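(* Let $\Sigma$ be a smooth compact torus and let $F\colon[0,T)\times\Sigma\to\mathbb S^3$, $F_t=F(t,\cdot)$, be a maximal smooth solution of the Möbius-invariant Willmore flow (MIWF) starting from a smooth parametrization $F_0$ of a smooth Hopf torus, with $\mathcal W(F_0)\leq8\pi$ and $T=T_{\max}(F_0)<\infty$. Let $\gamma_t\colon\mathbb S^1\to\mathbb S^2$ be the oriented normal-gauge profile, $\widetilde\gamma_t$ its anchored constant-speed reparametrization, and let $\gamma_T$ (with length $L_T=L(\gamma_T)\in[\pi,8]$) be the limit of $\widetilde\gamma_t$ as $t\nearrow T$ (see the context). Orient the profiles consistently with the reduced flow. Let $\mathcal A_t\in\mathbb R/4\pi\mathbb Z$ be the oriented area class enclosed by $\gamma_t$, and $\mathcal A_T$ the corresponding area class for $\gamma_T$. Then $$\mathcal A_t\longrightarrow\mathcal A_T\qquad\text{in }\mathbb R/4\pi\mathbb Z\quad\text{as }t\nearrow T.$$ For $t$ sufficiently close to $T$, choose compatible real representatives such that $\mathcal A_t\to\mathcal A_T$ in $\mathbb R$. Pinkall's lattice of the Hopf torus over $\gamma_t$ is $$\Gamma_t=\operatorname{span}_{\mathbb Z}\left\{(2\pi,0),\left(\frac{\mathcal A_t}2,\frac{L(\gamma_t)}2\right)\right\},$$ and the corresponding modulus is $$\tau_t=\frac{\mathcal A_t+iL(\gamma_t)}{4\pi}\in\mathbb H .$$ It satisfies $$\tau_t\longrightarrow\tau_T:=\frac{\mathcal A_T+iL_T}{4\pi},\qquad\frac14\leq\operatorname{Im}\tau_T\leq\frac2\pi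 .$$ Consequently the conformal classes $[\tau_t]\to[\tau_T]$ in $\mathcal M_1=\mathbb H/\mathrm{PSL}_2(\mathbb Z)$ have a unique finite-time limit, independent of the approaching time sequence. With the orientation induced by the fixed oriented profile and the positively oriented Hopf fibres, the class $[\tau_T]$ is the intrinsic oriented conformal class of the limiting $C^1$ Hopf torus $\pi^{-1}(\gamma_T(\mathbb S^1))$ (with its induced metric). In particular, no conformal degeneration occurs at the finite endpoint.
   Context: **Flow.** $\mathbb S^3\subset\mathbb R^4$ is the unit sphere with round metric $g_{\mathbb S^3}$. For a smooth immersion $F_t\colon\Sigma\to\mathbb S^3$: $g_t:=F_t^*g_{\mathbb S^3}$, $\mu_t$ is its area measure, and $A_t,A_t^0,H_t$ are the second fundamental form, its trace-free part, and the trace mean-curvature vector of $F_t$ in $\mathbb S^3$. $\mathcal W(F_t)=\int_\Sigma(1+\frac14|H_t|^2)\,\mathrm d\mu_t$. The $L^2$-gradient $G_t$ is the normal field with $D\mathcal W(F_t)[\phi]=\int_\Sigma\langle G_t,\phi\rangle\,\mathrm d\mu_t$ for all smooth normal fields $\phi$. A smooth MIWF is a smooth family of umbilic-free immersions satisfying $\partial_tF_t=-|A_t^0|^{-4}G_t$. $T_{\max}(F_0)$ is the right endpoint of the maximal interval of existence of the smooth MIWF starting from $F_0$. **Hopf tori and profiles.** $\pi\colon\mathbb S^3\to\mathbb S^2$ is the standard Hopf fibration onto the unit sphere, so $|D\pi(v)|=2|v|$ for horizontal $v$ and fibres have length $2\pi$. The Hopf torus of a regular closed curve $\gamma\colon\mathbb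 S^1=\mathbb R/\mathbb Z\to\mathbb S^2$ is the immersed torus $\{(x,p)\in\mathbb S^1\times\mathbb S^3:\pi(p)=\gamma(x)\}\to\mathbb S^3$, $(x,p)\mapsto p$; a smooth parametrization is this immersion composed with a diffeomorphism from $\Sigma$. $L(\gamma)=\int\mathrm ds_\gamma$, $E(\gamma)=\int(1+\kappa_\gamma^2)\,\mathrm ds_\gamma$, $\kappa_\gamma$ the signed geodesic curvature. In the setting of the claim there is a smooth family $(\gamma_t)_{0\le t<T}$ of regular oriented closed curves (the normal-gauge profile) solving the reduced flow $\partial_t\gamma_t=-(1+\kappa_{\gamma_t}^2)^{-2}\nabla_{L^2}E(\gamma_t)$ ($L^2(\mathrm ds_{\gamma_t})$-gradient) such that $F_t$ is a smooth parametrization of the Hopf torus of $\gamma_t$. **Anchored gauge and limit.** $\phi_t(x):=\frac1{L(\gamma_t)}\int_0^x|\partial_z\gamma_t(z)|\,\mathrm dz$ for $x\in[0,1]$ (extended equivariantly), $\psi_t:=\phi_t^{-1}$, $\widetilde\gamma_t:=\gamma_t\circ\psi_t$. In this setting $\widetilde\gamma_t$ converges as $t\nearrow T$, weakly in $W^{2,2}$ and strongly in $C^{1,\alpha}$ for every $0<\alpha<\frac12$, to an embedded regular curve $\gamma_T\in W^{2,2}\cap C^1(\mathbb S^1,\mathbb S^2)$ of constant speed $L_T=L(\gamma_T)\in[\pi,8]$, and $L(\gamma_t)\to L_T$; $\pi^{-1}(\gamma_T(\mathbb S^1))$ is the support of the limit varifold of the flow. **Area class and moduli.** The oriented area class $\mathcal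 A_\gamma\in\mathbb R/4\pi\mathbb Z$ of an oriented closed curve $\gamma$ in $\mathbb S^2$ is the signed area (with respect to $\mathrm dV_{\mathbb S^2}$) of any disc or two-chain in $\mathbb S^2$ bounded by $\gamma$, well defined modulo $4\pi$. Orientations are those of Pinkall: the Hopf connection (horizontal spaces orthogonal to the fibres) has curvature $\frac12\mathrm dV_{\mathbb S^2}$, and the holonomy angle of $\gamma$ is $\delta_\gamma=\mathcal A_\gamma/2\pmod{2\pi}$. $\mathbb H$ is the upper half-plane; the modulus of a lattice is obtained by identifying $\mathbb R^2=\mathbb C$ and dividing the second listed generator by the first; $\mathcal M_1=\mathbb H/\mathrm{PSL}_2(\mathbb Z)$ is the moduli space of oriented conformal classes of tori and $[\tau]$ the class of $\tau$. *)

(* Defs.v *)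
From HB Require Import structures.
From mathcomp Require Import all_boot all_order all_algebra.
From mathcomp Require Import all_classical all_reals all_analysis.
From mathcomp Require Import complex ring.

Set Implicit Arguments.
Unset Strict Implicit.
Unset Printing Implicit Defensive.

Import Order.TTheory GRing.Theory Num.Theory.
Import numFieldNormedType.Exports.

Local Open Scope classical_set_scope.
Local Open Scope ring_scope.
Local Open Scope quotient_scope.

Section Smoothness.
Context {R : realType}.

Fixpoint Ck (V W : normedModType R) (k : nat) (U : set V) (f : V -> W) : Prop :=
  (forall x, U x -> {for x, continuous f}) /\
  if k is k'.+1 then
    forall v, (forall x, U x -> derivable f x v) /\ Ck k' U (fun x => 'D_v f x)
  else True.

Definition smooth (V W : normedModType R) (f : V -> W) : Prop :=
  forall k, Ck k setT f.

(* Smoothness on an arbitrary subset [A]: local smooth extendability; on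
   [0, T[ x R^n this is smoothness up to and including time 0. *)
Definition smooth_on (V W : normedModType R) (A : set V) (f : V -> W) : Prop :=
  forall x, A x -> exists U : set V, exists g : V -> W,
    [/\ open U, U x, forall k, Ck k U g & forall y, A y -> U y -> f y = g y].

(* [d] is the derivative at [t] of [c : [0, T[ -> W], one-sided if t = 0. *)
Definition time_derivative (W : normedModType R) (c : R -> W) (t : R) (d : W) :=
  h^-1 *: (c (t + h) - c t)
    @[h --> within [set h | h != 0 /\ 0 <= t + h] (nbhs (0 : R))] --> d.

End Smoothness.

Section Euclidean.
Context {R : realType}.

Definition rvec n (s : seq R) : 'rV[R]_n := \row_i s`_i.
Definition co n (p : 'rV[R]_n.+1) (k : nat) : R := p 0 (inord k).
Definition pt (u v : R) : 'rV[R]_2 := rvec 2 [:: u; v].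

Definition dot n (u v : 'rV[R]_n) : R := \sum_i u 0 i * v 0 i.
Definition enorm n (u : 'rV[R]_n) : R := Num.sqrt (dot u u).
Definition on_sphere n (u : 'rV[R]_n) : Prop := enorm u = 1.
Definition to_sphere n (u : 'rV[R]_n) : 'rV[R]_n := (enorm u)^-1 *: u.

Definition triple (u v w : 'rV[R]_3) : R :=
  \det (\matrix_(i < 3) nth 0 [:: u; v; w] i).

Definition lattice (v w : 'rV[R]_2) : set 'rV[R]_2 :=
  [set z | exists m n : int, z = v *~ m + w *~ n].

End Euclidean.

Section TorusGeometry.
Context {R : realType}.
Local Notation leb := (@lebesgue_measure R).
Implicit Types (F G phi : 'rV[R]_2 -> 'rV[R]_4) (z : 'rV[R]_2).

Definition int_lattice : set 'rV[R]_2 := lattice (pt 1 0) (pt 0 1).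

Definition torus_periodic (W : Type) (f : 'rV[R]_2 -> W) : Prop :=
  forall z m, int_lattice m -> f (z + m) = f z.

Definition torus_int (f : 'rV[R]_2 -> R) : R :=
  \int[leb]_(u in `[0, 1]) \int[leb]_(v in `[0, 1]) f (pt u v).

Definition pd (W : normedModType R) (i : 'I_2) (f : 'rV[R]_2 -> W) z : W :=
  'D_(delta_mx 0 i) f z.

Definition sphere_immersion F : Prop :=
  [/\ torus_periodic F, smooth F, forall z, on_sphere (F z)
    & forall z v, v != 0 -> 'D_v F z != 0].

Definition metric F z : 'M[R]_2 := \matrix_(i, j) dot (pd i F z) (pd j F z).
Definition area_density F z : R := Num.sqrt (\det (metric F z)).

(* Orthogonal projection onto the normal space of the immersion in T S^3, i.e.
   onto the orthogonal complement of F, d_0 F, d_1 F in R^4. *)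
Definition normal_part F z (w : 'rV[R]_4) : 'rV[R]_4 :=
  w - dot w (F z) *: F z
  - \sum_i \sum_j (invmx (metric F z) i j * dot w (pd i F z)) *: pd j F z.

Definition second_ff F z (i j : 'I_2) : 'rV[R]_4 :=
  normal_part F z (pd i (pd j F) z).

Definition mean_curvature F z : 'rV[R]_4 :=
  \sum_i \sum_j invmx (metric F z) i j *: second_ff F z i j.

Definition tracefree_ff F z (i j : 'I_2) : 'rV[R]_4 :=
  second_ff F z i j - (2^-1 * metric F z i j) *: mean_curvature F z.

Definition tracefree_normsq F z : R :=
  \sum_i \sum_j \sum_k \sum_l
    invmx (metric F z) i k * invmx (metric F z) j l
      * dot (tracefree_ff F z i j) (tracefree_ff F z k l).

Definition umbilic_free F : Prop := forall z, tracefree_normsq F z != 0.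

Definition Willmore F : R :=
  torus_int (fun z => (1 + 4^-1 * dot (mean_curvature F z) (mean_curvature F z))
                      * area_density F z).

Definition normal_field F phi : Prop :=
  [/\ torus_periodic phi, smooth phi, forall z, dot (phi z) (F z) = 0
    & forall z i, dot (phi z) (pd i F z) = 0].

Definition Willmore_gradient F G : Prop :=
  normal_field F G /\
  forall phi, normal_field F phi ->
    is_derive (0 : R) (1 : R)
      (fun s : R => Willmore (fun z => to_sphere (F z + s *: phi z)))
      (torus_int (fun z => dot (G z) (phi z) * area_density F z)).

Definition MIWF (T : R) (F : R -> 'rV[R]_2 -> 'rV[R]_4) : Prop :=
  [/\ 0 < T,
      smooth_on [set q : R * 'rV[R]_2 | 0 <= q.1 < T] (fun q => F q.1 q.2),
      forall t, 0 <= t < T -> sphere_immersion (F t) /\ umbilic_free (F t)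
    & forall t, 0 <= t < T -> exists2 G, Willmore_gradient (F t) G &
        forall z, time_derivative (F ^~ z) t
                    (- ((tracefree_normsq (F t) z) ^- 2 *: G z))].

Definition Tmax F : \bar R :=
  ereal_sup [set T%:E | T in
    [set T : R | exists2 F', MIWF T F' & forall z, F' 0 z = F z]].

End TorusGeometry.

Section Curves.
Context {R : realType}.
Local Notation leb := (@lebesgue_measure R).
Implicit Types (g V phi : R -> 'rV[R]_3) (x : R).

Definition closed_curve g : Prop :=
  [/\ forall x, g (x + 1) = g x, forall x, on_sphere (g x),
      Ck 1 setT g & forall x, derive1 g x != 0].

Definition speed g x : R := enorm (derive1 g x).

Definition clength g : R := \int[leb]_(x in `[0, 1]) speed g x.

Definition curvature g x : R :=
  triple (g x) (derive1 g x) (derive1n 2 g x) / speed g x ^+ 3.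

Definition elastic_energy g : R :=
  \int[leb]_(x in `[0, 1]) ((1 + curvature g x ^+ 2) * speed g x).

Definition tangent_field_along g phi : Prop :=
  [/\ forall x, phi (x + 1) = phi x, smooth phi
    & forall x, dot (phi x) (g x) = 0].

Definition elastic_gradient g V : Prop :=
  tangent_field_along g V /\
  forall phi, tangent_field_along g phi ->
    is_derive (0 : R) (1 : R)
      (fun s : R => elastic_energy (fun x => to_sphere (g x + s *: phi x)))
      (\int[leb]_(x in `[0, 1]) (dot (V x) (phi x) * speed g x)).

Definition reduced_flow (T : R) (g : R -> R -> 'rV[R]_3) : Prop :=
  [/\ smooth_on [set q : R * R | 0 <= q.1 < T] (fun q => g q.1 q.2),
      forall t, 0 <= t < T -> smooth (g t) /\ closed_curve (g t)
    & forall t, 0 <= t < T -> exists2 V, elastic_gradient (g t) V &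
        forall x, time_derivative (g ^~ x) t
                    (- ((1 + curvature (g t) x ^+ 2) ^- 2 *: V x))].

Definition arc_phase g x : R :=
  (Num.floor x)%:~R
  + (clength g)^-1 * \int[leb]_(y in `[0, x - (Num.floor x)%:~R]) speed g y.

Definition arc_phase_inv g x : R := xget 0 [set y | arc_phase g y = x].

Definition anchored g : R -> 'rV[R]_3 := g \o arc_phase_inv g.

Definition L2_01 (f : R -> R) : Prop :=
  measurable_fun (`[0, 1] : set R) f /\
  leb.-integrable `[0, 1] (fun x => (f x ^+ 2)%:E).

Definition weak_derivative (f w : R -> R) : Prop :=
  forall phi : R -> R, smooth phi -> (forall x, phi (x + 1) = phi x) ->
    \int[leb]_(x in `[0, 1]) (f x * derive1 phi x)
    = - \int[leb]_(x in `[0, 1]) (w x * phi x).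

Definition weakL2_cvg (T : R) (f : R -> R -> 'rV[R]_3) g : Prop :=
  forall (i : 'I_3) (phi : R -> R), L2_01 phi ->
    \int[leb]_(x in `[0, 1]) (f t x 0 i * phi x) @[t --> T^'-]
      --> \int[leb]_(x in `[0, 1]) (g x 0 i * phi x).

Definition weakW22_cvg (T : R) (f : R -> R -> 'rV[R]_3) g : Prop :=
  exists w : R -> 'rV[R]_3,
    [/\ forall i, L2_01 (fun x => w x 0 i),
        forall i, weak_derivative (fun x => derive1 g x 0 i) (fun x => w x 0 i),
        weakL2_cvg T f g,
        weakL2_cvg T (fun t => derive1 (f t)) (derive1 g)
      & weakL2_cvg T (fun t => derive1n 2 (f t)) w].

Definition C1alpha_cvg (T alpha : R) (f : R -> R -> 'rV[R]_3) g : Prop :=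
  forall e : R, 0 < e -> \forall t \near T^'-,
    [/\ forall x, enorm (f t x - g x) <= e,
        forall x, enorm (derive1 (f t) x - derive1 g x) <= e
      & forall x y, enorm ((derive1 (f t) x - derive1 g x) - (derive1 (f t) y - derive1 g y))
                    <= e * `|x - y| `^ alpha].

Definition embedded g : Prop :=
  forall x y, g x = g y -> x - y \is a Num.int.

Definition profile_limit (T : R) (g : R -> R -> 'rV[R]_3) (gT : R -> 'rV[R]_3)
    : Prop :=
  [/\ [/\ closed_curve gT, embedded gT
        & forall x, speed gT x = clength gT],
      weakW22_cvg T (fun t => anchored (g t)) gT,
      forall alpha, 0 < alpha < 2^-1 ->
        C1alpha_cvg T alpha (fun t => anchored (g t)) gT,
      clength (g t) @[t --> T^'-] --> clength gT
    & pi <= clength gT <= 8].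

End Curves.

Section AreaClass.
Context {R : realType}.
Local Notation leb := (@lebesgue_measure R).

Definition area_rel (a b : R) : bool := (a - b) / (4 * pi) \is a Num.int.

Lemma area_rel_equiv : equiv_class_of area_rel.
Proof.
split=> [a|a b|b a c]; rewrite /area_rel.
- by rewrite subrr mul0r.
- by rewrite -opprB mulNr rpredN.
- move=> ab bc; rewrite (_ : a - c = (a - b) + (b - c)); last by ring.
  by rewrite mulrDl rpredD.
Qed.

Canonical area_rel_canonical := EquivRelPack area_rel_equiv.

Definition Rmod4pi := quotient_topology {eq_quot area_rel}.

Definition mod4pi (a : R) : Rmod4pi := \pi_Rmod4pi a.

(* A disc in S^2 bounded by [g], in polar coordinates: [h s x] at radius [s]
   and angle [x]. The regularity class (h of class C^1 and d_s h of class C^1)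
   contains the geodesic cones over closed C^1 curves. *)
Definition spanning_disc (g : R -> 'rV[R]_3) (h : R * R -> 'rV[R]_3) : Prop :=
  [/\ Ck 1 setT h, Ck 1 setT (fun q => 'D_(1, 0) h q),
      forall q, on_sphere (h q), forall s x, h (s, x + 1) = h (s, x)
    & (forall x, h (0, x) = h (0, 0)) /\ (forall x, h (1, x) = g x)].

(* S^2 is oriented by its outward normal: dV_p(v, w) = det(p, v, w). *)
Definition signed_area (h : R * R -> 'rV[R]_3) : R :=
  \int[leb]_(s in `[0, 1]) \int[leb]_(x in `[0, 1])
    triple (h (s, x)) ('D_(1, 0) h (s, x)) ('D_(0, 1) h (s, x)).

Definition area_class (g : R -> 'rV[R]_3) : Rmod4pi :=
  get [set mod4pi (signed_area h) | h in spanning_disc g].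

End AreaClass.

Section Hopf.
Context {R : realType}.

(* With z1 = p0 + i p1 and z2 = p2 + i p3: (|z1|^2 - |z2|^2, 2 conj(z1) z2). *)
Definition hopf (p : 'rV[R]_4) : 'rV[R]_3 :=
  rvec 3 [:: co p 0 ^+ 2 + co p 1 ^+ 2 - co p 2 ^+ 2 - co p 3 ^+ 2;
             2 * (co p 0 * co p 2 + co p 1 * co p 3);
             2 * (co p 0 * co p 3 - co p 1 * co p 2)].

(* The positive unit fibre direction i p, velocity of e^{i theta} p. The
   connection form omega(v) = <v, i p> satisfies d omega = 1/2 hopf^* dV for the
   outward orientation of S^2. *)
Definition fibre_dir (p : 'rV[R]_4) : 'rV[R]_4 :=
  rvec 4 [:: - co p 1; co p 0; - co p 3; co p 2].

(* z |-> (a z mod 1, X z) induces a bijection from R^2 / Lam onto the pull-back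
   {(x, p) in S^1 x S^3 | hopf p = g x}. *)
Definition hopf_torus_cover (g : R -> 'rV[R]_3) (Lam : set 'rV[R]_2)
    (a : 'rV[R]_2 -> R) (X : 'rV[R]_2 -> 'rV[R]_4) : Prop :=
  [/\ forall z, on_sphere (X z), forall z, hopf (X z) = g (a z),
      forall z w, Lam (z - w) <-> X z = X w /\ a z - a w \is a Num.int
    & forall x p, on_sphere p -> hopf p = g x ->
        exists2 z, X z = p & a z - x \is a Num.int].

(* The induced bijection from R^2 / Z^2 is a diffeomorphism: it is smooth, and
   its inverse locally lifts to smooth maps [b] into R^2. *)
Definition hopf_parametrization (g : R -> 'rV[R]_3) (F : 'rV[R]_2 -> 'rV[R]_4)
    : Prop :=
  exists a : 'rV[R]_2 -> R,
    [/\ smooth (a : 'rV[R]_2 -> R^o), smooth F, hopf_torus_cover g int_lattice a F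
      & forall z, exists U : set (R * 'rV[R]_4), exists b : R * 'rV[R]_4 -> 'rV[R]_2,
          [/\ open U, U (a z, F z), forall k, Ck k U b
            & forall q, U q -> on_sphere q.2 -> hopf q.2 = g q.1 ->
                a (b q) = q.1 /\ F (b q) = q.2]].

Definition normal_gauge_profile (T : R) (F : R -> 'rV[R]_2 -> 'rV[R]_4)
    (g : R -> R -> 'rV[R]_3) : Prop :=
  reduced_flow T g /\
  forall t, 0 <= t < T -> hopf_parametrization (g t) (F t).

(* The Hopf torus of [g] with its induced metric is R^2 / Lam, the first
   coordinate being the angle along the positively oriented fibres and the
   second the arclength of horizontal curves positively oriented by [g]. *)
Definition Pinkall_lattice (g : R -> 'rV[R]_3) (Lam : set 'rV[R]_2) : Prop :=
  exists a : 'rV[R]_2 -> R, exists X : 'rV[R]_2 -> 'rV[R]_4,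
    [/\ Ck 1 setT (a : 'rV[R]_2 -> R^o), Ck 1 setT X, hopf_torus_cover g Lam a X,
        forall z, pd 0 X z = fibre_dir (X z)
      & forall z, metric X z = 1%:M /\
          0 < dot (pd 1 (hopf \o X) z) (derive1 g (a z))].

Definition hopf_preimage (g : R -> 'rV[R]_3) : set 'rV[R]_4 :=
  [set p | on_sphere p /\ exists x, hopf p = g x].

(* There is an orientation-preserving conformal C^1 diffeomorphism from
   R^2 / (Z (1, 0) + Z (Re tau, Im tau)) onto the preimage of the embedded curve
   [g], with the metric induced from S^3 and the orientation (fibre, g). *)
Definition uniformized_by (g : R -> 'rV[R]_3) (tau : R[i]) : Prop :=
  exists X : 'rV[R]_2 -> 'rV[R]_4,
    [/\ Ck 1 setT X,
        forall z w, lattice (pt 1 0) (pt (complex.Re tau) (complex.Im tau)) (z - w)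
                    <-> X z = X w,
        range X = hopf_preimage g,
        forall z, exists2 c, 0 < c & metric X z = c%:M
      & forall z x, hopf (X z) = g x ->
          0 < \det (\matrix_(i < 2, j < 2)
                      if j == 0 then dot (pd i X z) (fibre_dir (X z))
                      else dot (pd i (hopf \o X) z) (derive1 g x))].

End Hopf.

Section Moduli.
Context {R : realType}.

Definition upper : set (R[i] : numFieldType) := [set z | 0 < complex.Im z].

Definition modular_rel (z w : upper) : bool :=
  `[< exists a b c d : int, a * d - b * c = 1 /\
      val w = (a%:~R * val z + b%:~R) / (c%:~R * val z + d%:~R) >].

Lemma upper_gt0 (z : upper) : 0 < complex.Im (val z).
Proof. by case: z => z /= /set_mem. Qed.

Lemma modular_det (a b c d : int) : a * d - b * c = 1 ->
  a%:~R * d%:~R - b%:~R * c%:~R = 1 :> R[i].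
Proof. by move=> e; rewrite -!rmorphM -rmorphB /= e. Qed.

Lemma modular_den_neq0 (a b c d : int) (z : upper) : a * d - b * c = 1 ->
  c%:~R * val z + d%:~R != 0 :> R[i].
Proof.
move=> detM; apply/eqP; have := upper_gt0 z.
case: (val z) => x y /= y0.
rewrite -!(rmorph_int (real_complex R)) => -[] /=.
rewrite !(mul0r, addr0, subr0) => re0 /eqP.
rewrite mulf_eq0 (gt_eqF y0) orbF => c0; move: re0.
rewrite (eqP c0) mul0r add0r => /eqP; rewrite intr_eq0 => /eqP d0.
by move: c0; rewrite intr_eq0 => /eqP c0; move: detM; rewrite c0 d0 !mulr0 subr0.
Qed.

Lemma modular_rel_equiv : equiv_class_of modular_rel.
Proof.
have sym z w : modular_rel z w -> modular_rel w z.
  move=> /asboolP[a [b [c [d [detM wE]]]]]; apply/asboolP.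
  exists d, (- b), (- c), a; split; first by rewrite -detM; ring.
  have den := modular_den_neq0 z detM; move: wE => ->.
  have detC := modular_det detM; rewrite !rmorphN /=.
  have e1 : - c%:~R * ((a%:~R * val z + b%:~R) / (c%:~R * val z + d%:~R))
      + a%:~R = (c%:~R * val z + d%:~R)^-1 :> R[i].
    by apply: (mulIf den); rewrite mulVf // mulrDl mulrA mulfVK // -[RHS]detC; ring.
  have e2 : d%:~R * ((a%:~R * val z + b%:~R) / (c%:~R * val z + d%:~R))
      - b%:~R = val z / (c%:~R * val z + d%:~R) :> R[i].
    apply: (mulIf den); rewrite mulfVK // mulrDl mulrA mulfVK //.
    by rewrite -[RHS]mulr1 -[X in _ = _ * X]detC; ring.
  by rewrite e1 e2 invrK mulfVK.
split=> [z|z w|w z v].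
- apply/asboolP; exists 1, 0, 0, 1; split; first by rewrite mulr1 mulr0 subr0.
  by rewrite !(mul1r, mul0r, addr0, add0r) divr1.
- by apply/idP/idP; exact: sym.
- move=> /asboolP[a [b [c [d [detM wE]]]]] /asboolP[a' [b' [c' [d' [detN vE]]]]].
  apply/asboolP; exists (a' * a + b' * c), (a' * b + b' * d),
    (c' * a + d' * c), (c' * b + d' * d).
  split; first by rewrite -[RHS]mulr1 -[X in _ = X * _]detM -[X in _ = _ * X]detN; ring.
  have den1 := modular_den_neq0 z detM.
  have num x y : (x * a + y * c)%:~R * val z + (x * b + y * d)%:~R
      = (x%:~R * val w + y%:~R) * (c%:~R * val z + d%:~R) :> R[i].
    rewrite wE [RHS]mulrDl -[_ * _ * (_ + _)]mulrA mulfVK //.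
    by rewrite !rmorphD !rmorphM /=; ring.
  by rewrite !num -mulf_div divff // mulr1.
Qed.

Canonical modular_rel_canonical := EquivRelPack modular_rel_equiv.

Definition moduli := quotient_topology {eq_quot modular_rel}.

Lemma upper_i : upper 'i%C.
Proof. by rewrite /upper /=. Qed.

(* Meaningful only for tau in H (junk value [i] otherwise). *)
Definition torus_class (tau : R[i]) : moduli :=
  \pi_moduli (insubd (SigSub (mem_set upper_i) : upper) tau).

(* A conformal class c in M_1 is the class of all tori conformally equivalent to
   C / (Z + Z tau), c = [tau]; the Hopf torus over the embedded curve [g] is of
   class [c] when it is one of them, orientations being respected. *)
Definition oriented_conformal_class (g : R -> 'rV[R]_3) (c : moduli) : Prop :=
  exists tau : R[i], [/\ upper tau, torus_class tau = c & uniformized_by g tau].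

Definition complex_of_pt (v : 'rV[R]_2) : R[i] := (co v 0 +i* co v 1)%C.

Definition lattice_modulus (v w : 'rV[R]_2) : R[i] :=
  complex_of_pt w / complex_of_pt v.

Definition hopf_modulus (A L : R) : R[i] := (A +i* L)%C / ((4 * pi)%:C)%C.

Definition hopf_gen1 : 'rV[R]_2 := pt (2 * pi) 0.
Definition hopf_gen2 (A L : R) : 'rV[R]_2 := pt (A / 2) (L / 2).

Definition compatible_areas (T : R) (g : R -> R -> 'rV[R]_3)
    (gT : R -> 'rV[R]_3) (A : R -> R) (AT : R) : Prop :=
  [/\ \forall t \near T^'-, mod4pi (A t) = area_class (g t),
      mod4pi AT = area_class gT & A t @[t --> T^'-] --> AT].

End Moduli.

(* Main.v *)
Require Import Defs.
From HB Require Import structures.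
From mathcomp Require Import all_boot all_order all_algebra.
From mathcomp Require Import all_classical all_reals all_analysis.
From mathcomp Require Import complex.
From mathcomp Require Import ring lra zify.

Set Implicit Arguments.
Unset Strict Implicit.
Unset Printing Implicit Defensive.

Import Order.TTheory GRing.Theory Num.Theory.
Import numFieldNormedType.Exports.

Local Open Scope classical_set_scope.
Local Open Scope ring_scope.

(** The theorem rests on one formula. For a pole p whose antipode is not on a
    loop g of the unit sphere, the geodesic cone from p over g has area

      cone_area p g = int_0^1 triple p g g' / (1 + p . g) dx.

    Half the integrand is also the connection form of an explicit section of the
    Hopf map along g, namely the point of the fibre over g x closest to a fixed
    point q over p. Turning this section back by its accumulated angle gives a
    horizontal lift of g (hlift), whose holonomy is therefore half the cone area
    (hlift_period), and horizontal lifts are unique up to a constant phase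
    (horizontal_unique). This has four consequences.

    The cone area modulo 4 pi does not depend on the pole (cone_area_indep). By
    Stokes' theorem on the circles of a disc, using near each circle a pole that
    suits it, every disc spanning g then has the area of the cone modulo 4 pi
    (disc_area); a pole exists because a C^1 loop does not fill the sphere
    (exists_avoids), and a spanning disc exists because the cone is one
    (cone_disc_spanning). So the area class is the class of the cone area
    (area_class_cone).

    The formula is invariant under reparametrization (cone_area_anchored) and
    continuous in the C^1 topology (cone_area_close). The C^1 convergence of the
    anchored profiles hence makes the areas converge, and with the convergence of
    the lengths the moduli converge in the upper half-plane.

    Rotating a horizontal lift of the constant-speed curve along the fibres gives
    an isometric cover of the Hopf torus by the plane. Its periods are a full
    turn of the fibre and one turn around the curve corrected by the holonomy:
    this is Pinkall's lattice (Pinkall_of_curve). Divided by 2 pi it is the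
    lattice of 1 and the modulus, so over the embedded limit curve the cover is
    the required uniformization (uniformized_of_Pinkall).

    Finally, conformal classes converge because the projection to the moduli
    space is continuous. A limit is unique because the modular group acts
    properly discontinuously (modular_separation): the equation
    |c z + d|^2 = Im z / Im w bounds the matrices that move z close to w. A
    closed rectangle around the limit modulus projects to the compact set that
    excludes degeneration. *)

(** * Directional derivatives and global primitives *)

Section DirectionalCalculus.
Context {R : realType} {V : normedModType R}.
Implicit Types (f g : V -> R) (x v : V).

Lemma is_derive_add f g x v a b : is_derive x v f a -> is_derive x v g b ->
  is_derive x v (fun y => f y + g y) (a + b).
Proof. by move=> *; exact: is_deriveD. Qed.

Lemma is_derive_sub f g x v a b : is_derive x v f a -> is_derive x v g b ->
  is_derive x v (fun y => f y - g y) (a - b).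
Proof. by move=> *; exact: is_deriveB. Qed.

Lemma is_derive_opp f x v a : is_derive x v f a ->
  is_derive x v (fun y => - f y) (- a).
Proof. by move=> *; exact: is_deriveN. Qed.

Lemma is_derive_mul f g x v a b : is_derive x v f a -> is_derive x v g b ->
  is_derive x v (fun y => f y * g y) (a * g x + f x * b).
Proof.
move=> fa gb; apply: is_derive_eq (is_deriveM fa gb) _.
by rewrite /GRing.scale /=; ring.
Qed.

Lemma is_derive_const (c : R) x v : is_derive x v (fun=> c) 0.
Proof. exact: is_derive_cst. Qed.

Lemma is_derive_inv f x v a : f x != 0 -> is_derive x v f a ->
  is_derive x v (fun y => (f y)^-1) (- a / f x ^+ 2).
Proof.
move=> fx [fd fa]; apply: DeriveDef; first exact: derivableV.
by rewrite deriveV // fa /GRing.scale /= mulNr mulrC -mulNr.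
Qed.

End DirectionalCalculus.

Section C1.
Context {R : realType} {V : normedModType R}.

Lemma C1P (W : normedModType R) (f : V -> W) :
  Ck 1 setT f <->
  continuous f /\ forall v, (forall x, derivable f x v) /\ continuous ('D_v f).
Proof.
split=> -[fc fd].
  by split=> [x|v]; [exact: fc|have [d1 [d2 _]] := fd v; split=> x; [exact: d1|exact: d2]].
split=> [x _|v]; first exact: fc.
by have [d1 d2] := fd v; split=> [x _|]; [exact: d1|split=> // x _; exact: d2].
Qed.

Lemma C1_intro (W : normedModType R) (f : V -> W) (df : V -> V -> W) :
  continuous f -> (forall v x, is_derive x v f (df v x)) ->
  (forall v, continuous (df v)) -> Ck 1 setT f.
Proof.
move=> fc fd dfc; apply/C1P; split=> // v; split=> [x|].
  by have [] := fd v x.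
rewrite (_ : 'D_v f = df v) //; apply/funext => x.
by have [_ ->] := fd v x.
Qed.

End C1.

Section Primitive.
Context {R : realType}.
Local Notation leb := (@lebesgue_measure R).
Implicit Types (f g : R -> R) (x : R).

Lemma integrable_segment f a b : continuous f ->
  leb.-integrable `[a, b] (EFin \o f).
Proof.
move=> fc; apply: continuous_compact_integrable; first exact: segment_compact.
exact: continuous_subspaceT.
Qed.

(** Both integrals are needed so that one formula is a primitive on the whole
    line: for x < 0 the first interval is empty, for 0 < x the second one is. *)
Definition prim f x : R :=
  \int[leb]_(y in `[0, x]) f y - \int[leb]_(y in `[x, 0]) f y.

(** Starting the integral further left makes x an interior right endpoint,
    which is what the fundamental theorem of calculus asks for. *)
Lemma prim_shift f (N x : R) : continuous f -> 0 <= N -> - N <= x ->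
  prim f x = \int[leb]_(y in `[- N, x]) f y - \int[leb]_(y in `[- N, 0]) f y.
Proof.
move=> fc N0 Nx.
have oc a b : \int[leb]_(y in `]a, b]) f y = \int[leb]_(y in `[a, b]) f y.
  apply: Rintegral_itv_obnd_cbnd.
  apply: integrableS (integrable_segment a b fc) => //; exact: subset_itv_oc_cc.
have sub a b c : a <= b -> b <= c ->
   \int[leb]_(y in `[a, c]) f y = \int[leb]_(y in `[a, b]) f y + \int[leb]_(y in `[b, c]) f y.
  move=> ab bc; rewrite -[in RHS](oc b c) -(@Rintegral_itvB _ f (BLeft a) (BRight c) b) ?bnd_simp//.
    by ring.
  exact: integrable_segment.
rewrite /prim; have [x0|x0] := leP 0 x.
  rewrite (sub (- N) 0 x) ?oppr_le0 // [X in _ - X](_ : _ = 0); first by ring.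
  have [x00|xlt] := eqVneq x 0; first by rewrite x00 set_itv1 Rintegral_set1.
  by rewrite set_itv_ge ?Rintegral_set0 // bnd_simp -ltNge lt_neqAle eq_sym xlt.
rewrite (sub (- N) x 0) ?(ltW x0) // [X in X - _](_ : _ = 0); first by ring.
by rewrite set_itv_ge ?Rintegral_set0 // bnd_simp -ltNge.
Qed.

Lemma is_derive_prim f x : continuous f -> is_derive x 1 (prim f) (f x).
Proof.
move=> fc; pose N := `|x| + 1.
have N0 : 0 <= N by rewrite addr_ge0.
have Nx : - N < x by rewrite ltrNl (le_lt_trans (ler_norm (- x))) // normrN ltrDl.
have xx : x < x + 1 by rewrite ltrDl.
have [dF eF] := @continuous_FTC1_closed _ f (- N) x (x + 1) xx (integrable_segment _ _ fc) Nx (fc x).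
apply: (@near_eq_is_derive _ _ _ (fun x => \int[leb]_(y in `[- N, x]) f y - \int[leb]_(y in `[- N, 0]) f y)).
  near=> y; apply/esym/prim_shift => //; apply/ltW; near: y.
  exact: lt_nbhsr.
rewrite -[f x]subr0; apply: is_derive_sub.
by apply: DeriveDef; rewrite -?derive1E.
Unshelve. all: by end_near. Qed.

Lemma prim0 f : prim f 0 = 0.
Proof. by rewrite /prim set_itv1 Rintegral_set1 subrr. Qed.

Lemma prim_ge0 f x : 0 <= x -> prim f x = \int[leb]_(y in `[0, x]) f y.
Proof.
rewrite le_eqVlt => /predU1P[<-|x0]; first by rewrite prim0 set_itv1 Rintegral_set1.
by rewrite /prim [in X in _ - X]set_itv_ge ?bnd_simp -?ltNge // Rintegral_set0 subr0.
Qed.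

Lemma prim1 f : \int[leb]_(x in `[0, 1]) f x = prim f 1.
Proof. by rewrite prim_ge0. Qed.

Lemma derive_continuous f (df : R -> R) :
  (forall x, is_derive x 1 f (df x)) -> continuous f.
Proof.
by move=> h x; apply/differentiable_continuous/derivable1_diffP; have [] := h x.
Qed.

Lemma derive_eq_cst f g (df : R -> R) x y :
  (forall x, is_derive x 1 f (df x)) -> (forall x, is_derive x 1 g (df x)) ->
  f x - f y = g x - g y.
Proof.
move=> ff gg.
have := @is_derive_0_is_cst _ (fun x => f x - g x) x y; move=> h.
have /h : forall x, is_derive x 1 (fun x => f x - g x) 0.
  by move=> z; rewrite -(subrr (df z)); exact: is_derive_sub.
by move=> e; lra.
Qed.

Lemma prim_unique f (F : R -> R) x : continuous f ->
  (forall x, is_derive x 1 F (f x)) -> prim f x = F x - F 0.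
Proof.
move=> fc dF; rewrite -[LHS]subr0 -[X in X = _]/(prim f x - 0) -[X in _ - X = _](prim0 f).
apply: (@derive_eq_cst (prim f) F f) => // y; exact: is_derive_prim.
Qed.

(** Comparing two integrals over a period at one well-chosen point replaces
    all estimates under the integral sign in the sequel. *)
Lemma prim_mvt f : continuous f -> exists2 c, 0 <= c <= 1 & prim f 1 = f c.
Proof.
move=> fc.
have [|c|c + e] := @MVT_segment _ (prim f) f 0 1 ler01.
- by move=> x _; exact: is_derive_prim.
- apply: continuous_subspaceT.
  by apply: (@derive_continuous _ f) => ?; exact: is_derive_prim.
by rewrite in_itv /= => c01; exists c => //; move: e; rewrite prim0 !subr0 mulr1.
Qed.

Lemma prim_lin f g (a : R) x : continuous f -> continuous g ->
  prim (fun x => a * f x + g x) x = a * prim f x + prim g x.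
Proof.
move=> fc gc.
have h (y : R) : is_derive y 1 (fun x => a * prim f x + prim g x) (a * f y + g y).
  apply: is_derive_add; last by exact: is_derive_prim.
  have := is_derive_mul (is_derive_const a y (1 : R)) (is_derive_prim y fc).
  by rewrite mul0r add0r.
rewrite (prim_unique x _ h) ?prim0 ?mulr0 ?addr0 ?subr0 //.
by move=> y; apply: cvgD; [apply: cvgM; [exact: cvg_cst|exact: fc]|exact: gc].
Qed.

Lemma prim_cst (c x : R) : prim (fun=> c) x = c * x.
Proof.
have h (y : R) : is_derive y 1 (fun x : R => c * x) c.
  have := is_derive_mul (is_derive_const c y (1 : R)) (is_derive_id y (1 : R)).
  by rewrite mul0r add0r mulr1.
rewrite (prim_unique x _ h) ?mulr0 ?subr0 //.
by move=> y; exact: cvg_cst.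
Qed.

Lemma prim_period f x : continuous f -> (forall x, f (x + 1) = f x) ->
  prim f (x + 1) = prim f x + prim f 1.
Proof.
move=> fc fp.
have h (y : R) : is_derive y 1 (fun y => prim f (y + 1)) (f y).
  rewrite -(fp y) -[f (y + 1)]mulr1.
  apply: (@is_derive1_comp _ (prim f) (fun y => y + 1)); first exact: is_derive_prim.
  by have := is_derive_add (is_derive_id y (1 : R)) (is_derive_const 1 y (1 : R)); rewrite addr0.
by rewrite (prim_unique x fc h) add0r subrK.
Qed.

End Primitive.

(** * Coordinates, and the algebra of the Hopf map *)

Section Coordinates.
Context {R : realType}.

Lemma co_rvec n (s : seq R) k : (k <= n)%N -> co (rvec n.+1 s) k = s`_k.
Proof. by move=> kn; rewrite /co /rvec mxE inordK. Qed.

Lemma coD n (u v : 'rV[R]_n.+1) k : co (u + v) k = co u k + co v k.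
Proof. by rewrite /co mxE. Qed.

Lemma coN n (u : 'rV[R]_n.+1) k : co (- u) k = - co u k.
Proof. by rewrite /co mxE. Qed.

Lemma coZ n a (u : 'rV[R]_n.+1) k : co (a *: u) k = a * co u k.
Proof. by rewrite /co mxE. Qed.

Lemma co0 n k : co (0 : 'rV[R]_n.+1) k = 0.
Proof. by rewrite /co mxE. Qed.

Lemma co_ext n (u v : 'rV[R]_n.+1) :
  (forall k, (k <= n)%N -> co u k = co v k) -> u = v.
Proof.
move=> h; apply/rowP => i; have := h i; rewrite /co inord_val; apply.
by rewrite -ltnS.
Qed.

Lemma dotE n (u v : 'rV[R]_n.+1) : dot u v = \sum_(i < n.+1) co u i * co v i.
Proof. by apply: eq_bigr => i _; rewrite /co !inord_val. Qed.

Lemma dot3E (u v : 'rV[R]_3) :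
  dot u v = co u 0 * co v 0 + co u 1 * co v 1 + co u 2 * co v 2.
Proof. by rewrite dotE !big_ord_recl big_ord0 /= addr0 !addrA. Qed.

Lemma dot4E (u v : 'rV[R]_4) : dot u v =
  co u 0 * co v 0 + co u 1 * co v 1 + co u 2 * co v 2 + co u 3 * co v 3.
Proof. by rewrite dotE !big_ord_recl big_ord0 /= addr0 !addrA. Qed.

Lemma tripleE (u v w : 'rV[R]_3) : triple u v w =
  co u 0 * (co v 1 * co w 2 - co v 2 * co w 1)
  + co u 1 * (co v 2 * co w 0 - co v 0 * co w 2)
  + co u 2 * (co v 0 * co w 1 - co v 1 * co w 0).
Proof.
rewrite /triple (expand_det_row _ ord0) !big_ord_recl big_ord0 /cofactor.
rewrite !(expand_det_row _ ord0) !big_ord_recl !big_ord0 /cofactor !det_mx11.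
rewrite !mxE /= /co.
have e (x : 'rV[R]_3) (i : 'I_3) (k : nat) : nat_of_ord i = k -> x ord0 i = x ord0 (inord k).
  by move=> <-; rewrite inord_val.
rewrite (_ : (0 : 'I_1) = ord0); last exact/val_inj.
repeat match goal with |- context [@fun_of_matrix _ _ _ ?x ord0 (lift ?a ?b)] =>
  let k := eval compute in (nat_of_ord (lift a b)) in
  rewrite (e x (lift a b) k erefl) end.
rewrite (e _ ord0 0%N erefl) /bump /= ?add0n ?add1n. ring.
Qed.

Lemma enorm2 n (u : 'rV[R]_n.+1) : enorm u ^+ 2 = dot u u.
Proof.
by rewrite sqr_sqrtr // dotE sumr_ge0 // => i _; rewrite -expr2 sqr_ge0.
Qed.

Lemma enorm_ge0 n (u : 'rV[R]_n.+1) : 0 <= enorm u.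
Proof. exact: sqrtr_ge0. Qed.

Lemma on_sphereP n (u : 'rV[R]_n.+1) : on_sphere u <-> dot u u = 1.
Proof.
rewrite /on_sphere -enorm2; split=> [->|e]; first by rewrite expr1n.
by apply/eqP; rewrite -(@eqrXn2 _ 2) ?enorm_ge0 // e expr1n.
Qed.

End Coordinates.
Definition coE := (@coD, @coN, @coZ, @co_rvec, @co0).
Ltac coex := rewrite ?(dot3E, dot4E, tripleE) ?coE //=.

Section HopfAlgebra.
Context {R : realType}.
Implicit Types (p q : 'rV[R]_4) (y z : 'rV[R]_3) (u : R).

(** With q a vector of C^2 and y in R^3, this is the Hermitian matrix
    y_0 sigma_3 + y_1 sigma_1 + y_2 sigma_2 applied to q: a unit y gives the
    reflection whose +1 eigenline is the Hopf fibre over y. *)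
Definition herm y q : 'rV[R]_4 :=
  rvec 4 [:: co y 0 * co q 0 + co y 1 * co q 2 + co y 2 * co q 3;
             co y 0 * co q 1 + co y 1 * co q 3 - co y 2 * co q 2;
             co y 1 * co q 0 - co y 2 * co q 1 - co y 0 * co q 2;
             co y 1 * co q 1 + co y 2 * co q 0 - co y 0 * co q 3].

Definition rot u q : 'rV[R]_4 := cos u *: q + sin u *: fibre_dir q.

Lemma dotDl n (a b c : 'rV[R]_n.+1) : dot (a + b) c = dot a c + dot b c.
Proof. by rewrite !dotE -big_split; apply: eq_bigr => i _; rewrite coD mulrDl. Qed.
Lemma dotC n (a b : 'rV[R]_n.+1) : dot a b = dot b a.
Proof. by rewrite !dotE; apply: eq_bigr => i _; rewrite mulrC. Qed.
Lemma dotZl n k (a b : 'rV[R]_n.+1) : dot (k *: a) b = k * dot a b.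
Proof. by rewrite !dotE mulr_sumr; apply: eq_bigr => i _; rewrite coZ mulrA. Qed.
Lemma dotDr n (a b c : 'rV[R]_n.+1) : dot c (a + b) = dot c a + dot c b.
Proof. by rewrite !(dotC c) dotDl. Qed.
Lemma dotZr n k (a b : 'rV[R]_n.+1) : dot b (k *: a) = k * dot b a.
Proof. by rewrite !(dotC b) dotZl. Qed.

Lemma dot_hopf q : dot (hopf q) (hopf q) = dot q q ^+ 2.
Proof. by coex; ring. Qed.

Lemma dot_fibre q p : dot (fibre_dir q) (fibre_dir p) = dot q p.
Proof. by coex; ring. Qed.

Lemma dot_fibre_self q : dot q (fibre_dir q) = 0.
Proof. by coex; ring. Qed.

Lemma dot_fibre_anti p q : dot (fibre_dir p) q = - dot p (fibre_dir q).
Proof. by coex; ring. Qed.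

Lemma fibreK q : fibre_dir (fibre_dir q) = - q.
Proof. by apply: co_ext => -[|[|[|[|]]]] // _; coex. Qed.

Lemma fibreD p q : fibre_dir (p + q) = fibre_dir p + fibre_dir q.
Proof. by apply: co_ext => -[|[|[|[|]]]] // _; coex; ring. Qed.

Lemma fibreZ a q : fibre_dir (a *: q) = a *: fibre_dir q.
Proof. by apply: co_ext => -[|[|[|[|]]]] // _; coex; ring. Qed.

Lemma dot_eq0 n (r : 'rV[R]_n.+1) : dot r r = 0 -> r = 0.
Proof.
rewrite dotE => /eqP; rewrite psumr_eq0 => [/allP h|i _]; last by rewrite -expr2 sqr_ge0.
apply: co_ext => k kn; rewrite co0; apply/eqP.
by have := h (Ordinal (kn : (k < n.+1)%N)) (mem_index_enum _); rewrite mulf_eq0 orbb.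
Qed.

(** The squared modulus of the Hermitian product of p and q is
    (|p|^2 |q|^2 + hopf p . hopf q) / 2, so equality holds in Cauchy-Schwarz
    when the Hopf images agree. *)
Lemma same_fibre p q : dot q q = 1 -> dot p p = 1 -> hopf p = hopf q ->
  p = dot p q *: q + dot p (fibre_dir q) *: fibre_dir q.
Proof.
move=> q1 p1 e; apply/eqP; rewrite -subr_eq0; apply/eqP/dot_eq0.
transitivity (dot p p + (dot q q - 2) * (dot p q ^+ 2 + dot p (fibre_dir q) ^+ 2)).
  by coex; ring.
have h : 2 * (dot p q ^+ 2 + dot p (fibre_dir q) ^+ 2)
  = dot p p * dot q q + dot (hopf p) (hopf q) by coex; ring.
by move: h; rewrite e dot_hopf q1 p1; lra.
Qed.

Lemma hopf_rot u q : hopf (rot u q) = hopf q.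
Proof.
have := cos2Dsin2 u; rewrite /rot => e.
apply: co_ext => -[|[|[|]]] // _; coex;
  rewrite -[RHS]mul1r -e; ring.
Qed.

Lemma dot_rot u p q : dot (rot u p) (rot u q) = dot p q.
Proof.
have := cos2Dsin2 u; rewrite /rot => e; coex.
rewrite -[RHS]mul1r -e; ring.
Qed.

Lemma rotD u v q : rot u (rot v q) = rot (u + v) q.
Proof.
rewrite /rot cosD sinD.
by apply: co_ext => -[|[|[|[|]]]] // _; coex; ring.
Qed.

Lemma fibre_rot u q : fibre_dir (rot u q) = rot u (fibre_dir q).
Proof. by apply: co_ext => -[|[|[|[|]]]] // _; coex; ring. Qed.

(** For unit y, adding to q its reflection projects q onto the fibre over y;
    the right-hand side is then a multiple of y. *)
Lemma hopf_herm y q :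
  hopf (q + herm y q) =
  hopf q + (2 * dot q q) *: y + (2 * dot y (hopf q)) *: y - dot y y *: hopf q.
Proof. by apply: co_ext => -[|[|[|]]] // _; coex; ring. Qed.

Lemma dot_herm y q :
  dot (q + herm y q) (q + herm y q)
  = dot q q * (1 + dot y y) + 2 * dot y (hopf q).
Proof. by coex; ring. Qed.

(** The connection form of the projected point: the product of two Pauli
    matrices has the cross product as its skew part. *)
Lemma conn_herm y z q :
  dot (herm z q) (fibre_dir (q + herm y q)) = triple (hopf q) y z.
Proof. coex; ring. Qed.

Definition dhopf q (v : 'rV[R]_4) : 'rV[R]_3 :=
  rvec 3 [:: 2 * (co q 0 * co v 0 + co q 1 * co v 1 - co q 2 * co v 2 - co q 3 * co v 3);
             2 * (co v 0 * co q 2 + co q 0 * co v 2 + co v 1 * co q 3 + co q 1 * co v 3);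
             2 * (co v 0 * co q 3 + co q 0 * co v 3 - co v 1 * co q 2 - co q 1 * co v 2)].

(** The differential of the Hopf map doubles lengths orthogonally to the
    fibre and kills the fibre direction. *)
Lemma dot_dhopf q v : dot (dhopf q v) (dhopf q v) =
  4 * (dot q q * dot v v - dot v (fibre_dir q) ^+ 2).
Proof. coex; ring. Qed.

(** Tangent vectors a and b have a cross product parallel to the normal y. *)
Lemma triple_normal (y a b p : 'rV[R]_3) : dot y y = 1 -> dot y a = 0 -> dot y b = 0 ->
  triple p a b = dot p y * triple y a b.
Proof.
move=> y1 ya yb; apply/eqP; rewrite -subr_eq0; apply/eqP.
rewrite -[triple p a b]mulr1 -y1.
have -> : triple p a b * dot y y - dot p y * triple y a b
  = dot y b * triple p a y - dot y a * triple p b y.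
  by coex; ring.
by rewrite ya yb !mul0r subrr.
Qed.

End HopfAlgebra.

(** * Vector-valued derivatives *)

Section VectorCalculus.
Context {R : realType}.

Lemma is_derive_sum_ord (V : normedModType R) n (F : 'I_n -> V -> R) (d : 'I_n -> R) (x v : V) :
  (forall i, is_derive x v (F i) (d i)) ->
  is_derive x v (fun y => \sum_(i < n) F i y) (\sum_(i < n) d i).
Proof.
move=> h; have := is_derive_sum h; rewrite (_ : (fun y => _) = \sum_i F i) //.
by apply/funext => y; rewrite fct_sumE.
Qed.

Lemma is_derive_coP (V : normedModType R) n (f : V -> 'rV[R]_n.+1) x v d :
  is_derive x v f d <->
  forall k, (k <= n)%N -> is_derive x v (fun y => co (f y) k) (co d k).
Proof.
split=> [[fd <-] k kn|h].
  split; first by move/derivable_mxP : fd; apply.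
  by rewrite derive_mx // /co mxE.
have fd : derivable f x v.
  apply/derivable_mxP => i j; rewrite ord1; have [] := h j; first by rewrite -ltnS.
  by rewrite /co inord_val.
split=> //; rewrite derive_mx //; apply: co_ext => k kn; rewrite {1}/co mxE.
by have [_ <-] := h k kn.
Qed.

Lemma continuous_coP (T : topologicalType) n (f : T -> 'rV[R]_n.+1) x :
  {for x, continuous f} <->
  forall k, (k <= n)%N -> {for x, continuous (fun y => co (f y) k)}.
Proof.
split=> [fc k kn|h].
  exact: (continuous_comp fc (@coord_continuous R 1 n.+1 0 (inord k) (f x))).
apply/cvgrPdist_le => /= e e0.
near=> y.
rewrite /Num.Def.normr/= mx_normrE (bigmax_le _ (ltW e0))//= => -[i j] _ /=.
rewrite !mxE /= ord1; move: j {i}; near: y; apply: filter_forall => /= j.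
have jn : (j <= n)%N by rewrite -ltnS.
have /cvgrPdist_le/(_ _ e0) := h j jn.
by apply: filterS => y; rewrite /co inord_val.
Unshelve. all: by end_near. Qed.

Lemma C1_coP (V : normedModType R) n (f : V -> 'rV[R]_n.+1) :
  Ck 1 setT f <-> forall k, (k <= n)%N -> Ck 1 setT (fun y => co (f y) k : R).
Proof.
split=> [/C1P[fc fd] k kn|h].
  apply: (@C1_intro _ _ _ _ (fun v x => co ('D_v f x) k)).
  - by move=> x; have /continuous_coP := fc x; apply.
  - by move=> v x; have [fdx _] := fd v; have /derivableP/is_derive_coP := fdx x; apply.
  - by move=> v x; have [_ /(_ x)/continuous_coP] := fd v; apply.
apply/C1P; split=> [x|v].
  by apply/continuous_coP => k kn; have /C1P[+ _] := h k kn; apply.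
have hd x : derivable f x v.
  apply/derivable_mxP => i j; rewrite ord1.
  have := h j; rewrite /co inord_val -ltnS => /(_ (ltn_ord j))/C1P[_ /(_ v)[+ _]].
  by apply.
split=> // x; apply/continuous_coP => k kn.
have /C1P[_ /(_ v)[_ /(_ x)]] := h k kn.
congr (continuous_at _ _); apply/funext => y.
by rewrite derive_mx // /co mxE.
Qed.

(** A directional derivative is an ordinary derivative along a line; this
    reduces every chain rule below to the one-variable one. *)
Lemma is_derive_line (V W : normedModType R) (F : V -> W) z v d :
  is_derive z v F d <-> is_derive (0 : R) (1 : R) (fun h : R => F (h *: v + z)) d.
Proof.
have e : 'D_v F z = 'D_1 (fun h : R => F (h *: v + z)) 0.
  rewrite /derive; congr (lim _).
  set A := fun h => _; set B := fun h => _; suff -> : A = B by [].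
  by apply/funext => h; rewrite /A /B /= addr0 scale0r add0r [_%:A]mulr1.
split=> -[a b]; split; rewrite -?e -?derivable1P //.
- by apply/derivable1P.
- by rewrite e.
Qed.

Lemma is_derive_comp_linear (V : normedModType R) (l : V -> R) (f : R -> R) z v d :
  (forall (h : R) z v, l (h *: v + z) = h * l v + l z) ->
  is_derive (l z) 1 f d -> is_derive z v (fun y => f (l y)) (l v * d).
Proof.
move=> ll fd; apply/is_derive_line.
rewrite (_ : (fun h => _) = f \o (fun h : R => h * l v + l z)); last first.
  by apply/funext => h /=; rewrite ll.
rewrite mulrC; apply: is_derive1_comp.
  by rewrite mul0r add0r.
have := is_derive_add (is_derive_mul (is_derive_id (0 : R) (1 : R)) (is_derive_const (l v) (0:R) (1:R)))
  (is_derive_const (l z) (0:R) (1:R)).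
by rewrite mul1r mulr0 !addr0.
Qed.

Lemma is_derive_scale (W : normedModType R) (f : R -> W) (x v : R) d :
  is_derive x 1 f d -> is_derive x v f (v *: d).
Proof.
move=> [fd fe]; have df : differentiable f x by exact/derivable1_diffP.
split; first exact: diff_derivable.
by rewrite deriveE // -fe deriveE // -linearZ /= [v *: 1]mulr1.
Qed.

Lemma C1_of_derive (W : normedModType R) (f df : R -> W) :
  (forall x : R, is_derive x 1 f (df x)) -> continuous df -> Ck 1 setT f.
Proof.
move=> fd dc. apply: (@C1_intro R _ W f (fun v x => v *: df x)).
- by move=> x; apply/differentiable_continuous/derivable1_diffP; have [] := fd x.
- by move=> v x; exact: is_derive_scale.
- by move=> v x; apply: cvgZr; exact: dc.
Qed.

Lemma C1_derive1 (W : normedModType R) (f : R -> W) : Ck 1 setT f ->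
  (forall x : R, is_derive x 1 f (derive1 f x)) /\ continuous (derive1 f).
Proof.
move=> /C1P[fc /(_ (1 : R))[fd dc]]; split=> [x|].
  by rewrite derive1E; exact: derivableP.
by rewrite (_ : derive1 f = 'D_1 f) //; apply/funext => x; rewrite derive1E.
Qed.

Lemma is_derive_derive1 (W : normedModType R) (f : R -> W) (x : R) d :
  is_derive x 1 f d -> derive1 f x = d.
Proof. by move=> [_ <-]; rewrite derive1E. Qed.

Lemma is_derive_dot (V : normedModType R) n (f g : V -> 'rV[R]_n.+1) x v a b :
  is_derive x v f a -> is_derive x v g b ->
  is_derive x v (fun y => dot (f y) (g y)) (dot a (g x) + dot (f x) b).
Proof.
move=> /is_derive_coP fa /is_derive_coP gb.
rewrite (_ : (fun y => _) = (fun y => \sum_(i < n.+1) co (f y) i * co (g y) i)); last first.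
  by apply/funext => y; rewrite dotE.
rewrite !dotE -big_split /=; apply: is_derive_sum_ord => i.
have ni : (i <= n)%N by rewrite -ltnS.
by apply: is_derive_mul; [exact: fa|exact: gb].
Qed.

Lemma is_derive_triple (V : normedModType R) (f g h : V -> 'rV[R]_3) x v a b c :
  is_derive x v f a -> is_derive x v g b -> is_derive x v h c ->
  is_derive x v (fun y => triple (f y) (g y) (h y))
   (triple a (g x) (h x) + triple (f x) b (h x) + triple (f x) (g x) c).
Proof.
move=> /is_derive_coP fa /is_derive_coP gb /is_derive_coP hc.
rewrite (_ : (fun y => _) = (fun y => 
  co (f y) 0 * (co (g y) 1 * co (h y) 2 - co (g y) 2 * co (h y) 1)
  + co (f y) 1 * (co (g y) 2 * co (h y) 0 - co (g y) 0 * co (h y) 2)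
  + co (f y) 2 * (co (g y) 0 * co (h y) 1 - co (g y) 1 * co (h y) 0))); last first.
  by apply/funext => y; rewrite tripleE.
have fa0 := fa 0%N erefl; have fa1 := fa 1%N erefl; have fa2 := fa 2%N erefl.
have gb0 := gb 0%N erefl; have gb1 := gb 1%N erefl; have gb2 := gb 2%N erefl.
have hc0 := hc 0%N erefl; have hc1 := hc 1%N erefl; have hc2 := hc 2%N erefl.
apply: is_derive_eq (is_derive_add (is_derive_add (is_derive_mul fa0 (is_derive_sub (is_derive_mul gb1 hc2)
  (is_derive_mul gb2 hc1)))
  (is_derive_mul fa1 (is_derive_sub (is_derive_mul gb2 hc0) (is_derive_mul gb0 hc2))))
  (is_derive_mul fa2 (is_derive_sub (is_derive_mul gb0 hc1) (is_derive_mul gb1 hc0)))) _.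
by rewrite !tripleE; ring.
Qed.

Lemma continuous_const (T : topologicalType) (c : R) : continuous (fun _ : T => c).
Proof. by move=> x; exact: cvg_cst. Qed.

Lemma continuous_dot (T : topologicalType) n (f g : T -> 'rV[R]_n.+1) x :
  {for x, continuous f} -> {for x, continuous g} -> {for x, continuous (fun y => dot (f y) (g y))}.
Proof.
move=> /continuous_coP fc /continuous_coP gc.
rewrite (_ : (fun y => _) = (fun y => \sum_(i < n.+1) co (f y) i * co (g y) i)); last first.
  by apply/funext => y; rewrite dotE.
apply: cvg_big => [|i _]; first exact: add_continuous.
have ni : (i <= n)%N by rewrite -ltnS.
by apply: cvgM; [exact: fc|exact: gc].
Qed.

Lemma continuous_triple (T : topologicalType) (f g h : T -> 'rV[R]_3) x :
  {for x, continuous f} -> {for x, continuous g} -> {for x, continuous h} ->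
  {for x, continuous (fun y => triple (f y) (g y) (h y))}.
Proof.
move=> /continuous_coP fc /continuous_coP gc /continuous_coP hc.
rewrite (_ : (fun y => _) = (fun y => 
  co (f y) 0 * (co (g y) 1 * co (h y) 2 - co (g y) 2 * co (h y) 1)
  + co (f y) 1 * (co (g y) 2 * co (h y) 0 - co (g y) 0 * co (h y) 2)
  + co (f y) 2 * (co (g y) 0 * co (h y) 1 - co (g y) 1 * co (h y) 0))); last first.
  by apply/funext => y; rewrite tripleE.
have fa0 := fc 0%N erefl; have fa1 := fc 1%N erefl; have fa2 := fc 2%N erefl.
have gb0 := gc 0%N erefl; have gb1 := gc 1%N erefl; have gb2 := gc 2%N erefl.
have hc0 := hc 0%N erefl; have hc1 := hc 1%N erefl; have hc2 := hc 2%N erefl.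
by apply: cvgD; [apply: cvgD|]; apply: cvgM => //; apply: cvgB; apply: cvgM.
Qed.

End VectorCalculus.

(** * Functions of class C^1 *)

Section C1Kit.
Context {R : realType} {V : normedModType R}.
Implicit Types f g : V -> R.

Lemma C1_dest (W : normedModType R) (f : V -> W) : Ck 1 setT f -> continuous f /\
  exists df : V -> V -> W, (forall v x, is_derive x v f (df v x)) /\ (forall v, continuous (df v)).
Proof.
move=> /C1P[fc fd]; split=> //; exists (fun v => 'D_v f); split=> [v x|v].
  by have [/(_ x)/derivableP] := fd v.
by have [] := fd v.
Qed.

Lemma C1_const (c : R) : Ck 1 setT (fun _ : V => c).
Proof.
by apply: (@C1_intro R V _ _ (fun _ _ => 0)) => *; first [exact: continuous_const | exact: is_derive_const].
Qed.

Lemma C1_add f g : Ck 1 setT f -> Ck 1 setT g -> Ck 1 setT (fun x => f x + g x).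
Proof.
move=> /C1_dest[fc [df [fd dfc]]] /C1_dest[gc [dg [gd dgc]]].
apply: (@C1_intro R V _ _ (fun v x => df v x + dg v x)) => [x|v x].
- by apply: cvgD; [exact: fc|exact: gc].
- by apply: cvgD; [exact: dfc|exact: dgc].
Qed.

Lemma C1_mul f g : Ck 1 setT f -> Ck 1 setT g -> Ck 1 setT (fun x => f x * g x).
Proof.
move=> /C1_dest[fc [df [fd dfc]]] /C1_dest[gc [dg [gd dgc]]].
apply: (@C1_intro R V _ _ (fun v x => df v x * g x + f x * dg v x)) => [x|v x|v x].
- by apply: cvgM; [exact: fc|exact: gc].
- exact: is_derive_mul.
- by apply: cvgD; apply: cvgM; [exact: dfc|exact: gc|exact: fc|exact: dgc].
Qed.

Lemma C1_opp f : Ck 1 setT f -> Ck 1 setT (fun x => - f x).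
Proof.
move=> fC; rewrite (_ : (fun x => _) = (fun x => (-1) * f x)); last first.
  by apply/funext => x; rewrite mulN1r.
by apply: C1_mul fC; exact: C1_const.
Qed.

Lemma C1_sub f g : Ck 1 setT f -> Ck 1 setT g -> Ck 1 setT (fun x => f x - g x).
Proof. by move=> fC gC; apply: C1_add fC _; exact: C1_opp. Qed.

Lemma is_derive_comp (F : R -> R) f x v a b : is_derive (f x) 1 F a -> is_derive x v f b ->
  is_derive x v (fun y => F (f y)) (a * b).
Proof.
move=> Fa /is_derive_line fb; apply/is_derive_line.
by apply: (@is_derive1_comp _ F (fun h : R => f (h *: v + x))); rewrite ?scale0r ?add0r.
Qed.

Lemma C1_comp (F dF : R -> R) f : Ck 1 setT f ->
  (forall x, is_derive (f x) 1 F (dF (f x))) -> (forall x, {for f x, continuous dF}) ->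
  Ck 1 setT (fun x => F (f x)).
Proof.
move=> /C1_dest[fc [df [fd dfc]]] Fd dFc.
apply: (@C1_intro R V _ _ (fun v x => dF (f x) * df v x)) => [x|v x|v x].
- apply: (continuous_comp (fc x)); apply/differentiable_continuous/derivable1_diffP.
  by have [] := Fd x.
- exact: is_derive_comp.
- by apply: cvgM; [exact: (continuous_comp (fc x) (dFc x))|exact: dfc].
Qed.

Lemma C1_inv f : Ck 1 setT f -> (forall x, f x != 0) -> Ck 1 setT (fun x => (f x)^-1).
Proof.
move=> fC f0; apply: (@C1_comp GRing.inv (fun y => - (y ^+ 2)^-1)) => // x.
  have := is_derive_inv (f0 x) (is_derive_id (f x) (1 : R)).
  by rewrite mulNr mul1r.
apply: cvgN; apply: cvgV; first by rewrite expf_neq0.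
exact: exprn_continuous.
Qed.

Lemma C1_linear (l : V -> R) : continuous l ->
  (forall (h : R) z v, l (h *: v + z) = h * l v + l z) -> Ck 1 setT l.
Proof.
move=> lc ll; apply: (@C1_intro R V _ _ (fun v _ => l v)) => // [v x|v]; last exact: continuous_const.
have h : is_derive (l x) 1 (@id R) 1 by exact: is_derive_id.
by have := is_derive_comp_linear v ll h; rewrite mulr1.
Qed.

Lemma C1_dot n (f : V -> 'rV[R]_n.+1) (p : 'rV[R]_n.+1) :
  Ck 1 setT f -> Ck 1 setT (fun x => dot p (f x) : R).
Proof.
move=> /C1_dest[fc [df [fd dfc]]].
apply: (@C1_intro R V _ _ (fun v x => dot p (df v x))) => [x|v x|v x].
- by apply: continuous_dot; [exact: cvg_cst|exact: fc].
- have := is_derive_dot (is_derive_cst p x v) (fd v x); rewrite /cst.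
  by rewrite (_ : dot 0 _ = 0) ?add0r // dotE big1 // => i _; rewrite co0 mul0r.
- by apply: continuous_dot; [exact: cvg_cst|exact: dfc].
Qed.

Lemma C1_cos f : Ck 1 setT f -> Ck 1 setT (fun x => cos (f x)).
Proof.
move=> fC; apply: (@C1_comp cos (fun x => - sin x)) => // x.
by apply: cvgN; exact: continuous_sin.
Qed.

Lemma C1_sin f : Ck 1 setT f -> Ck 1 setT (fun x => sin (f x)).
Proof. by move=> fC; apply: (@C1_comp sin cos) => // x; exact: continuous_cos. Qed.

Lemma C1_sqrt f : Ck 1 setT f -> (forall x, 0 < f x) -> Ck 1 setT (fun x => Num.sqrt (f x)).
Proof.
move=> fC f0; apply: (@C1_comp Num.sqrt (fun x => (2 * Num.sqrt x)^-1)) => // x.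
  exact: is_derive1_sqrt.
apply: cvgV; first by rewrite mulf_neq0 // gt_eqF // sqrtr_gt0.
by apply: cvgM; [exact: cvg_cst|exact: sqrt_continuous].
Qed.

End C1Kit.

Section VectorRules.
Context {R : realType} {V : normedModType R}.

Lemma is_derive_scaled n (k : V -> R) (f : V -> 'rV[R]_n.+1) x v a b :
  is_derive x v k a -> is_derive x v f b ->
  is_derive x v (fun y => k y *: f y) (a *: f x + k x *: b).
Proof.
move=> ka /is_derive_coP fb; apply/is_derive_coP => i ni.
rewrite coD !coZ; under eq_fun do rewrite coZ.
by apply: is_derive_mul => //; exact: fb.
Qed.

Lemma is_derive_addv n (f g : V -> 'rV[R]_n.+1) x v a b :
  is_derive x v f a -> is_derive x v g b ->
  is_derive x v (fun y => f y + g y) (a + b).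
Proof. by move=> *; exact: is_deriveD. Qed.

Lemma is_derive_herm (f : V -> 'rV[R]_3) q x v a : is_derive x v f a ->
  is_derive x v (fun y => herm (f y) q) (herm a q).
Proof.
move=> /is_derive_coP fa; apply/is_derive_coP.
have lin (c0 c1 c2 : R) : is_derive x v (fun y => co (f y) 0 * c0 + co (f y) 1 * c1 + co (f y) 2 * c2)
   (co a 0 * c0 + co a 1 * c1 + co a 2 * c2).
  have fa0 := fa 0%N erefl; have fa1 := fa 1%N erefl; have fa2 := fa 2%N erefl.
  apply: is_derive_eq (is_derive_add (is_derive_add (is_derive_mul fa0 (is_derive_const c0 x v))
    (is_derive_mul fa1 (is_derive_const c1 x v))) (is_derive_mul fa2 (is_derive_const c2 x v))) _.
  by rewrite !mulr0 !addr0.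
have cong (c0 c1 c2 : R) (F : V -> R) b : (forall y, F y = co (f y) 0 * c0 + co (f y) 1 * c1 + co (f y) 2 * c2) ->
   b = co a 0 * c0 + co a 1 * c1 + co a 2 * c2 -> is_derive x v F b.
  by move=> /funext -> ->.
move=> [|[|[|[|]]]] // _.
- apply: (cong (co q 0) (co q 2) (co q 3)) => [y|]; rewrite co_rvec //=; ring.
- apply: (cong (co q 1) (co q 3) (- co q 2)) => [y|]; rewrite co_rvec //=; ring.
- apply: (cong (- co q 2) (co q 0) (- co q 1)) => [y|]; rewrite co_rvec //=; ring.
- apply: (cong (- co q 3) (co q 1) (co q 0)) => [y|]; rewrite co_rvec //=; ring.
Qed.

Lemma is_derive_fibre (f : V -> 'rV[R]_4) x v a : is_derive x v f a ->
  is_derive x v (fun y => fibre_dir (f y)) (fibre_dir a).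
Proof.
move=> /is_derive_coP fa; apply/is_derive_coP.
have cong (F : V -> R) k : (forall y, F y = co (f y) k) -> (k <= 3)%N -> is_derive x v F (co a k).
  by move=> /funext -> k3; exact: fa.
have congN (F : V -> R) k : (forall y, F y = - co (f y) k) -> (k <= 3)%N -> is_derive x v F (- co a k).
  by move=> /funext -> k3; apply: is_derive_opp; exact: fa.
move=> [|[|[|[|]]]] // _; rewrite co_rvec //=;
  by [apply: cong => // y; rewrite co_rvec|apply: congN => // y; rewrite co_rvec].
Qed.

Lemma is_derive_rot (u : V -> R) (f : V -> 'rV[R]_4) x v a b :
  is_derive x v u a -> is_derive x v f b ->
  is_derive x v (fun y => rot (u y) (f y)) (rot (u x) (b + a *: fibre_dir (f x))).
Proof.
move=> ua fb.
have dc : is_derive x v (fun y => cos (u y)) (- sin (u x) * a).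
  by apply: is_derive_comp ua.
have ds : is_derive x v (fun y => sin (u y)) (cos (u x) * a).
  by apply: is_derive_comp ua.
apply: is_derive_eq (is_derive_addv (is_derive_scaled dc fb) (is_derive_scaled ds (is_derive_fibre fb))) _.
rewrite /rot !fibreD !fibreZ fibreK.
by apply: co_ext => k _; rewrite !(coD, coZ, coN); ring.
Qed.

Lemma is_derive_hopf (f : V -> 'rV[R]_4) x v a : is_derive x v f a ->
  is_derive x v (fun y => hopf (f y)) (dhopf (f x) a).
Proof.
move=> /is_derive_coP fa; apply/is_derive_coP.
have fa0 := fa 0%N erefl; have fa1 := fa 1%N erefl; have fa2 := fa 2%N erefl; have fa3 := fa 3%N erefl.
move=> [|[|[|]]] // _; rewrite co_rvec //=; under eq_fun do rewrite co_rvec //= ?expr2.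
- apply: is_derive_eq (is_derive_sub (is_derive_sub (is_derive_add (is_derive_mul fa0 fa0)
  (is_derive_mul fa1 fa1)) (is_derive_mul fa2 fa2)) (is_derive_mul fa3 fa3)) _; ring.
- apply: is_derive_eq (is_derive_mul (is_derive_const 2 x v) (is_derive_add (is_derive_mul fa0 fa2)
  (is_derive_mul fa1 fa3))) _; ring.
- apply: is_derive_eq (is_derive_mul (is_derive_const 2 x v) (is_derive_sub (is_derive_mul fa0 fa3)
  (is_derive_mul fa1 fa2))) _; ring.
Qed.

End VectorRules.

(** * Horizontal lifts of loops in the sphere *)

Lemma forall_le3 (P : nat -> Prop) : P 0%N -> P 1%N -> P 2%N -> P 3%N ->
  forall k, (k <= 3)%N -> P k.
Proof. by move=> p0 p1 p2 p3 [|[|[|[|]]]]. Qed.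

Section HorizontalLift.
Context {R : realType}.
Implicit Types (p y : 'rV[R]_3) (q : 'rV[R]_4) (g : R -> 'rV[R]_3).

Definition sphere_loop g : Prop :=
  [/\ forall x, g (x + 1) = g x, forall x, on_sphere (g x) & Ck 1 setT g].

(** For a unit p: the loop does not meet the antipode of p, so that the
    geodesic cone from p and the section of the Hopf map defined by p exist
    along it. *)
Definition avoids g p : Prop := forall x, 0 < 1 + dot p (g x).

(** The rate at which the geodesic from p to the moving point of the loop
    sweeps area; the underlying 1-form y |-> triple p y dy / (1 + p . y) is a
    primitive of the area form on the sphere minus the point -p. *)
Definition cone_density p g x : R :=
  triple p (g x) (derive1 g x) / (1 + dot p (g x)).

Definition cone_area p g : R := prim (cone_density p g) 1.

Lemma sphere_loop_derive g : sphere_loop g -> forall x : R, is_derive x 1 g (derive1 g x).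
Proof. by move=> [_ _ /C1_derive1[]]. Qed.

Lemma derive1_period (W : normedModType R) (g : R -> W) :
  (forall x, g (x + 1) = g x) -> (forall x : R, is_derive x 1 g (derive1 g x)) ->
  forall x, derive1 g (x + 1) = derive1 g x.
Proof.
move=> gp gd x; symmetry; apply: is_derive_derive1.
apply/is_derive_line; have /is_derive_line := gd (x + 1).
by rewrite (_ : (fun h => _) = (fun h : R => g (h *: 1 + x))) // ; apply/funext => h; rewrite addrA gp.
Qed.

Lemma cone_density_continuous p g : sphere_loop g -> avoids g p ->
  continuous (cone_density p g).
Proof.
move=> [_ _ /C1_derive1[gd gc]] av x.
have gcx : {for x, continuous g}.
  by apply/differentiable_continuous/derivable1_diffP; have [] := gd x.
apply: cvgM.
  by apply: continuous_triple; [exact: cvg_cst|exact: gcx|exact: gc].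
apply: cvgV; first by rewrite gt_eqF.
by apply: cvgD; [exact: cvg_cst|apply: continuous_dot; [exact: cvg_cst|exact: gcx]].
Qed.

Lemma cone_density_period p g : sphere_loop g -> forall x,
  cone_density p g (x + 1) = cone_density p g x.
Proof.
move=> sg x; have [gp _ _] := sg.
by rewrite /cone_density gp (derive1_period gp (sphere_loop_derive sg)).
Qed.

Lemma hopf_surj p : on_sphere p -> exists2 q, on_sphere q & hopf q = p.
Proof.
move=> /on_sphereP p1; have p1' := p1; rewrite dot3E in p1'.
have [pN|pN] := eqVneq (1 + co p 0) 0.
  have a : co p 0 = -1 by lra.
  have b : co p 1 ^+ 2 + co p 2 ^+ 2 = 0 by rewrite a in p1'; lra.
  move/eqP : b; rewrite paddr_eq0 ?sqr_ge0 // !sqrf_eq0 => /andP[/eqP b /eqP c].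
  exists (rvec 4 [:: 0; 0; 1; 0]); first by apply/on_sphereP; coex; ring.
  by apply: co_ext => -[|[|[|]]] // _; coex; rewrite ?a ?b ?c; ring.
have ge : -1 <= co p 0.
  rewrite leNgt; apply/negP => lt.
  have := sqr_ge0 (co p 1); have := sqr_ge0 (co p 2); rewrite !expr2; nra.
have gt : 0 < 1 + co p 0 by rewrite lt0r pN; lra.
pose r := Num.sqrt ((1 + co p 0) / 2).
have r2 : r ^+ 2 = (1 + co p 0) / 2 by rewrite sqr_sqrtr // divr_ge0 // ltW.
have r0 : r != 0 by rewrite gt_eqF // sqrtr_gt0 divr_gt0.
have e : (co p 1 ^+ 2 + co p 2 ^+ 2) = (1 - co p 0) * (1 + co p 0).
  by move: p1'; lra.
have e2 : (co p 1 / (2 * r)) ^+ 2 + (co p 2 / (2 * r)) ^+ 2 = (1 - co p 0) / 2.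
  rewrite !expr_div_n -mulrDl e exprMn r2; field.
  by rewrite pN.
exists (rvec 4 [:: r; 0; co p 1 / (2 * r); co p 2 / (2 * r)]).
  by apply/on_sphereP; coex; move: r2 e2; rewrite !expr2; lra.
apply: co_ext => -[|[|[|]]] // _; coex.
- by move: r2 e2; rewrite !expr2; lra.
- by field.
- by field.
Qed.

(** The point of the fibre over y closest to q. *)
Definition hsection q y : 'rV[R]_4 :=
  (Num.sqrt (2 * (1 + dot (hopf q) y)))^-1 *: (q + herm y q).

Lemma hopfZ (k : R) q : hopf (k *: q) = k ^+ 2 *: hopf q.
Proof. by apply: co_ext => -[|[|[|]]] // _; coex; ring. Qed.

Lemma hsectionP q y : on_sphere q -> on_sphere y -> 0 < 1 + dot (hopf q) y ->
  on_sphere (hsection q y) /\ hopf (hsection q y) = y.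
Proof.
move=> /on_sphereP q1 /on_sphereP y1 d0.
have D0 : 0 < 2 * (1 + dot (hopf q) y) by lra.
have Dn : 2 * (1 + dot (hopf q) y) != 0 by rewrite gt_eqF.
rewrite /hsection; set D := 2 * _ in D0 Dn *.
have k2 : (Num.sqrt D)^-1 ^+ 2 = D^-1 by rewrite exprVn sqr_sqrtr // ltW.
split.
  apply/on_sphereP; rewrite dotZl dotZr mulrA -expr2 k2 dot_herm q1 y1 dotC.
  by rewrite mul1r (_ : 1 + 1 + _ = D) ?mulVf // /D; ring.
rewrite hopfZ k2 hopf_herm q1 y1 dotC; apply: co_ext => k _.
rewrite !(coD, coN, coZ) (_ : _ + _ - _ = D * co y k) ?mulKf // /D; ring.
Qed.

(** The connection form of the section along the loop is half the cone
    density, so rotating back by the accumulated angle makes the lift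
    horizontal. *)
Definition hlift q g (x : R) : 'rV[R]_4 :=
  rot (- (prim (cone_density (hopf q) g) x / 2)) (hsection q (g x)).

Section Lift.
Variables (q : 'rV[R]_4) (g : R -> 'rV[R]_3).
Hypotheses (sq : on_sphere q) (sg : sphere_loop g) (av : avoids g (hopf q)).

Lemma hopf_hlift x : hopf (hlift q g x) = g x.
Proof. by have [_ gs _] := sg; rewrite hopf_rot; have [] := hsectionP sq (gs x) (av x). Qed.

Lemma sphere_hlift x : on_sphere (hlift q g x).
Proof.
have [_ gs _] := sg; apply/on_sphereP; rewrite dot_rot; apply/on_sphereP.
by have [] := hsectionP sq (gs x) (av x).
Qed.

(** The holonomy of the loop is minus half the area of the cone. *)
Lemma hlift_period x : hlift q g (x + 1) = rot (- (cone_area (hopf q) g / 2)) (hlift q g x).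
Proof.
have [gp _ _] := sg.
rewrite /hlift prim_period; last 2 first.
- exact: cone_density_continuous.
- exact: cone_density_period.
by rewrite rotD gp /cone_area; congr (rot _ _); ring.
Qed.

Lemma dot_fibreZ (a b : R) (v w : 'rV[R]_4) :
  dot (a *: w + b *: v) (fibre_dir (b *: w)) = b ^+ 2 * dot v (fibre_dir w).
Proof.
by rewrite fibreZ !(dotDl, dotZl, dotZr) dot_fibre_self; ring.
Qed.

Lemma hlift_derive (x : R) : exists2 d, is_derive x 1 (hlift q g) d &
  dot d (fibre_dir (hlift q g x)) = 0.
Proof.
have gd := sphere_loop_derive sg x.
have avx : 0 < 1 + dot (hopf q) (g x) := av x.
set p := hopf q in avx *.
have D0 : 0 < 2 * (1 + dot p (g x)) by lra.
have dD0 := is_derive_mul (is_derive_const 2 x (1 : R)) (is_derive_add (is_derive_const 1 x (1 : R))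
  (is_derive_dot (is_derive_cst p x (1:R)) gd)).
have sD : 0 < Num.sqrt (2 * (1 + dot p (g x))) by rewrite sqrtr_gt0.
have dsq := @is_derive_comp R _ Num.sqrt (fun y : R => 2 * (1 + dot p (g y))) x 1 _ _
  (is_derive1_sqrt D0) dD0.
have dk := @is_derive_inv R _ (fun y : R => Num.sqrt (2 * (1 + dot p (g y)))) x 1 _
  (lt0r_neq0 sD) dsq.
have dw := is_derive_addv (is_derive_cst q x (1 : R)) (is_derive_herm q gd).
have dt := is_derive_opp (is_derive_mul (is_derive_prim x (cone_density_continuous sg av)) (is_derive_const 2^-1 x (1 : R))).
have ds := is_derive_scaled dk dw.
have dl := is_derive_rot dt ds.
eapply ex_intro2; first exact: dl.
rewrite /hlift fibre_rot dot_rot dotDl -/p /cst /= add0r.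
rewrite -/(hsection q (g x)) {2}/hsection -/p.
set k := (Num.sqrt _)^-1; rewrite dot_fibreZ mulr0 addr0 add0r conn_herm -/p.
have [_ gs _] := sg.
have [/on_sphereP s1 _] := hsectionP sq (gs x) (av x).
rewrite -[k *: _]/(hsection q (g x)) dotZl dot_fibre s1.
rewrite /k exprVn sqr_sqrtr ?ltW // /cone_density.
move: (triple p (g x) _) (1 + dot p (g x)) => a b.
by rewrite invfM; ring.
Qed.

Lemma C1_hlift : Ck 1 setT (hlift q g).
Proof.
have [_ _ gC] := sg.
have th : Ck 1 setT (fun x => - (prim (cone_density (hopf q) g) x / 2)).
  apply: C1_opp; apply: C1_mul; last exact: C1_const.
  apply: (@C1_of_derive _ _ _ (cone_density (hopf q) g)); last exact: cone_density_continuous.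
  by move=> x; apply: is_derive_prim; exact: cone_density_continuous.
have kC : Ck 1 setT (fun x => (Num.sqrt (2 * (1 + dot (hopf q) (g x))))^-1).
  apply: C1_inv; last by move=> x; rewrite gt_eqF // sqrtr_gt0; have := av x; lra.
  apply: C1_sqrt; last by move=> x; have := av x; lra.
  by apply: C1_mul; [exact: C1_const|apply: C1_add; [exact: C1_const|exact: C1_dot]].
have gk k : (k <= 2)%N -> Ck 1 setT (fun x => co (g x) k : R) by move/C1_coP : gC; apply.
have lin (c0 c1 c2 c3 : R) : Ck 1 setT (fun x => c0 + (co (g x) 0 * c1 + co (g x) 1 * c2 + co (g x) 2 * c3) : R).
  apply: C1_add; first exact: C1_const.
  apply: C1_add; first apply: C1_add; apply: C1_mul;
    [exact: (gk 0%N)|exact: C1_const|exact: (gk 1%N)|exact: C1_const|exact: (gk 2%N)|exact: C1_const].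
have wC : forall k, (k <= 3)%N -> Ck 1 setT (fun x => co (hsection q (g x)) k : R).
  move=> k k3; under eq_fun do rewrite coZ; apply: C1_mul kC _.
  have cong (F : R -> R) (c0 c1 c2 c3 : R) : (forall x, F x = c0 + (co (g x) 0 * c1 + co (g x) 1 * c2 + co (g x) 2 * c3)) ->
    Ck 1 setT F by move=> /funext ->; exact: (lin c0 c1 c2 c3).
  move: k k3; apply: forall_le3.
  - apply: (cong _ (co q 0) (co q 0) (co q 2) (co q 3)) => x; rewrite coD co_rvec //=; ring.
  - apply: (cong _ (co q 1) (co q 1) (co q 3) (- co q 2)) => x; rewrite coD co_rvec //=; ring.
  - apply: (cong _ (co q 2) (- co q 2) (co q 0) (- co q 1)) => x; rewrite coD co_rvec //=; ring.
  - apply: (cong _ (co q 3) (- co q 3) (co q 1) (co q 0)) => x; rewrite coD co_rvec //=; ring.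
apply/C1_coP => k k3; rewrite /hlift /rot.
have fC : Ck 1 setT (fun x => co (fibre_dir (hsection q (g x))) k : R).
  move: k k3; apply: forall_le3; under eq_fun do rewrite co_rvec //=.
  - by apply: C1_opp; exact: (wC 1%N).
  - exact: (wC 0%N).
  - by apply: C1_opp; exact: (wC 3%N).
  - exact: (wC 2%N).
under eq_fun do rewrite coD (coZ _ (hsection _ _)) (coZ _ (fibre_dir _)).
apply: C1_add; apply: C1_mul;
  [apply: C1_cos; exact: th|exact: wC|apply: C1_sin; exact: th|exact: fC].
Qed.

End Lift.

(** Two horizontal lifts of one curve differ by a constant phase: the two
    real components of their Hermitian product have zero derivative, since a
    horizontal vector is orthogonal to the whole complex line of the fibre. *)
Lemma horizontal_unique (Y Z dY dZ : R -> 'rV[R]_4) :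
  (forall x, on_sphere (Y x)) -> (forall x, on_sphere (Z x)) ->
  (forall x, hopf (Y x) = hopf (Z x)) ->
  (forall x : R, is_derive x 1 Y (dY x)) -> (forall x : R, is_derive x 1 Z (dZ x)) ->
  (forall x, dot (dY x) (fibre_dir (Y x)) = 0) ->
  (forall x, dot (dZ x) (fibre_dir (Z x)) = 0) ->
  forall x y : R, dot (Z x) (Y x) = dot (Z y) (Y y) /\
              dot (Z x) (fibre_dir (Y x)) = dot (Z y) (fibre_dir (Y y)).
Proof.
move=> Y1 Z1 YZ Yd Zd hY hZ x y.
have tang (W dW : R -> 'rV[R]_4) : (forall x, on_sphere (W x)) ->
    (forall x : R, is_derive x 1 W (dW x)) -> forall x, dot (dW x) (W x) = 0.
  move=> W1 Wd z; have := is_derive_dot (Wd z) (Wd z).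
  rewrite (_ : (fun y : R => _) = fun=> 1); last by apply/funext => w; apply/on_sphereP.
  by move=> /is_derive_derive1; rewrite derive1_cst (dotC (W z)); lra.
have orth (q p d : 'rV[R]_4) : on_sphere q -> on_sphere p -> hopf p = hopf q ->
    dot d q = 0 -> dot d (fibre_dir q) = 0 -> dot d p = 0 /\ dot d (fibre_dir p) = 0.
  move=> /on_sphereP q1 /on_sphereP p1 e d1 d2; rewrite (same_fibre q1 p1 e).
  by rewrite fibreD !fibreZ fibreK !(dotDr, dotZr, d1, d2) -scaleN1r dotZr d1; split; ring.
have oY z := orth _ _ _ (Y1 z) (Z1 z) (esym (YZ z)) (tang _ _ Y1 Yd z) (hY z).
have oZ z := orth _ _ _ (Z1 z) (Y1 z) (YZ z) (tang _ _ Z1 Zd z) (hZ z).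
split.
- apply: (@is_derive_0_is_cst _ (fun x => dot (Z x) (Y x))) => z.
  have := is_derive_dot (Zd z) (Yd z); rewrite (dotC (Z z)).
  by have [-> _] := oY z; have [-> _] := oZ z; rewrite addr0.
- apply: (@is_derive_0_is_cst _ (fun x => dot (Z x) (fibre_dir (Y x)))) => z.
  have := is_derive_dot (Zd z) (is_derive_fibre (Yd z)); rewrite (dotC (Z z)) dot_fibre_anti.
  by have [_ ->] := oY z; have [_ ->] := oZ z; rewrite oppr0 addr0.
Qed.

End HorizontalLift.

(** * The cone area modulo 4 pi does not depend on the pole *)

Section Angles.
Context {R : realType}.

Lemma period_int (W : Type) (g : R -> W) (P : R) : (forall x, g (x + P) = g x) ->
  forall (k : int) x, g (x + P * k%:~R) = g x.
Proof.
move=> gp; have nat_case (k : nat) x : g (x + P * k%:R) = g x.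
  elim: k x => [|k ih] x; first by rewrite mulr0 addr0.
  by rewrite -natr1 mulrDr mulr1 addrA gp ih.
move=> [k|k] x; first exact: nat_case.
by rewrite NegzE -[in RHS](subrK (P * k.+1%:R) x) nat_case mulrNz mulrN.
Qed.

Lemma floor_bounds (x : R) : (Num.floor x)%:~R <= x < (Num.floor x)%:~R + 1.
Proof. by have := floor_itv x; rewrite intrD. Qed.

Lemma cos2pi_int (k : int) (x : R) : cos (x + (2 * pi) * k%:~R) = cos x.
Proof. by apply: (@period_int _ cos) => y; rewrite mulr_natl cosD2pi. Qed.

Lemma sin2pi_int (k : int) (x : R) : sin (x + (2 * pi) * k%:~R) = sin x.
Proof. by apply: (@period_int _ sin) => y; rewrite mulr_natl sinD2pi. Qed.

Lemma cos_eq1 (t : R) : cos t = 1 <-> t / (2 * pi) \is a Num.int.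
Proof.
have pi0 : 0 < 2 * pi :> R by rewrite mulr_gt0 // pi_gt0.
split=> [c1|/intrP[k e]]; last first.
  have -> : t = 0 + (2 * pi) * k%:~R.
    by rewrite add0r -e mulrC divfK // gt_eqF.
  by rewrite cos2pi_int cos0.
pose k := Num.floor (t / (2 * pi)); pose r := t - (2 * pi) * k%:~R.
have kr : t = r + (2 * pi) * k%:~R by rewrite subrK.
have /andP[k0 k1] := floor_bounds (t / (2 * pi)).
have r0 : 0 <= r by rewrite subr_ge0 mulrC -ler_pdivlMr.
have r1 : r < 2 * pi.
  by move: k1; rewrite ltr_pdivrMr // mulrDl mul1r /r /k; lra.
move: c1; rewrite kr cos2pi_int => c1.
have [r00|rn0] := eqVneq r 0.
  by rewrite r00 add0r mulrAC divff ?mul1r ?intr_int // gt_eqF.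
have rp : 0 < r by rewrite lt0r rn0.
have s0 : 0 < sin (r / 2).
  apply: sin_gt0_pi; rewrite divr_gt0 //=.
  by rewrite ltr_pdivrMr // mulrC.
have e : cos r = cos ((r / 2) *+ 2) by congr cos; rewrite -mulr_natr divfK.
move: c1; rewrite e cos_mulr2n => c1.
have c2 : cos (r / 2) ^+ 2 = 1 by move: c1; rewrite mulr2n; lra.
move: (sin2cos2 (r / 2)); rewrite c2 subrr => /eqP; rewrite sqrf_eq0 => /eqP s1.
by rewrite s1 ltxx in s0.
Qed.

(** Congruence modulo 4 pi becomes an equation between values of a smooth
    function, which can be followed along a homotopy by differentiating. *)
Lemma area_relP (a b : R) : area_rel a b <-> cos ((a - b) / 2) = 1.
Proof.
rewrite cos_eq1 /area_rel (_ : (a - b) / 2 / (2 * pi) = (a - b) / (4 * pi)) //.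
by rewrite -mulrA -invfM; congr (_ / _); ring.
Qed.

Lemma circle_angle (a b : R) : a ^+ 2 + b ^+ 2 = 1 -> exists u, cos u = a /\ sin u = b.
Proof.
move=> e.
have a1 : -1 <= a <= 1.
  by rewrite -ler_norml -(@ler_pXn2r _ 2) ?nnegrE // expr1n real_normK ?num_real // -e lerDl sqr_ge0.
have sa : sin (acos a) = `|b|.
  rewrite sin_acos // -sqrtr_sqr; congr Num.sqrt; lra.
have ca : cos (acos a) = a by rewrite acosK.
have [b0|b0] := leP 0 b.
  by exists (acos a); rewrite sa ger0_norm.
by exists (- acos a); rewrite cosN sinN sa ltr0_norm // opprK.
Qed.

End Angles.

Section ConeArea.
Context {R : realType}.
Implicit Types (p : 'rV[R]_3) (q : 'rV[R]_4) (g : R -> 'rV[R]_3).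

Lemma dot_rot2 (a b : R) (Y Z : 'rV[R]_4) :
  dot (rot b Z) (rot a Y) = cos (a - b) * dot Z Y + sin (a - b) * dot Z (fibre_dir Y).
Proof.
rewrite cosB sinB /rot !(dotDl, dotDr, dotZl, dotZr) dot_fibre dot_fibre_anti.
ring.
Qed.

Lemma fibre_coef (p q : 'rV[R]_4) : on_sphere q -> on_sphere p -> hopf p = hopf q ->
  dot p q ^+ 2 + dot p (fibre_dir q) ^+ 2 = 1.
Proof.
move=> /on_sphereP q1 /on_sphereP p1 e.
have := p1; rewrite {1 2}(same_fibre q1 p1 e).
by rewrite !(dotDl, dotDr, dotZl, dotZr) dot_fibre (dotC (fibre_dir q) q) !dot_fibre_self q1 => <-; ring.
Qed.

(** Both areas are read off from the holonomy of the loop, which is an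
    invariant because horizontal lifts are unique up to a phase. *)
Lemma cone_area_indep g p p' : sphere_loop g -> on_sphere p -> on_sphere p' ->
  avoids g p -> avoids g p' -> area_rel (cone_area p g) (cone_area p' g).
Proof.
move=> sg sp sp' av av'.
have [q sq eq] := hopf_surj sp; have [q' sq' eq'] := hopf_surj sp'.
rewrite -eq -eq'; rewrite -eq in av; rewrite -eq' in av'.
pose Y := hlift q g; pose Z := hlift q' g.
have Y1 x : on_sphere (Y x) by exact: sphere_hlift.
have Z1 x : on_sphere (Z x) by exact: sphere_hlift.
have YZ x : hopf (Y x) = hopf (Z x) by rewrite !hopf_hlift.
have [dY [Yd hY]] : exists dY, (forall x : R, is_derive x 1 Y (dY x)) /\
   (forall x, dot (dY x) (fibre_dir (Y x)) = 0).
  have h (x : R) : exists d, is_derive x 1 Y d /\ dot d (fibre_dir (Y x)) = 0.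
    by have [d d1 d2] := hlift_derive sq sg av x; exists d.
  by have [dY h'] := choice h; exists dY; split=> x; have [] := h' x.
have [dZ [Zd hZ]] : exists dZ, (forall x : R, is_derive x 1 Z (dZ x)) /\
   (forall x, dot (dZ x) (fibre_dir (Z x)) = 0).
  have h (x : R) : exists d, is_derive x 1 Z d /\ dot d (fibre_dir (Z x)) = 0.
    by have [d d1 d2] := hlift_derive sq' sg av' x; exists d.
  by have [dZ h'] := choice h; exists dZ; split=> x; have [] := h' x.
have [e1 e2] := horizontal_unique Y1 Z1 YZ Yd Zd hY hZ (0 + 1) 0.
rewrite /Y /Z !hlift_period // -/(Y 0) -/(Z 0) in e1 e2.
rewrite dot_rot2 in e1; rewrite fibre_rot dot_rot2 fibreK in e2.
have := fibre_coef (Y1 0) (Z1 0) (esym (YZ 0)).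
set U := dot (Z 0) (Y 0) in e1 e2 *; set V := dot (Z 0) (fibre_dir (Y 0)) in e1 e2 *.
rewrite -[- Y 0]scaleN1r dotZr -/U in e2.
move=> UV; apply/area_relP; rewrite -cosN; set t := _ - _ in e1 e2.
have -> : - ((cone_area (hopf q) g - cone_area (hopf q') g) / 2) = t by rewrite /t; ring.
have e3 : cos t * (U ^+ 2 + V ^+ 2)
  = U * (cos t * U + sin t * V) + V * (cos t * V + sin t * (-1 * U)) by ring.
by rewrite -[LHS]mulr1 -UV e3 e1 e2; ring.
Qed.

Lemma lipschitz01 (f : R -> R) : Ck 1 setT (f : R -> R) ->
  exists2 M, 0 < M & forall x y, 0 <= x <= 1 -> 0 <= y <= 1 -> `|f x - f y| <= M * `|x - y|.
Proof.
move=> /C1_derive1[fd fc].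
have [|c c01 cmax] := @EVT_max _ (fun x => `|derive1 f x|) 0 1 ler01.
  by apply: continuous_subspaceT => x; apply: (continuous_comp (fc x)); exact: norm_continuous.
exists (`|derive1 f c| + 1); first by rewrite ltr_wpDl.
have h x y : 0 <= x -> x <= y -> y <= 1 -> `|f x - f y| <= (`|derive1 f c| + 1) * `|x - y|.
  move=> x0 xy y1.
  have [|d] := @MVT_segment _ f (derive1 f) x y xy (fun x _ => fd x).
    by apply: continuous_subspaceT; exact: (@derive_continuous _ f).
  rewrite in_itv /= => /andP[xd dy] e; rewrite distrC e normrM (distrC x).
  rewrite ler_wpM2r //; apply: le_trans (cmax d _) _; last by rewrite lerDl.
  by rewrite in_itv /=; apply/andP; split; lra.
move=> x y /andP[x0 x1] /andP[y0 y1]; have [xy|xy] := leP x y; first exact: h.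
by rewrite distrC (distrC x); apply: h => //; exact: ltW.
Qed.

(** Lipschitz loops are too thin to fill the sphere. On a grid of n^2 points
    of the sphere at mutual distance at least 1/(2n), preimages in [0, 1[
    would include two at distance at most 1/(n^2 - 1), by the pigeonhole
    principle, and the Lipschitz bound fails for large n. *)
Lemma loop_not_onto g : sphere_loop g -> exists2 r, on_sphere r & forall x, g x != r.
Proof.
move=> [gp gs /C1_coP gC].
have [M0 M00 L0] := lipschitz01 (gC 0%N erefl).
have [M1 M10 L1] := lipschitz01 (gC 1%N erefl).
pose M := M0 + M1.
(* 2 M + 1 < n makes 2 M n < n^2 - 1, which the last estimate contradicts *)
pose n := (Num.truncn (2 * M)).+2.
have nM : 2 * M + 1 < n%:R.
  have M2 : 0 <= 2 * M by rewrite mulr_ge0 // addr_ge0 // ltW.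
  have /andP[_ h] := truncn_itv M2.
  by rewrite /n -(addn1 _.+1) natrD; lra.
have n0 : 0 < n%:R :> R by rewrite ltr0n.
(* Both planar coordinates of a covered point stay below 1/2 in absolute value,
   so its third coordinate is a real square root. *)
pose pt3 (jk : 'I_n * 'I_n) : 'rV[R]_3 :=
  let a := jk.1%:R / (2 * n%:R) in let b := jk.2%:R / (2 * n%:R) in
  rvec 3 [:: a; b; Num.sqrt (1 - a ^+ 2 - b ^+ 2)].
have lt12 (j : 'I_n) : 0 <= (j%:R / (2 * n%:R) : R) <= 2^-1.
  rewrite divr_ge0 ?mulr_ge0 //= invfM mulrCA ler_piMr ?invr_ge0 //.
  by rewrite ler_pdivrMr // mul1r ler_nat ltnW.
have pt3s jk : on_sphere (pt3 jk).
  apply/on_sphereP; rewrite dot3E !co_rvec //= -[X in _ + X]expr2 sqr_sqrtr; first ring.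
  have /andP[a0 a1] := lt12 jk.1; have /andP[b0 b1] := lt12 jk.2; rewrite !expr2; nra.
apply: contrapT => H.
have onto r : on_sphere r -> exists x, g x = r.
  move=> rs; apply: contrapT => Hx; apply: H; exists r => // x.
  by apply/negP => /eqP e; apply: Hx; exists x.
have onto1 jk : exists x, 0 <= x < 1 /\ g x = pt3 jk.
  have [x e] := onto _ (pt3s jk); exists (x - (Num.floor x)%:~R); split.
    by have := floor_bounds x; lra.
  by have := period_int gp (- Num.floor x) x; rewrite mul1r rmorphN e.
have [X XP] := choice onto1.
pose N := (n ^ 2).-1.
have Nn : N.+1 = (n ^ 2)%N by rewrite /N prednK // expn_gt0.
have N0 : 0 < N%:R :> R by rewrite ltr0n -ltnS Nn -[X in (X < _)%N](exp1n 2) ltn_exp2r.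
have t0 jk : 0 <= N%:R * X jk.
  by have [/andP[x0 x1] _] := XP jk; rewrite mulr_ge0 // ltW.
have cellP jk : (Num.truncn (N%:R * X jk) < N)%N.
  have [/andP[x0 x1] _] := XP jk; have /andP[h _] := truncn_itv (t0 jk).
  by rewrite -(ltr_nat R); apply: le_lt_trans h _; rewrite gtr_pMr.
pose cell jk := Ordinal (cellP jk).
have /injectivePn[j [k jk ecell]] : ~~ injectiveb cell.
  apply/negP => /injectiveP /leq_card; rewrite card_prod !card_ord mulnn -Nn.
  by rewrite ltnn.
have [/andP[xj0 xj1] gj] := XP j; have [/andP[xk0 xk1] gk] := XP k.
have close : `|X j - X k| <= N%:R^-1.
  have /andP[a1 a2] := truncn_itv (t0 j).
  have /andP[b1 b2] := truncn_itv (t0 k).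
  have e : Num.truncn (N%:R * X j) = Num.truncn (N%:R * X k) by case: ecell.
  rewrite -(ler_pM2l N0) mulfV ?gt_eqF // -[X in X * _]gtr0_norm // -normrM ler_norml.
  move: a1 a2 b1 b2; rewrite e -!natr1; lra.
have key f (m : R) : 0 < m -> m <= M -> (forall x y, 0 <= x <= 1 -> 0 <= y <= 1 -> `|f x - f y| <= m * `|x - y|) ->
   forall a b : 'I_n, f (X j) = a%:R / (2 * n%:R) -> f (X k) = b%:R / (2 * n%:R) -> a = b.
  move=> m0 mM lip a b ea eb; apply: contrapT => ab.
  have : `|f (X j) - f (X k)| <= m * N%:R^-1.
    apply: le_trans (lip (X j) (X k) _ _) _; [by rewrite xj0 ltW|by rewrite xk0 ltW|].
    by rewrite ler_pM2l.
  rewrite ea eb -mulrBl normrM [X in _ * X]gtr0_norm ?invr_gt0 ?mulr_gt0 //.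
  apply/negP; rewrite -ltNge ltr_pdivlMr ?mulr_gt0 // mulrAC ltr_pdivrMr //.
  have d1 : 1 <= `|a%:R - b%:R| :> R.
    rewrite ler_normr; apply/orP.
    have [lt|lt|e] := ltngtP a b; last by case: ab; exact/ord_inj.
    - have : (a.+1)%:R <= b%:R :> R by rewrite ler_nat.
      by rewrite -natr1; right; lra.
    - have : (b.+1)%:R <= a%:R :> R by rewrite ler_nat.
      by rewrite -natr1; left; lra.
  apply: lt_le_trans (_ : N%:R <= _); last by rewrite ler_peMl // ltW.
  have -> : N%:R = n%:R ^+ 2 - 1 :> R by rewrite -natrX -Nn -natr1 addrK.
  rewrite expr2; nra.
have e1 : j.1 = k.1.
  apply: (key (fun x => co (g x) 0) M0) => //; first by rewrite lerDl ltW.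
  - by rewrite gj co_rvec.
  - by rewrite gk co_rvec.
have e2 : j.2 = k.2.
  apply: (key (fun x => co (g x) 1) M1) => //; first by rewrite lerDr ltW.
  - by rewrite gj co_rvec.
  - by rewrite gk co_rvec.
by move: jk; rewrite (surjective_pairing j) (surjective_pairing k) e1 e2 eqxx.
Qed.

Lemma exists_avoids g : sphere_loop g -> exists2 p, on_sphere p & avoids g p.
Proof.
move=> sg; have [r rs rg] := loop_not_onto sg; have [_ gs _] := sg.
exists (- r).
  by apply/on_sphereP; rewrite -scaleN1r dotZl dotZr; have /on_sphereP -> := rs; ring.
move=> x; rewrite -scaleN1r dotZl.
have : 0 < dot (r - g x) (r - g x).
  rewrite lt0r -enorm2 sqr_ge0 andbT enorm2; apply/eqP => /dot_eq0/eqP.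
  by rewrite subr_eq0 eq_sym (negbTE (rg x)).
rewrite -[- g x]scaleN1r !(dotDl, dotDr, dotZl, dotZr) (dotC (g x) r).
have /on_sphereP -> := rs; have /on_sphereP -> := gs x; lra.
Qed.

End ConeArea.

(** * Every loop bounds a disc *)

Section ConeDisc.
Context {R : realType}.
Implicit Types (p : 'rV[R]_3) (g : R -> 'rV[R]_3).

(** Stereographic coordinate of y from the antipode of p, and its squared
    norm when p and y are unit vectors. *)
Definition stereo p (y : 'rV[R]_3) : 'rV[R]_3 :=
  (1 + dot p y)^-1 *: (y - dot p y *: p).
Definition stereo_sq p (y : 'rV[R]_3) : R := (1 - dot p y) / (1 + dot p y).

(** The inverse stereographic image of the straight cone over the coordinate
    curve. Unlike the normalization of an affine cone it is rational in the
    radius, with a denominator that never vanishes. *)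
Definition cone_disc p g (z : R * R) : 'rV[R]_3 :=
  (1 + z.1 ^+ 2 * stereo_sq p (g z.2))^-1 *:
    ((2 * z.1) *: stereo p (g z.2) + (1 - z.1 ^+ 2 * stereo_sq p (g z.2)) *: p).

Lemma C1_fst : Ck 1 setT (fun z : R * R => z.1 : R).
Proof.
apply: C1_linear => [|h z v /=]; last by [].
by move=> z; exact: cvg_fst.
Qed.

Lemma C1_snd : Ck 1 setT (fun z : R * R => z.2 : R).
Proof.
apply: C1_linear => [|h z v /=]; last by [].
by move=> z; exact: cvg_snd.
Qed.

Lemma C1_comp_snd (F : R -> R) : Ck 1 setT (F : R -> R) -> Ck 1 setT (fun z : R * R => F z.2).
Proof.
move=> /C1_derive1[Fd Fc].
apply: (@C1_comp R _ F (derive1 F) _ C1_snd) => x.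
exact: Fc.
Qed.

Lemma radial_derive_snd (F : R -> R) (z : R * R) : Ck 1 setT (F : R -> R) ->
  is_derive z ((1, 0) : R * R) (fun z : R * R => F z.2) 0.
Proof.
move=> /C1_derive1[Fd _].
have := @is_derive_comp_linear R (R * R)%type snd F z ((1, 0) : R * R) (derive1 F z.2).
by rewrite /= mul0r; apply => //; exact: Fd.
Qed.

Lemma radial_derive_fst (z : R * R) : is_derive z ((1, 0) : R * R) (fun z : R * R => z.1) 1.
Proof.
have := @is_derive_comp_linear R (R * R)%type fst id z ((1, 0) : R * R) 1.
by rewrite /= mul1r; apply => //; exact: is_derive_id.
Qed.

Section Disc.
Variables (p : 'rV[R]_3) (g : R -> 'rV[R]_3).
Hypotheses (sp : on_sphere p) (sg : sphere_loop g) (av : avoids g p).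

Let w k x : R := co (stereo p (g x)) k.
Let m x : R := stereo_sq p (g x).

Let av0 x : 1 + dot p (g x) != 0. Proof. by rewrite gt_eqF. Qed.

Lemma stereo_sq_ge0 x : 0 <= m x.
Proof.
have [_ gs _] := sg; rewrite /m /stereo_sq divr_ge0 // ?(ltW (av x)) //.
have : 0 <= dot (p - g x) (p - g x) by rewrite -enorm2 sqr_ge0.
rewrite -[- g x]scaleN1r !(dotDl, dotDr, dotZl, dotZr) (dotC (g x) p).
have /on_sphereP -> := sp; have /on_sphereP -> := gs x; lra.
Qed.

Let D0 (z : R * R) : 1 + z.1 ^+ 2 * m z.2 != 0.
Proof. by rewrite gt_eqF // ltr_wpDr // mulr_ge0 ?sqr_ge0 // stereo_sq_ge0. Qed.

Let C1dp : Ck 1 setT (fun x => dot p (g x) : R).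
Proof. by have [_ _ gC] := sg; exact: C1_dot. Qed.

Let C1dpV : Ck 1 setT (fun x => (1 + dot p (g x))^-1 : R).
Proof. by apply: C1_inv => [|x]; [apply: C1_add; [exact: C1_const|exact: C1dp]|exact: av0]. Qed.

Let C1w k : (k <= 2)%N -> Ck 1 setT (w k : R -> R).
Proof.
move=> k2; have [_ _ /C1_coP gC] := sg.
rewrite (_ : w k = fun x => (1 + dot p (g x))^-1 * (co (g x) k - dot p (g x) * co p k)).
  apply: C1_mul; [exact: C1dpV|apply: C1_sub; [exact: gC|apply: C1_mul; [exact: C1dp|exact: C1_const]]].
by apply/funext => x; rewrite /w /stereo coZ coD coN coZ.
Qed.

Let C1m : Ck 1 setT (m : R -> R).
Proof. by apply: C1_mul; [apply: C1_sub; [exact: C1_const|exact: C1dp]|exact: C1dpV]. Qed.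

Let C1sqm : Ck 1 setT (fun z : R * R => z.1 ^+ 2 * m z.2).
Proof.
apply: C1_mul; last by apply: C1_comp_snd; exact: C1m.
by under eq_fun do rewrite expr2; apply: C1_mul; exact: C1_fst.
Qed.

Let C1D1 : Ck 1 setT (fun z : R * R => (1 + z.1 ^+ 2 * m z.2)^-1).
Proof. by apply: C1_inv => [|z]; [apply: C1_add; [exact: C1_const|exact: C1sqm]|exact: D0]. Qed.

Let coneE k z : co (cone_disc p g z) k =
  (1 + z.1 ^+ 2 * m z.2)^-1 * (2 * z.1 * w k z.2 + (1 - z.1 ^+ 2 * m z.2) * co p k).
Proof. by rewrite /cone_disc coZ coD (coZ (2 * z.1)) (coZ (1 - _)). Qed.

Let C1_2z : Ck 1 setT (fun z : R * R => 2 * z.1).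
Proof. by apply: C1_mul; [exact: C1_const|exact: C1_fst]. Qed.

Lemma C1_cone_disc : Ck 1 setT (cone_disc p g).
Proof.
apply/C1_coP => k k2; under eq_fun do rewrite coneE.
apply: C1_mul; first exact: C1D1.
apply: C1_add; apply: C1_mul.
- exact: C1_2z.
- by apply: C1_comp_snd; exact: C1w.
- by apply: C1_sub; [exact: C1_const|exact: C1sqm].
- exact: C1_const.
Qed.

Let ds k (z : R * R) : R :=
  (1 + z.1 ^+ 2 * m z.2)^-1 *
   ((2 * w k z.2 - 2 * z.1 * m z.2 * co p k)
    - (2 * z.1 * m z.2) * ((1 + z.1 ^+ 2 * m z.2)^-1 *
      (2 * z.1 * w k z.2 + (1 - z.1 ^+ 2 * m z.2) * co p k))).

Let dsP (z : R * R) : is_derive z ((1, 0) : R * R) (cone_disc p g) (rvec 3 [:: ds 0 z; ds 1 z; ds 2 z]).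
Proof.
apply/is_derive_coP => k k2.
have -> : co (rvec 3 [:: ds 0 z; ds 1 z; ds 2 z]) k = ds k z.
  by rewrite co_rvec //; move: k k2 => [|[|[|k]]].
under eq_fun do rewrite coneE.
have d1 := radial_derive_fst z; have dm := radial_derive_snd z C1m; have dw := radial_derive_snd z (C1w k2).
have c1 (c : R) := is_derive_const c z ((1, 0) : R * R).
have dq : is_derive z ((1, 0) : R * R) (fun z : R * R => z.1 ^+ 2 * m z.2) (2 * z.1 * m z.2).
  under eq_fun do rewrite expr2.
  by apply: is_derive_eq (is_derive_mul (is_derive_mul d1 d1) dm) _; ring.
have dVq := @is_derive_inv R _ (fun z : R * R => 1 + z.1 ^+ 2 * m z.2) z ((1, 0) : R * R) _ (D0 z) (is_derive_add (c1 1) dq).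
apply: is_derive_eq (is_derive_mul dVq (is_derive_add (is_derive_mul (is_derive_mul (c1 2) d1) dw)
  (is_derive_mul (is_derive_sub (c1 1) dq) (c1 (co p k))))) _.
have := D0 z; rewrite /ds; move: (m _) (w _ _) (co p k) => M W P h.
by rewrite !expr2; field; rewrite -expr2.
Qed.

Lemma C1_cone_disc_radial : Ck 1 setT (fun z => 'D_(1, 0) (cone_disc p g) z).
Proof.
have -> : (fun z => 'D_(1, 0) (cone_disc p g) z) = fun z => rvec 3 [:: ds 0 z; ds 1 z; ds 2 z].
  by apply/funext => z; have [_ ->] := dsP z.
have dsC k : (k <= 2)%N -> Ck 1 setT (ds k : R * R -> R).
  move=> k2; rewrite /ds.
  have A : Ck 1 setT (fun z : R * R => 2 * z.1 * m z.2).
    by apply: C1_mul; [exact: C1_2z|apply: C1_comp_snd; exact: C1m].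
  have B : Ck 1 setT (fun z : R * R => w k z.2) by apply: C1_comp_snd; exact: C1w.
  have C := C1_const.
  apply: C1_mul; first exact: C1D1.
  apply: C1_sub; last apply: C1_mul; [|exact: A|].
    by apply: C1_sub; apply: C1_mul; [exact: C|exact: B|exact: A|exact: C].
  apply: C1_mul; first exact: C1D1.
  apply: C1_add; apply: C1_mul.
  - exact: C1_2z.
  - exact: B.
  - by apply: C1_sub; [exact: C|exact: C1sqm].
  - exact: C.
apply/C1_coP => k k2.
have -> : (fun z => co (rvec 3 [:: ds 0 z; ds 1 z; ds 2 z]) k) = ds k.
  by apply/funext => z; rewrite co_rvec //; case: k k2 => [|[|[|]]].
exact: dsC.
Qed.

Lemma cone_disc_spanning : spanning_disc g (cone_disc p g).
Proof.
have [gp gs _] := sg; have /on_sphereP p1 := sp.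
split; [exact: C1_cone_disc|exact: C1_cone_disc_radial| | |split].
- move=> z; have /on_sphereP y1 := gs z.2; apply/on_sphereP.
  rewrite /cone_disc /stereo -[- (_ *: p)]scaleN1r !(dotZl, dotZr, dotDl, dotDr).
  rewrite (dotC (g _) p) p1 y1.
  have := D0 z; have := av0 z.2; rewrite /m /stereo_sq.
  move: (dot p (g z.2)) (z.1) => a s h1 h2.
  field; rewrite h1 /=.
  have e : 1 + a + s * s * (1 - a) = (1 + a) * (1 + s ^+ 2 * ((1 - a) / (1 + a))) by field.
  by rewrite (_ : _ + _ = (1 + a) * (1 + s ^+ 2 * ((1 - a) / (1 + a)))) ?mulf_neq0 //; field.
- by move=> s x; rewrite /cone_disc /= gp.
- move=> x; rewrite /cone_disc /= !expr0n /= !mul0r !mulr0 !scale0r !subr0 !addr0.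
  by [].
- move=> x; rewrite /cone_disc /= expr1n !mul1r !mulr1.
  apply: co_ext => k k2; rewrite /stereo /stereo_sq !(coZ, coD, coN).
  have := av0 x; move: (dot p (g x)) => a h; field; rewrite h /=.
  by rewrite (_ : _ + _ = 2) //; ring.
Qed.

End Disc.
End ConeDisc.

(** * Integrals depending on a parameter *)

Section ParamIntegrals.
Context {R : realType}.

(** The tube lemma for the compact segment [0, 1]. *)
Lemma segment_near (P : R -> R -> Prop) (s0 : R) :
  (forall x, 0 <= x <= 1 -> \forall z \near ((x, s0) : R * R), P z.2 z.1) ->
  \forall s \near s0, forall x, 0 <= x <= 1 -> P s x.
Proof.
move=> h.
have /compact_near_coveringP nc := @segment_compact R 0 1.
have : nbhs s0 (fun s => `[0, 1]%classic `<=` P s).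
  apply: (nc R (nbhs s0) P) => x; rewrite /= in_itv /= => /h [[U V] [/= Ux Vs] UV].
  by exists (U, V) => //= -[a b] [/= Ua Vb]; exact: (UV (a, b)).
by apply: filterS => s sP x x01; apply: sP; rewrite /= in_itv.
Qed.

Lemma tube (f : R * R -> R) (s0 e : R) : 0 < e ->
  (forall x, 0 <= x <= 1 -> {for (s0, x), continuous f}) ->
  \forall s \near s0, forall x, 0 <= x <= 1 -> `|f (s, x) - f (s0, x)| < e.
Proof.
move=> e0 fc; apply: segment_near => x x01.
have e2 : 0 < e / 2 by lra.
have /cvgrPdist_lt/(_ _ e2) [[U V] [/= Us Vx] UV] := fc x x01.
exists (V, U) => //= -[a b] [/= Va Ub].
have h1 := UV (b, a) (conj Ub Va).
have h2 := UV (s0, a) (conj (nbhs_singleton Us) Va).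
rewrite (_ : _ - _ = (f (s0, x) - f (s0, a)) - (f (s0, x) - f (b, a))); last by ring.
by apply: le_lt_trans (ler_normB _ _) _; move: h1 h2 => /=; lra.
Qed.

Lemma prim_diff (f g : R -> R) : continuous f -> continuous g ->
  exists2 c, 0 <= c <= 1 & prim f 1 - prim g 1 = f c - g c.
Proof.
move=> fc gc.
have hc : continuous (fun x => -1 * g x + f x).
  by move=> x; apply: cvgD; [apply: cvgM; [exact: cvg_cst|exact: gc]|exact: fc].
have [c c01 e] := prim_mvt hc.
by exists c => //; move: e; rewrite prim_lin // !mulN1r addrC => ->; rewrite addrC.
Qed.

Lemma slice_continuous (T : topologicalType) (f : R * R -> T) (s : R) : continuous f ->
  continuous (fun x => f (s, x)).
Proof.
move=> fc x; apply: (@continuous_comp _ _ _ (fun x : R => (s, x)) f); last exact: fc.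
exact: (@cvg_pair _ _ _ (nbhs x) (nbhs s) (nbhs x) _ _ _ (fun=> s) id (cvg_cst s) cvg_id).
Qed.

Lemma prim_param_continuous (f : R * R -> R) : continuous f ->
  continuous (fun s => prim (fun x => f (s, x)) 1).
Proof.
move=> fc s0; apply/cvgrPdist_lt => e e0.
have := @tube f s0 e e0 (fun x _ => fc (s0, x)).
apply: filterS => s hs.
have [c c01 ->] := prim_diff (slice_continuous (s := s0) fc) (slice_continuous (s := s) fc).
by rewrite distrC; exact: hs.
Qed.

Lemma mvt_abs (f df : R -> R) (s k : R) :
  (forall r, `|r - s| <= `|k| -> is_derive r 1 f (df r)) ->
  exists2 r, `|r - s| <= `|k| & f (s + k) - f s = df r * k.
Proof.
move=> fd.
have main (a b : R) : a <= b -> (forall r : R, a <= r <= b -> is_derive r 1 f (df r)) ->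
    exists2 r, a <= r <= b & f b - f a = df r * (b - a).
  move=> ab fab.
  have [||r] := @MVT_segment _ f df a b ab.
  - by move=> x; rewrite in_itv /= => /andP[ax xb]; apply: fab; rewrite !ltW.
  - apply: derivable_within_continuous => x; rewrite in_itv /= => xab.
    by have [] := fab x xab.
  by rewrite in_itv /= => rab e; exists r.
have [k0|k0] := leP 0 k.
  have [|r|r rb e] := main s (s + k); first by rewrite lerDl.
    by move=> /andP[r0 r1]; apply: fd; rewrite !ger0_norm ?subr_ge0 // lerBlDl.
  exists r; last by rewrite e; congr (_ * _); ring.
  by move/andP: rb => [r0 r1]; rewrite !ger0_norm ?subr_ge0 // lerBlDl.
have [|r|r rb e] := main (s + k) s; first by rewrite gerDl ltW.
  by move=> /andP[r0 r1]; apply: fd; rewrite ler0_norm ?subr_le0 // ltr0_norm //; lra.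
exists r; last by rewrite -opprB e; ring.
by move/andP: rb => [r0 r1]; rewrite ler0_norm ?subr_le0 // ltr0_norm //; lra.
Qed.

Lemma is_derive_eps (f : R -> R) (s d : R) :
  (forall e, 0 < e -> \forall k \near (0 : R), `|f (s + k) - f s - d * k| <= e * `|k|) ->
  is_derive s 1 f d.
Proof.
move=> h.
have c : h^-1 *: ((f \o shift s) (h *: (1 : R)) - f s) @[h --> (0 : R)^'] --> d.
  apply/cvgrPdist_le => e e0.
  near=> k.
  have k0 : k != 0 by near: k; exact: nbhs_dnbhs_neq.
  have : `|f (s + k) - f s - d * k| <= e * `|k|.
    by near: k; apply: nbhs_dnbhs; exact: h.
  have E : d - k^-1 *: (f (k + s) - f s) = - ((f (s + k) - f s - d * k) / k).
    by rewrite /GRing.scale /= (addrC k); field.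
  by rewrite /= [k *: 1]mulr1 E normrN normrM normfV ler_pdivrMr ?normr_gt0.
split; first by apply/cvg_ex; exists d.
by apply: cvg_lim => //; exact: Rhausdorff.
Unshelve. all: by end_near. Qed.

Lemma derive_eps (f : R -> R) (s d : R) : is_derive s 1 f d ->
  forall e, 0 < e -> \forall k \near (0 : R), `|f (s + k) - f s - d * k| <= e * `|k|.
Proof.
move=> [/cvg_ex[l fl] e1] e e0.
have ld : l = d by rewrite -e1; symmetry; apply: cvg_lim => //; exact: Rhausdorff.
move/cvgrPdist_le : fl => /(_ e e0); rewrite ld /dnbhs near_withinE.
apply: filterS => k hk.
have [->|k0] := eqVneq k 0; first by rewrite addr0 subrr mulr0 subrr normr0 mulr0.
have := hk k0; rewrite /= [k *: 1]mulr1.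
have E : d - k^-1 *: (f (k + s) - f s) = - ((f (s + k) - f s - d * k) / k).
  by rewrite /GRing.scale /= (addrC k); field.
by rewrite E normrN normrM normfV ler_pdivrMr ?normr_gt0.
Qed.

Lemma prim_param_derive (F dF : R * R -> R) (s0 : R) :
  (\forall s \near s0, (forall x : R, is_derive s (1 : R) (fun s : R => F (s, x)) (dF (s, x))) /\
     continuous (fun x => F (s, x))) ->
  continuous (fun x => dF (s0, x)) ->
  (forall x, 0 <= x <= 1 -> {for (s0, x), continuous dF}) ->
  is_derive s0 1 (fun s => prim (fun x => F (s, x)) 1) (prim (fun x => dF (s0, x)) 1).
Proof.
move=> Fd dFc dFc0; apply: is_derive_eps => e e0.
have t := tube e0 dFc0.
have [d /= d0 dP] : nbhs s0 ((fun s : R => (forall x : R, is_derive s (1 : R) (fun s : R => F (s, x)) (dF (s, x))) /\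
     continuous (fun x => F (s, x))) `&` (fun s => forall x, 0 <= x <= 1 -> `|dF (s, x) - dF (s0, x)| < e)).
  exact: filterI.
exists d => // k; rewrite /ball_ /= sub0r normrN => kd.
have inb r : `|r - s0| <= `|k| -> ball s0 d r.
  by move=> rk; rewrite /ball /= distrC; exact: le_lt_trans kd.
have z0 : `|s0 - s0| <= `|k| by rewrite subrr normr0.
have zk : `|s0 + k - s0| <= `|k| by rewrite addrAC subrr add0r.
have [[_ Fc0'] _] := dP s0 (inb s0 z0).
have [[_ Fck'] _] := dP (s0 + k) (inb _ zk).
have hc : continuous (fun x => k * dF (s0, x) + F (s0, x)).
  by move=> x; apply: cvgD; [apply: cvgM; [exact: cvg_cst|exact: dFc]|exact: Fc0'].
have [c c01 E] := prim_diff Fck' hc.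
have -> : prim (fun x => F (s0 + k, x)) 1 - prim (fun x => F (s0, x)) 1 - prim (fun x => dF (s0, x)) 1 * k
  = F (s0 + k, c) - (k * dF (s0, c) + F (s0, c)).
  by rewrite -E prim_lin //; ring.
have [r rk Er] := @mvt_abs (fun s => F (s, c)) (fun s => dF (s, c)) s0 k (fun r rk => (dP r (inb r rk)).1.1 c).
have -> : F (s0 + k, c) - (k * dF (s0, c) + F (s0, c)) = (dF (r, c) - dF (s0, c)) * k.
  by rewrite mulrBl -Er; ring.
rewrite normrM ler_wpM2r //; apply: ltW; exact: (dP r (inb r rk)).2.
Qed.

(** Schwarz's theorem when only one of the two mixed partial derivatives is
    known to exist: the second difference of h, divided by one increment, is
    computed by two applications of the mean value theorem, and letting that
    increment tend to 0 gives the difference quotient of hx. *)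
Lemma mixed_partial (h hs hx hsx : R * R -> R) :
  (forall s x : R, is_derive s 1 (fun s => h (s, x)) (hs (s, x))) ->
  (forall s x : R, is_derive x 1 (fun x => h (s, x)) (hx (s, x))) ->
  (forall s x : R, is_derive x 1 (fun x => hs (s, x)) (hsx (s, x))) ->
  continuous hsx ->
  forall s x : R, is_derive s 1 (fun s => hx (s, x)) (hsx (s, x)).
Proof.
move=> ds dx dsx csx s x; apply: is_derive_eps => e e0.
have [[U V] [/= Us Vx] UV] := (cvgrPdist_lt _ _).1 (csx (s, x)) _ e0.
have [d1 /= d10 U1] := Us; have [d2 /= d20 V2] := Vx.
exists d1 => // k; rewrite /ball_ /= sub0r normrN => kd.
apply/ler_addgt0Pr => e' e'0.
have e'2 : 0 < e' / 2 by lra.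
have [dl1 /= dl10 L1] := derive_eps (dx (s + k) x) e'2.
have [dl2 /= dl20 L2] := derive_eps (dx s x) e'2.
pose l := Num.min d2 (Num.min dl1 dl2) / 2.
have l0 : 0 < l by rewrite divr_gt0 // !lt_min d20 dl10.
have lm : l < Num.min d2 (Num.min dl1 dl2) by rewrite ltr_pdivrMr // mulr_natr mulr2n ltrDl; move: l0; rewrite pmulr_lgt0.
have /and3P[ld2 ldl1 ldl2] : [&& l < d2, l < dl1 & l < dl2] by move: lm; rewrite !lt_min.
have nl : `|l| = l by rewrite gtr0_norm.
have h1 := L1 l; rewrite /ball_ /= sub0r normrN nl in h1; have {}h1 := h1 ldl1.
have h2 := L2 l; rewrite /ball_ /= sub0r normrN nl in h2; have {}h2 := h2 ldl2.
have [r rk Er] := @mvt_abs (fun s => h (s, x + l) - h (s, x)) (fun s => hs (s, x + l) - hs (s, x)) s k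
  (fun r _ => is_derive_sub (ds r (x + l)) (ds r x)).
have [q ql Eq] := @mvt_abs (fun x => hs (r, x)) (fun x => hsx (r, x)) x l (fun q _ => dsx r q).
rewrite /= in Er Eq; rewrite Eq in Er.
have close : `|hsx (s, x) - hsx (r, q)| < e.
  apply: (UV (r, q)); split; [apply: U1|apply: V2]; rewrite /ball /= distrC.
  - exact: le_lt_trans kd.
  - by apply: le_lt_trans ql _; rewrite nl.
have ln : l != 0 by rewrite gt_eqF.
rewrite -(ler_pM2r l0) mulrDl -{1}nl -normrM.
have -> : (hx (s + k, x) - hx (s, x) - hsx (s, x) * k) * l
  = (hsx (r, q) - hsx (s, x)) * (k * l)
   - (h (s + k, x + l) - h (s + k, x) - hx (s + k, x) * l)
   + (h (s, x + l) - h (s, x) - hx (s, x) * l).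
  rewrite [X in _ = X - _ + _]mulrBl.
  have -> : hsx (r, q) * (k * l) = hsx (r, q) * l * k by ring.
  by rewrite -Er; ring.
apply: le_trans (ler_normD _ _) _.
apply: le_trans (lerD (ler_normB _ _) h2) _.
have : `|(hsx (r, q) - hsx (s, x)) * (k * l)| <= e * `|k| * l.
  by rewrite normrM normrM nl mulrA ler_wpM2r ?(ltW l0) // ler_wpM2r // distrC ltW.
by move: h1; lra.
Qed.

End ParamIntegrals.

(** * The area class of a loop is the area of its cones *)

Section DiscArea.
Context {R : realType}.
Implicit Types (p a b : 'rV[R]_3).

Lemma is_derive_slice1 (W : normedModType R) (f : R * R -> W) (s x : R) d :
  is_derive ((s, x) : R * R) ((1, 0) : R * R) f d -> is_derive s 1 (fun s => f (s, x)) d.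
Proof.
move=> /is_derive_line h; apply/is_derive_line; congr (is_derive _ _ _ _): h.
apply/funext => k; congr f; rewrite -[LHS]/(k *: 1 + s, k *: 0 + x) /=.
by rewrite scaler0 add0r.
Qed.

Lemma is_derive_slice2 (W : normedModType R) (f : R * R -> W) (s x : R) d :
  is_derive ((s, x) : R * R) ((0, 1) : R * R) f d -> is_derive x 1 (fun x => f (s, x)) d.
Proof.
move=> /is_derive_line h; apply/is_derive_line; congr (is_derive _ _ _ _): h.
apply/funext => k; congr f; rewrite -[LHS]/(k *: 0 + s, k *: 1 + x) /=.
by rewrite scaler0 add0r.
Qed.

Lemma area_rel_cos (a b c : R) : area_rel a b -> cos ((a - c) / 2) = cos ((b - c) / 2).
Proof.
move=> /intrP[k e].
have -> : (a - c) / 2 = (b - c) / 2 + (2 * pi) * k%:~R.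
  have gen (P : R) : P != 0 -> (a - c) / 2 = (b - c) / 2 + (2 * P) * ((a - b) / (4 * P)).
    by move=> P0; field.
  by rewrite -e; apply: gen; rewrite gt_eqF // pi_gt0.
exact: cos2pi_int.
Qed.

(** Both sides are the scalar product of y x p with p x (a x b). *)
Lemma triple_swap p y a b :
  triple p y b * dot p a - triple p y a * dot p b
  = triple p a b * dot y p - dot p p * triple y a b.
Proof. coex; ring. Qed.

Definition loop (h : R * R -> 'rV[R]_3) s x := h (s, x).

Section Disc.
Variables h hs hx hsx : R * R -> 'rV[R]_3.
Hypotheses (hc : continuous h) (hsc : continuous hs) (hxc : continuous hx)
  (hsxc : continuous hsx)
  (ds : forall s x : R, is_derive s 1 (fun s => h (s, x)) (hs (s, x)))
  (dx : forall s x : R, is_derive x 1 (fun x => h (s, x)) (hx (s, x)))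
  (dsx : forall s x : R, is_derive x 1 (fun x => hs (s, x)) (hsx (s, x)))
  (h1 : forall z, dot (h z) (h z) = 1)
  (hp : forall s x, h (s, x + 1) = h (s, x)).

Let T z := triple (h z) (hs z) (hx z).

Let dxs (s x : R) : is_derive s 1 (fun s => hx (s, x)) (hsx (s, x)).
Proof.
apply/is_derive_coP => k k2.
apply: (@mixed_partial _ (fun z => co (h z) k) (fun z => co (hs z) k) (fun z => co (hx z) k)
  (fun z => co (hsx z) k)) => [s' x'|s' x'|s' x'|z].
- by have /is_derive_coP := ds s' x'; apply.
- by have /is_derive_coP := dx s' x'; apply.
- by have /is_derive_coP := dsx s' x'; apply.
- by have /continuous_coP := hsxc (x := z); apply.
Qed.

Let hhs s x : dot (h (s, x)) (hs (s, x)) = 0.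
Proof.
have := is_derive_dot (ds s x) (ds s x); rewrite (_ : (fun y : R => _) = fun=> 1); last first.
  by apply/funext => y; exact: h1.
by move=> /is_derive_derive1; rewrite derive1_cst (dotC (hs _)); lra.
Qed.

Let hhx s x : dot (h (s, x)) (hx (s, x)) = 0.
Proof.
have := is_derive_dot (dx s x) (dx s x); rewrite (_ : (fun y : R => _) = fun=> 1); last first.
  by apply/funext => y; exact: h1.
by move=> /is_derive_derive1; rewrite derive1_cst (dotC (hx _)); lra.
Qed.



Let loopS s : sphere_loop (loop h s).
Proof.
split=> [x|x|]; first exact: hp.
  by apply/on_sphereP; exact: h1.
have A (x : R) : is_derive x 1 (loop h s) (hx (s, x)) by exact: dx.
exact: (C1_of_derive A (slice_continuous (s := s) hxc)).
Qed.

Let hx_loop s x : derive1 (loop h s) x = hx (s, x).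
Proof. exact: (is_derive_derive1 (dx s x)). Qed.

Let hsp s x : hs (s, x + 1) = hs (s, x).
Proof.
rewrite -(is_derive_derive1 (ds s (x + 1))) -(is_derive_derive1 (ds s x)).
have -> : (fun s => h (s, x + 1)) = (fun s => h (s, x)) by apply/funext => y; exact: hp.
by [].
Qed.

Let Tc : continuous T.
Proof. by move=> z; apply: continuous_triple; [exact: hc|exact: hsc|exact: hxc]. Qed.

Let near_avoids p s0 : avoids (loop h s0) p -> \forall s \near s0, avoids (loop h s) p.
Proof.
move=> av.
have : \forall s \near s0, forall x, 0 <= x <= 1 -> 0 < 1 + dot p (h (s, x)).
  apply: (@segment_near R (fun s x => 0 < 1 + dot p (h (s, x)))) => x x01.
  have c : {for (x, s0), continuous (fun z : R * R => 1 + dot p (h (z.2, z.1)))}.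
    apply: cvgD; first exact: cvg_cst.
    apply: continuous_dot; first exact: cvg_cst.
    apply: (@continuous_comp _ _ _ (fun z : R * R => (z.2, z.1)) h); last exact: hc.
    exact: (@cvg_pair _ _ _ (nbhs (x, s0)) (nbhs s0) (nbhs x) _ _ _ snd fst cvg_snd cvg_fst).
  have := c; rewrite /prop_for /continuous_at => /cvgr_gt; apply.
  exact: av.
apply: filterS => s P x.
rewrite /loop; have := period_int (hp s) (- Num.floor x) x; rewrite mul1r rmorphN => <-.
by apply: P; have := floor_bounds x; lra.
Qed.

(** Stokes' theorem on a thin strip: away from -p the area form is exact, so
    the derivative of the integrand differs from the density of area by the
    x-derivative of the periodic function G. *)
Let cone_area_derive p s0 : on_sphere p -> avoids (loop h s0) p ->
  is_derive s0 1 (fun s => cone_area p (loop h s)) (prim (fun x => T (s0, x)) 1).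
Proof.
move=> /on_sphereP p1 av.
pose D z := 1 + dot p (h z).
pose F z := triple p (h z) (hx z) / D z.
pose dF z := (triple p (hs z) (hx z) + triple p (h z) (hsx z)) / D z
   + triple p (h z) (hx z) * (- dot p (hs z) / D z ^+ 2).
pose G z := triple p (h z) (hs z) / D z.
have eF s : cone_area p (loop h s) = prim (fun x => F (s, x)) 1.
  have e : cone_density p (loop h s) = (fun x => F (s, x)).
    by apply/funext => x; rewrite /cone_density hx_loop.
  by rewrite /cone_area e.
under eq_fun do rewrite eF.
have d1D (W : R -> 'rV[R]_3) (t : R) d : is_derive t 1 W d ->
   is_derive t 1 (fun t => 1 + dot p (W t)) (dot p d).
  move=> Wd; apply: is_derive_eq (is_derive_add (is_derive_const 1 t (1:R)) (is_derive_dot (is_derive_cst p t (1 : R)) Wd)) _.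
  by rewrite add0r (_ : dot 0 _ = 0) ?add0r // -(scale0r p) dotZl mul0r.
have dtr (W Z : R -> 'rV[R]_3) (t : R) w z : is_derive t 1 W w -> is_derive t 1 Z z ->
   is_derive t 1 (fun t => triple p (W t) (Z t)) (triple p w (Z t) + triple p (W t) z).
  move=> Ww Zz; apply: is_derive_eq (is_derive_triple (is_derive_cst p t (1 : R)) Ww Zz) _.
  rewrite /cst -addrA -[RHS]add0r; congr (_ + _).
  by rewrite tripleE !co0; ring.
have Dc z : {for z, continuous D}.
  by apply: cvgD; [exact: cvg_cst|apply: continuous_dot; [exact: cvg_cst|exact: hc]].
have dFc z : D z != 0 -> {for z, continuous dF}.
  move=> Dz.
  have DVc : {for z, continuous (fun z => (D z)^-1)} by apply: cvgV => //; exact: Dc.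
  apply: cvgD; apply: cvgM.
  - by apply: cvgD; apply: continuous_triple; first [exact: cvg_cst|exact: hsc|exact: hxc|exact: hc|exact: hsxc].
  - exact: DVc.
  - by apply: continuous_triple; first [exact: cvg_cst|exact: hsc|exact: hxc|exact: hc|exact: hsxc].
  - apply: cvgM; first by apply: cvgN; apply: continuous_dot; [exact: cvg_cst|exact: hsc].
    apply: cvgV; first by rewrite expf_neq0.
    by apply: (@continuous_comp _ _ _ D (fun x : R => x ^+ 2)); [exact: Dc|exact: exprn_continuous].
have D0 x : D (s0, x) != 0 by rewrite gt_eqF //; exact: av.
have dFslice : continuous (fun x => dF (s0, x)).
  move=> x; apply: (@continuous_comp _ _ _ (fun x : R => (s0, x)) dF); last exact/dFc.
  exact: (@cvg_pair _ _ _ (nbhs x) (nbhs s0) (nbhs x) _ _ _ (fun=> s0) id (cvg_cst s0) cvg_id).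
suff <- : prim (fun x => dF (s0, x)) 1 = prim (fun x => T (s0, x)) 1.
  apply: prim_param_derive.
  - have := near_avoids av; apply: filterS => s avs; split=> [x|].
      have Dz : D (s, x) != 0 by rewrite gt_eqF //; exact: avs.
      exact: (is_derive_mul (dtr _ _ _ _ _ (ds s x) (dxs s x)) (@is_derive_inv R _ (fun s => D
        (s, x)) s 1 _ Dz (d1D _ _ _ (ds s x)))).
    have := cone_density_continuous (loopS s) avs.
    have -> : cone_density p (loop h s) = (fun x => F (s, x)).
      by apply/funext => x; rewrite /cone_density hx_loop.
    by [].
  - exact: dFslice.
  - by move=> x _; exact/dFc.
have Tsc : continuous (fun x => T (s0, x)) by exact: slice_continuous Tc.
have dK (x : R) : is_derive x 1 (fun x => prim (fun x => T (s0, x)) x + G (s0, x)) (dF (s0, x)).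
  have dG := is_derive_mul (dtr _ _ _ _ _ (dx s0 x) (dsx s0 x)) (@is_derive_inv R _ (fun x => D
    (s0, x)) x 1 _ (D0 x) (d1D _ _ _ (dx s0 x))).
  apply: is_derive_eq (is_derive_add (is_derive_prim x Tsc) dG) _.
  have n1 := triple_normal (a := hs (s0, x)) (b := hx (s0, x)) p (h1 (s0, x)) (hhs s0 x) (hhx s0 x).
  have n2 := triple_swap p (h (s0, x)) (hs (s0, x)) (hx (s0, x)).
  have n3 : triple p (hx (s0, x)) (hs (s0, x)) = - triple p (hs (s0, x)) (hx (s0, x)).
    by coex; ring.
  have := D0 x; rewrite /dF /D /T n3; rewrite n1 p1 mul1r (dotC _ p) in n2; rewrite n1.
  move: n2; set t := triple (h _) _ _; set c := dot p (h _); set a1 := triple p (h _) (hx _).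
  set a2 := triple p (h _) (hs _); set b1 := dot p (hs _); set b2 := dot p (hx _).
  move=> n2 Dz.
  apply/eqP; rewrite -subr_eq0; apply/eqP.
  transitivity ((t * (1 + c) ^+ 2 - 2 * c * t * (1 + c) + (a1 * b1 - a2 * b2)) / (1 + c) ^+ 2).
    by field.
  by rewrite n2; field.
rewrite (prim_unique 1 dFslice dK) prim0 add0r.
have -> : G (s0, 1) = G (s0, 0).
  by rewrite /G /D -(add0r 1) hp hsp.
by rewrite addrK.
Qed.

(** Write I s for the area swept up to radius s. No single pole serves all
    radii, but modulo 4 pi the cone area is independent of the pole, so
    c s = cos ((cone area - I s) / 2) is well defined for any choice of poles,
    and locally constant by Stokes. At s = 0 the loop is a point and c is 1. *)
Lemma disc_area_aux p1 : on_sphere p1 ->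
  avoids (loop h 1) p1 -> (forall x, h (0, x) = h (0, 0)) ->
  area_rel (prim (fun s => prim (fun x => T (s, x)) 1) 1) (cone_area p1 (loop h 1)).
Proof.
move=> sp av h00.
have [P PP] : exists P, forall s, on_sphere (P s) /\ avoids (loop h s) (P s).
  have h2 s : exists p, on_sphere p /\ avoids (loop h s) p.
    by have [q q1 q2] := exists_avoids (loopS s); exists q.
  by have [P] := choice h2; exists P.
pose I s := prim (fun s => prim (fun x => T (s, x)) 1) s.
pose c s := cos ((cone_area (P s) (loop h s) - I s) / 2).
have dc (s0 : R) : is_derive s0 1 c 0.
  have [sP aP] := PP s0.
  apply: (@near_eq_is_derive _ _ _ (fun s => cos ((cone_area (P s0) (loop h s) - I s) / 2))).
    have := near_avoids aP; apply: filterS => s avs.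
    have [sPs aPs] := PP s.
    apply: area_rel_cos; exact: (cone_area_indep (loopS s) sP sPs avs aPs).
  have dI : is_derive s0 1 I (prim (fun x => T (s0, x)) 1).
    apply: (@is_derive_prim _ (fun s => prim (fun x => T (s, x)) 1)).
    exact: prim_param_continuous.
  have dd := is_derive_mul (is_derive_sub (cone_area_derive sP aP) dI) (is_derive_const 2^-1 s0 (1 : R)).
  have d3 := @is_derive_comp R _ cos (fun s => (cone_area (P s0) (loop h s) - I s) / 2) s0 1 _ _ (is_derive_cos _) dd.
  by apply: is_derive_eq d3 _; ring.
have c01 : c 0 = c 1 := is_derive_0_is_cst 0 1 dc.
have c0 : c 0 = 1.
  rewrite /c /I prim0 subr0 (_ : cone_area _ _ = 0) ?mul0r ?cos0 //.
  rewrite /cone_area (_ : cone_density _ _ = fun=> 0) ?prim_cst ?mul0r //.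
  apply/funext => x; rewrite /cone_density hx_loop (_ : hx (0, x) = 0).
    by rewrite tripleE !co0; ring.
  rewrite -hx_loop (_ : loop h 0 = cst (h (0, 0))) ?derive1_cst //.
  by apply/funext => y; exact: h00.
have [sP1 aP1] := PP 1.
have r1 : area_rel (cone_area (P 1) (loop h 1)) (I 1).
  by apply/area_relP; move: c0; rewrite c01.
have r2 := cone_area_indep (loopS 1) sp sP1 av aP1.
have [rr rs rt] := @area_rel_equiv R.
by rewrite rs; exact: rt r2 r1.
Qed.

End Disc.

Lemma disc_area (g : R -> 'rV[R]_3) (h : R * R -> 'rV[R]_3) p : spanning_disc g h ->
  on_sphere p -> avoids g p -> area_rel (signed_area h) (cone_area p g).
Proof.
move=> [/C1P[hc hd] /C1P[hsc hsd] h1 hp [h0 hg]] sp av.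
have [d10 c10] := hd ((1, 0) : R * R); have [d01 c01] := hd ((0, 1) : R * R).
have [ds01 cs01] := hsd ((0, 1) : R * R).
rewrite (_ : signed_area h = prim (fun s => prim (fun x =>
  triple (h (s, x)) ('D_(1, 0) h (s, x)) ('D_(0, 1) h (s, x))) 1) 1); last first.
  by rewrite /signed_area prim1; congr (prim _ 1); apply/funext => s; rewrite prim1.
have lg : loop h 1 = g by apply/funext => x; exact: hg.
rewrite -lg in av *.
apply: (@disc_area_aux h ('D_(1, 0) h) ('D_(0, 1) h) ('D_(0, 1) ('D_(1, 0) h)) hc c10 c01 cs01
   _ _ _ _ hp p sp av h0).
- by move=> s x; exact: (is_derive_slice1 (derivableP (d10 (s, x)))).
- by move=> s x; exact: (is_derive_slice2 (derivableP (d01 (s, x)))).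
- by move=> s x; exact: (is_derive_slice2 (derivableP (ds01 (s, x)))).
- by move=> z; apply/on_sphereP.
Qed.

Lemma area_class_cone (g : R -> 'rV[R]_3) p : sphere_loop g -> on_sphere p -> avoids g p ->
  area_class g = mod4pi (cone_area p g).
Proof.
move=> sg sp av; rewrite /area_class.
have ex : [set mod4pi (signed_area h) | h in spanning_disc g] !=set0.
  exact: (ex_intro _ _ (ex_intro2 _ _ (cone_disc p g) (cone_disc_spanning sp sg av) erefl)).
have [h hd e] := getPex ex; rewrite -e.
by apply/eqmodP; exact: disc_area hd sp av.
Qed.

Lemma mod4piP (a b : R) : mod4pi a = mod4pi b <-> area_rel a b.
Proof. by split=> [/eqmodP|h]; [|apply/eqmodP]. Qed.

End DiscArea.

(** * Constant-speed reparametrization and convergence of the area *)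

Section Anchored.
Context {R : realType}.
Implicit Types (p : 'rV[R]_3) (g : R -> 'rV[R]_3).

Lemma closed_curve_loop g : closed_curve g -> sphere_loop g.
Proof. by case. Qed.

Lemma enorm_gt0 n (u : 'rV[R]_n.+1) : u != 0 -> 0 < enorm u.
Proof.
move=> u0; rewrite lt0r enorm_ge0 andbT; apply: contra u0 => /eqP e.
by apply/eqP/dot_eq0; rewrite -enorm2 e expr0n.
Qed.

Lemma enormZ n (k : R) (u : 'rV[R]_n.+1) : enorm (k *: u) = `|k| * enorm u.
Proof. by rewrite /enorm dotZl dotZr mulrA -expr2 sqrtrM ?sqr_ge0 // sqrtr_sqr. Qed.

Section Arc.
Variable g : R -> 'rV[R]_3.
Hypothesis cg : closed_curve g.

Let gd (x : R) : is_derive x 1 g (derive1 g x).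
Proof. exact: sphere_loop_derive (closed_curve_loop cg) x. Qed.

Let gdc : continuous (derive1 g).
Proof. by have [_ _ /C1_derive1[_ +] _] := cg. Qed.

Lemma speed_gt0 x : 0 < speed g x.
Proof. by have [_ _ _ /(_ x) h] := cg; exact: enorm_gt0. Qed.

Lemma speed_continuous : continuous (speed g).
Proof.
move=> x; apply: (@continuous_comp _ _ _ (fun x => dot (derive1 g x) (derive1 g x)) Num.sqrt).
  by apply: continuous_dot; exact: gdc.
exact: sqrt_continuous.
Qed.

Lemma speed_period x : speed g (x + 1) = speed g x.
Proof. by have [gp _ _ _] := cg; rewrite /speed (derive1_period gp gd). Qed.

Lemma clengthE : clength g = prim (speed g) 1.
Proof. exact: prim1. Qed.

Lemma clength_gt0 : 0 < clength g.
Proof. by rewrite clengthE; have [c _ ->] := prim_mvt speed_continuous; exact: speed_gt0. Qed.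

Definition phase x : R := prim (speed g) x / clength g.

Let L0 : clength g != 0. Proof. by rewrite gt_eqF // clength_gt0. Qed.

Lemma phase_period x : phase (x + 1) = phase x + 1.
Proof.
rewrite /phase (prim_period x speed_continuous speed_period) -clengthE mulrDl divff //.
Qed.

Lemma phase_int x (k : int) : phase (x + k%:~R) = phase x + k%:~R.
Proof.
have per y : phase (y + 1) - (y + 1) = phase y - y by rewrite phase_period; ring.
have := @period_int R R (fun y => phase y - y) 1 per k x; rewrite mul1r /=; lra.
Qed.

Lemma phase0 : phase 0 = 0. Proof. by rewrite /phase prim0 mul0r. Qed.

Lemma arc_phaseE x : arc_phase g x = phase x.
Proof.
rewrite /arc_phase; have /andP[f0 f1] := floor_bounds x.
have := phase_int x (- Num.floor x); rewrite rmorphN /= => e.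
rewrite -prim_ge0 ?subr_ge0 // [_^-1 * _]mulrC.
by move: e; rewrite /phase => ->; ring.
Qed.

Lemma derive_phase (x : R) : is_derive x 1 phase (speed g x / clength g).
Proof.
apply: is_derive_eq (is_derive_mul (is_derive_prim x speed_continuous) (is_derive_const (clength g)^-1 x (1:R))) _.
by rewrite mulr0 addr0.
Qed.

Lemma phase_continuous : continuous phase.
Proof. exact: derive_continuous derive_phase. Qed.

Lemma phase_mono : {mono phase : x y / x <= y}.
Proof.
apply: le_mono => x y xy.
have [|c _ e] := @MVT _ phase (fun x => speed g x / clength g) x y xy (fun z _ => derive_phase z).
  by apply: continuous_subspaceT; exact: phase_continuous.
rewrite -subr_gt0 e mulr_gt0 ?subr_gt0 // divr_gt0 ?speed_gt0 ?clength_gt0 //.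
Qed.

Lemma phase_inj : injective phase.
Proof. by move=> x y e; apply/eqP; rewrite eq_le -(phase_mono x y) -(phase_mono y x) e lexx. Qed.

Local Notation Q := (arc_phase_inv g).

Lemma arc_phase_invK y : phase (Q y) = y.
Proof.
have ex : [set x | arc_phase g x = y] !=set0.
  have /andP[f0 f1] := floor_bounds y.
  have pk (k : int) : phase k%:~R = k%:~R.
    by have := phase_int 0 k; rewrite add0r phase0 add0r.
  have k01 : (Num.floor y)%:~R <= (Num.floor y + 1)%:~R :> R by rewrite intrD lerDl.
  have [||x _ xy] := @IVT _ phase _ _ y k01.
  - by apply: continuous_subspaceT; exact: phase_continuous.
  - rewrite !pk intrD; apply/andP; split.
      by rewrite ge_min f0.
    by rewrite le_max (ltW f1) orbT.
  by exists x; rewrite /= arc_phaseE.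
have := xgetPex 0 ex; rewrite /= arc_phaseE; exact.
Qed.

Lemma phaseK x : Q (phase x) = x.
Proof. by apply: phase_inj; rewrite arc_phase_invK. Qed.

Lemma arc_phase_inv_period y : Q (y + 1) = Q y + 1.
Proof. by apply: phase_inj; rewrite phase_period !arc_phase_invK. Qed.

Lemma arc_phase_inv0 : Q 0 = 0.
Proof. by rewrite -[X in Q X]phase0 phaseK. Qed.

Lemma derive_arc_phase_inv (y : R) : is_derive y 1 Q (clength g / speed g (Q y)).
Proof.
have := @is_derive_inverse R phase Q (speed g (Q y) / clength g) (Q y).
rewrite arc_phase_invK invf_div; apply.
- by near=> x; exact: phaseK.
- by near=> x; exact: phase_continuous.
- exact: derive_phase.
- by rewrite mulf_neq0 ?invr_eq0 // gt_eqF // speed_gt0.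
Unshelve. all: by end_near. Qed.

Lemma arc_phase_inv_continuous : continuous Q.
Proof. exact: derive_continuous derive_arc_phase_inv. Qed.

Lemma arc_phase_inv_slope_continuous : continuous (fun y => clength g / speed g (Q y)).
Proof.
move=> x; have Qc := @arc_phase_inv_continuous x.
apply: cvgM; first exact: cvg_cst.
apply: cvgV; first by rewrite gt_eqF // speed_gt0.
exact: (continuous_comp Qc (speed_continuous (x := _))).
Qed.

Lemma derive_anchored (y : R) :
  is_derive y 1 (anchored g) ((clength g / speed g (Q y)) *: derive1 g (Q y)).
Proof.
apply/is_derive_coP => k k2; rewrite coZ mulrC.
have /is_derive_coP/(_ k k2) gk := gd (Q y).
exact: (@is_derive_comp R _ (fun x => co (g x) k) Q y 1 _ _ gk (derive_arc_phase_inv y)).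
Qed.

Lemma anchored_loop : sphere_loop (anchored g).
Proof.
have [gp gs _ _] := cg; split=> [x|x|].
- by rewrite /anchored /= arc_phase_inv_period gp.
- exact: gs.
apply: (C1_of_derive derive_anchored) => x.
have Qc := @arc_phase_inv_continuous x.
apply: cvgZ; first exact: arc_phase_inv_slope_continuous.
exact: (continuous_comp Qc (gdc (x := _))).
Qed.

Lemma anchored_speed x : speed (anchored g) x = clength g.
Proof.
rewrite /speed (is_derive_derive1 (derive_anchored x)) enormZ.
have s0 := speed_gt0 (Q x).
by rewrite ger0_norm ?divr_ge0 ?ltW ?clength_gt0 // divfK // gt_eqF.
Qed.

(** A primitive of the density of g, composed with the inverse phase, is a
    primitive of the density of the reparametrized curve. *)
Lemma cone_area_anchored p : avoids g p ->
  cone_area p (anchored g) = cone_area p g.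
Proof.
move=> av; have sg := closed_curve_loop cg.
have ava : avoids (anchored g) p by move=> x; exact: av.
have dp (y : R) : is_derive y 1 (fun y => prim (cone_density p g) (Q y)) (cone_density p (anchored g) y).
  have d1 := is_derive_prim (Q y) (cone_density_continuous sg av).
  apply: is_derive_eq (@is_derive_comp R _ (prim (cone_density p g)) Q y 1 _ _ d1 (derive_arc_phase_inv y)) _.
  rewrite /cone_density (is_derive_derive1 (derive_anchored y)) /anchored /=.
  move: (clength g / _) => k; rewrite !tripleE !coZ; ring.
rewrite /cone_area (prim_unique 1 (cone_density_continuous anchored_loop ava) dp).
have -> : Q 1 = 1 by rewrite -(add0r 1) arc_phase_inv_period arc_phase_inv0.
by rewrite arc_phase_inv0 prim0 subr0.
Qed.

End Arc.

Lemma co_le_enorm n (u : 'rV[R]_n.+1) k : (k <= n)%N -> `|co u k| <= enorm u.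
Proof.
move=> kn; rewrite -sqrtr_sqr ler_wsqrtr // dotE.
rewrite (bigD1 (Ordinal (kn : (k < n.+1)%N))) //= expr2 lerDl.
by apply: sumr_ge0 => i _; rewrite -expr2 sqr_ge0.
Qed.

Lemma triple_sub (p a b c d : 'rV[R]_3) :
  triple p a b - triple p c d = triple p (a - c) d + triple p a (b - d).
Proof. by rewrite !tripleE !coD !coN; ring. Qed.

Lemma triple_le (a b c : 'rV[R]_3) : `|triple a b c| <= 6 * (enorm a * enorm b * enorm c).
Proof.
have m i j k : (i <= 2)%N -> (j <= 2)%N -> (k <= 2)%N ->
    `|co a i * co b j * co c k| <= enorm a * enorm b * enorm c.
  move=> i2 j2 k2; rewrite !normrM.
  apply: ler_pM; rewrite ?mulr_ge0 //; last exact: co_le_enorm.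
  by apply: ler_pM => //; exact: co_le_enorm.
have m012 := m 0%N 1%N 2%N erefl erefl erefl; have m021 := m 0%N 2%N 1%N erefl erefl erefl.
have m120 := m 1%N 2%N 0%N erefl erefl erefl; have m102 := m 1%N 0%N 2%N erefl erefl erefl.
have m201 := m 2%N 0%N 1%N erefl erefl erefl; have m210 := m 2%N 1%N 0%N erefl erefl erefl.
rewrite tripleE; move: m012 m021 m120 m102 m201 m210; rewrite !ler_norml.
move=> /andP[? ?] /andP[? ?] /andP[? ?] /andP[? ?] /andP[? ?] /andP[? ?].
apply/andP; split; lra.
Qed.

Lemma dot_le (a b : 'rV[R]_3) : `|dot a b| <= 3 * (enorm a * enorm b).
Proof.
have m i : (i <= 2)%N -> `|co a i * co b i| <= enorm a * enorm b.
  by move=> i2; rewrite normrM; apply: ler_pM => //; exact: co_le_enorm.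
have := m 0%N erefl; have := m 1%N erefl; have := m 2%N erefl.
rewrite dot3E !ler_norml => /andP[? ?] /andP[? ?] /andP[? ?].
apply/andP; split; lra.
Qed.

(** Error bound for a quotient whose denominator is at least m and is perturbed
    by little enough to stay above m/2. *)
Lemma quot_close (N N0 D D0 m M e : R) : 0 < m -> 0 <= M -> 0 <= e -> e <= 1 -> e <= m / 6 ->
  m <= D0 -> `|N0| <= 6 * M -> `|N - N0| <= 6 * (e * (M + 2)) -> `|D - D0| <= 3 * e ->
  `|N / D - N0 / D0| <= (12 * (M + 2) / m + 36 * M / m ^+ 2) * e.
Proof.
move=> m0 M0 e0 e1 em mD0 N0M NN DD.
have Dm : m / 2 <= D by move: DD; rewrite ler_norml => /andP[? ?]; lra.
have D0p : 0 < D0 by lra.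
have Dp : 0 < D by lra.
have Dn : D != 0 by rewrite gt_eqF.
have D0n : D0 != 0 by rewrite gt_eqF.
have mn : m != 0 by rewrite gt_eqF.
have -> : N / D - N0 / D0 = (N - N0) / D - N0 / D0 * ((D - D0) / D) by field; rewrite D0n Dn.
have iD : D^-1 <= 2 / m by rewrite -[leRHS]invf_div lef_pV2 ?posrE ?divr_gt0.
have iD0 : D0^-1 <= m^-1 by rewrite lef_pV2 ?posrE.
apply: le_trans (ler_normB _ _) _.
have A : `|(N - N0) / D| <= 6 * (e * (M + 2)) * (2 / m).
  rewrite normrM normfV (gtr0_norm Dp); apply: ler_pM => //.
  by rewrite invr_ge0 ltW.
have B : `|N0 / D0 * ((D - D0) / D)| <= 6 * M / m * (3 * e * (2 / m)).
  rewrite !normrM !normfV (gtr0_norm Dp) (gtr0_norm D0p).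
  have V0 : 0 <= D0^-1 by rewrite invr_ge0 ltW.
  have V1 : 0 <= D^-1 by rewrite invr_ge0 ltW.
  by apply: ler_pM; rewrite ?mulr_ge0 //; apply: ler_pM.
apply: le_trans (lerD A B) _; rewrite le_eqVlt; apply/orP; left; apply/eqP.
by field.
Qed.

Lemma loop_lower_bound g p : sphere_loop g -> avoids g p ->
  exists2 m, 0 < m & forall x, m <= 1 + dot p (g x).
Proof.
move=> sg av; have [gp _ gC] := sg.
have /C1P[dc _] := C1_dot p gC.
have [|c _ cmin] := @EVT_min _ (fun x => 1 + dot p (g x)) 0 1 ler01.
  by apply: continuous_subspaceT => x; apply: cvgD; [exact: cvg_cst|exact: dc].
exists (1 + dot p (g c)) => [|x]; first exact: av.
have := period_int gp (- Num.floor x) x; rewrite mul1r rmorphN => <-.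
by apply: cmin; rewrite in_itv /=; have := floor_bounds x; lra.
Qed.

Lemma loop_speed_bound g : sphere_loop g -> exists2 M, 0 <= M & forall x, speed g x <= M.
Proof.
move=> sg; have [gp _ /C1_derive1[gd gc]] := sg.
have sc : continuous (speed g).
  move=> x; apply: (@continuous_comp _ _ _ (fun x => dot (derive1 g x) (derive1 g x)) Num.sqrt).
    by apply: continuous_dot; exact: gc.
  exact: sqrt_continuous.
have [|c _ cmax] := @EVT_max _ (speed g) 0 1 ler01.
  by apply: continuous_subspaceT.
exists (speed g c) => [|x]; first exact: enorm_ge0.
have sp y : speed g (y + 1) = speed g y by rewrite /speed (derive1_period gp gd).
have := period_int sp (- Num.floor x) x; rewrite mul1r rmorphN => <-.
by apply: cmax; rewrite in_itv /=; have := floor_bounds x; lra.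
Qed.

(** The cone density is a quotient of functions that are linear in the curve
    and in its derivative, with a denominator bounded below along g. *)
Lemma cone_area_close g p : on_sphere p -> sphere_loop g -> avoids g p ->
  forall e, 0 < e -> exists2 d, 0 < d & forall f, sphere_loop f ->
    (forall x, enorm (f x - g x) <= d) -> (forall x, enorm (derive1 f x - derive1 g x) <= d) ->
    avoids f p /\ `|cone_area p f - cone_area p g| <= e.
Proof.
move=> sp sg av e e0.
have [m m0 mg] := loop_lower_bound sg av.
have [M M0 Mg] := loop_speed_bound sg.
pose C := 12 * (M + 2) / m + 36 * M / m ^+ 2.
have C0 : 0 < C.
  have a1 : 0 <= 36 * M / m ^+ 2 by apply: divr_ge0; [apply: mulr_ge0|exact: sqr_ge0].
  have a2 : 0 < 12 * (M + 2) / m by apply: divr_gt0 => //; apply: mulr_gt0 => //; lra.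
  by rewrite /C; lra.
have sp1 : enorm p = 1 := sp.
pose d := Num.min 1 (Num.min (m / 6) (e / C)).
have d0 : 0 < d by rewrite !lt_min ltr01 !divr_gt0.
have [d1 [dm de]] : d <= 1 /\ d <= m / 6 /\ d <= e / C.
  by rewrite /d !ge_min !lexx !orbT.
exists d => // f sf fg fg'.
have DD x : `|(1 + dot p (f x)) - (1 + dot p (g x))| <= 3 * d.
  have -> : (1 + dot p (f x)) - (1 + dot p (g x)) = dot p (f x - g x).
    by rewrite dotDr -[- g x]scaleN1r dotZr; ring.
  by apply: le_trans (dot_le _ _) _; rewrite sp1 mul1r ler_pM2l.
have avf : avoids f p.
  by move=> x; have := DD x; have := mg x; rewrite ler_norml => ? /andP[? ?]; lra.
split=> //.
have [c _ ->] := prim_diff (cone_density_continuous sf avf) (cone_density_continuous sg av).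
apply: le_trans (_ : C * d <= e); last by rewrite mulrC -ler_pdivlMr.
have [_ gs _] := sg; have gs1 : enorm (g c) = 1 := gs c.
have [_ fs _] := sf; have fs1 : enorm (f c) = 1 := fs c.
have Mc : enorm (derive1 g c) <= M := Mg c.
apply: quot_close => //; first exact: ltW.
- apply: le_trans (triple_le _ _ _) _.
  by rewrite sp1 gs1 !mul1r ler_pM2l.
- have -> : triple p (f c) (derive1 f c) - triple p (g c) (derive1 g c)
    = triple p (f c - g c) (derive1 g c) + triple p (f c) (derive1 f c - derive1 g c).
    exact: triple_sub.
  apply: le_trans (ler_normD _ _) _.
  apply: le_trans (lerD (triple_le _ _ _) (triple_le _ _ _)) _.
  rewrite sp1 fs1 !mul1r -mulrDr ler_pM2l //.
  have h1 : enorm (f c - g c) * enorm (derive1 g c) <= d * M.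
    by apply: ler_pM; rewrite ?enorm_ge0.
  have := fg' c; lra.
Qed.

End Anchored.

(** * Pinkall's lattice *)

Section Pinkall.
Context {R : realType}.
Implicit Types (g : R -> 'rV[R]_3) (z w v : 'rV[R]_2).

Lemma latticeP v1 v2 z : lattice v1 v2 z <-> exists m n : int,
  co z 0 = m%:~R * co v1 0 + n%:~R * co v2 0 /\ co z 1 = m%:~R * co v1 1 + n%:~R * co v2 1.
Proof.
split=> [[m [n ->]]|[m [n [e0 e1]]]]; exists m, n.
  by rewrite -(scaler_int m v1) -(scaler_int n v2) !coD !coZ.
by rewrite -(scaler_int m v1) -(scaler_int n v2); apply: co_ext => -[|[|]] // _; rewrite coD !coZ.
Qed.

Lemma co_pt (a b : R) : co (pt a b) 0 = a /\ co (pt a b) 1 = b.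
Proof. by rewrite /pt !co_rvec. Qed.

Lemma rot2pi_int (k : int) (u : R) q : rot (u + (2 * pi) * k%:~R) q = rot u q.
Proof. by rewrite /rot cos2pi_int sin2pi_int. Qed.

Lemma rot_fix (u u' : R) q : on_sphere q -> rot u q = rot u' q ->
  exists k : int, u = u' + (2 * pi) * k%:~R.
Proof.
move=> /on_sphereP q1 e.
have : dot (rot u' q) (rot u q) = 1 by rewrite e dot_rot.
rewrite dot_rot2 dot_fibre_self q1 mulr1 mulr0 addr0 => /cos_eq1/intrP[k ek].
exists k; rewrite -ek mulrC divfK ?subrKC //.
by rewrite mulf_neq0 // gt_eqF // pi_gt0.
Qed.

Lemma same_fibre_rot (p q : 'rV[R]_4) : on_sphere q -> on_sphere p -> hopf p = hopf q ->
  exists u, p = rot u q.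
Proof.
move=> sq sp e; have [u [cu su]] := circle_angle (fibre_coef sq sp e).
exists u; rewrite /rot cu su; apply: same_fibre => //; exact/on_sphereP.
Qed.

Section Cover.
Variables (g : R -> 'rV[R]_3) (A : R).
Hypothesis cg : closed_curve g.

Local Notation L := (clength g).
Local Notation c := (anchored g).
Local Notation Q := (arc_phase_inv g).

Variables (Y dY : R -> 'rV[R]_4) (alpha : R).
Hypotheses (Y1 : forall x, on_sphere (Y x)) (YC : Ck 1 setT Y)
  (hY : forall x, hopf (Y x) = c x)
  (Yp : forall x, Y (x + 1) = rot (- (alpha / 2)) (Y x))
  (Yd : forall x : R, is_derive x 1 Y (dY x))
  (Yhor : forall x, dot (dY x) (fibre_dir (Y x)) = 0)
  (Aalpha : area_rel A alpha).

(** Arclength of the horizontal lift is half the arclength of the curve, and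
    the anchored curve has period 1 and speed L. *)
Definition cover_arg z : R := 2 * co z 1 / L.
(** The group of fibre rotations acts on a horizontal lift Y of the curve:
    coordinate 0 is the rotation angle, coordinate 1 the arclength of Y. *)
Definition cover z : 'rV[R]_4 := rot (co z 0) (Y (cover_arg z)).
Definition cover_base z : R := Q (cover_arg z).

Let L0 : 0 < L. Proof. exact: clength_gt0. Qed.
Let Ln : L != 0. Proof. by rewrite gt_eqF. Qed.

Lemma cover_arg_lin (h : R) z v : cover_arg (h *: v + z) = h * cover_arg v + cover_arg z.
Proof. by rewrite /cover_arg coD coZ; ring. Qed.

Lemma co_lin k (h : R) z v : co (h *: v + z) k = h * co v k + co z k.
Proof. by rewrite coD coZ. Qed.

Lemma Y_int (n : int) x : Y (x + n%:~R) = rot (- (alpha / 2) * n%:~R) (Y x).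
Proof.
have per y : rot (alpha / 2 * (y + 1)) (Y (y + 1)) = rot (alpha / 2 * y) (Y y).
  by rewrite Yp rotD; congr (rot _ _); ring.
have := @period_int R _ (fun y => rot (alpha / 2 * y) (Y y)) 1 per n x.
rewrite mul1r => e.
have := congr1 (rot (- (alpha / 2 * (x + n%:~R)))) e.
rewrite !rotD addNr.
have -> : - (alpha / 2 * (x + n%:~R)) + alpha / 2 * x = - (alpha / 2) * n%:~R by ring.
by move=> <-; rewrite /rot cos0 sin0 scale1r scale0r addr0.
Qed.

Lemma Q_int (n : int) y : Q (y + n%:~R) = Q y + n%:~R.
Proof. by apply: (phase_inj cg); rewrite (phase_int cg) !(arc_phase_invK cg). Qed.

Lemma cover_derive z v : is_derive z v cover
  (rot (co z 0) (cover_arg v *: dY (cover_arg z) + co v 0 *: fibre_dir (Y (cover_arg z)))).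
Proof.
have d0 : is_derive z v (fun z => co z 0) (co v 0).
  have h := is_derive_id (co z 0) (1 : R).
  have := @is_derive_comp_linear R _ (fun z => co z 0) id z v 1 (co_lin 0) h.
  by rewrite mulr1.
have dYz : is_derive z v (fun z => Y (cover_arg z)) (cover_arg v *: dY (cover_arg z)).
  apply/is_derive_coP => k k3; rewrite coZ.
  have /is_derive_coP/(_ k k3) h := Yd (cover_arg z).
  exact: (@is_derive_comp_linear R _ cover_arg (fun y => co (Y y) k) z v _ cover_arg_lin h).
exact: is_derive_rot d0 dYz.
Qed.

Lemma co_delta (j : 'I_2) k : (k <= 1)%N ->
  co (delta_mx 0 j : 'rV[R]_2) k = (k == j)%:R.
Proof. by move=> k1; rewrite /co mxE eqxx /= -val_eqE /= inordK. Qed.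

Lemma delta0 : cover_arg (delta_mx 0 0 : 'rV[R]_2) = 0 /\ co (delta_mx 0 0 : 'rV[R]_2) 0 = 1.
Proof. by rewrite /cover_arg !co_delta //= mulr0 mul0r. Qed.

Lemma delta1 : cover_arg (delta_mx 0 1 : 'rV[R]_2) = 2 / L /\ co (delta_mx 0 1 : 'rV[R]_2) 0 = 0.
Proof. by rewrite /cover_arg !co_delta //= mulr1. Qed.

Lemma cover_pd0 z : pd 0 cover z = fibre_dir (cover z).
Proof.
rewrite /pd; have [_ ->] := cover_derive z (delta_mx 0 0).
by have [-> ->] := delta0; rewrite scale0r add0r scale1r fibre_rot.
Qed.

Lemma cover_pd1 z : pd 1 cover z = rot (co z 0) ((2 / L) *: dY (cover_arg z)).
Proof.
rewrite /pd; have [_ ->] := cover_derive z (delta_mx 0 1).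
by have [-> ->] := delta1; rewrite scale0r addr0.
Qed.

Lemma hopf_cover z : hopf (cover z) = g (cover_base z).
Proof. by rewrite hopf_rot hY. Qed.

Lemma dY_norm y : dot (dY y) (dY y) = L ^+ 2 / 4.
Proof.
have d1 := is_derive_hopf (Yd y); rewrite (_ : (fun y => _) = c) in d1; last by apply/funext => x; exact: hY.
have := dot_dhopf (Y y) (dY y); rewrite Yhor -(is_derive_derive1 d1) -enorm2 -/(speed c y).
rewrite (anchored_speed cg); have /on_sphereP -> := Y1 y.
by move=> ->; field.
Qed.

(** The two partial derivatives are the unit fibre direction and the unit
    velocity of a horizontal curve. *)
Lemma cover_metric z : metric cover z = 1%:M.
Proof.
apply/matrixP => i j; rewrite !mxE.
have sphc : dot (cover z) (cover z) = 1 by rewrite dot_rot; apply/on_sphereP.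
have e00 : dot (pd 0 cover z) (pd 0 cover z) = 1 by rewrite cover_pd0 dot_fibre.
have e01 : dot (pd 0 cover z) (pd 1 cover z) = 0.
  by rewrite cover_pd0 cover_pd1 /cover fibre_rot dot_rot dotZr dotC Yhor mulr0.
have e11 : dot (pd 1 cover z) (pd 1 cover z) = 1.
  by rewrite cover_pd1 dot_rot dotZl dotZr dY_norm; field.
have ord2 (k : 'I_2) : k = 0 \/ k = 1.
  by case: k => -[|[|]] // kk; [left|right]; apply/val_inj.
case: (ord2 i) => ->; case: (ord2 j) => ->.
- by rewrite e00 eqxx.
- by rewrite e01.
- by rewrite dotC e01.
- by rewrite e11 eqxx.
Qed.

Lemma cover_orient z : 0 < dot (pd 1 (hopf \o cover) z) (derive1 g (cover_base z)).
Proof.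
have hc : hopf \o cover = c \o cover_arg by apply/funext => x /=; rewrite hopf_rot hY.
have -> : pd 1 (hopf \o cover) z =
  (2 / L) *: ((L / speed g (cover_base z)) *: derive1 g (cover_base z)).
  rewrite /pd hc; apply: (fun h => @derive_val _ _ _ _ _ _ _ h).
  apply/is_derive_coP => k k2; rewrite coZ.
  have /is_derive_coP/(_ k k2) h := derive_anchored cg (cover_arg z).
  have := @is_derive_comp_linear R _ cover_arg (fun y => co (c y) k) z (delta_mx 0 1) _ cover_arg_lin h.
  by have [-> _] := delta1.
rewrite !dotZl -enorm2 -/(speed _ _).
have s0 := speed_gt0 cg (cover_base z).
apply: mulr_gt0; first exact: divr_gt0.
by apply: mulr_gt0; [exact: divr_gt0|exact: exprn_gt0].
Qed.

Lemma continuous_affine (T : topologicalType) (f : T -> R) a b : continuous f ->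
  continuous (fun x => a * f x * b).
Proof.
move=> fc x; apply: cvgM; last exact: cvg_cst.
by apply: cvgM; [exact: cvg_cst|exact: fc].
Qed.

Lemma co_continuous k : continuous (fun z : 'rV[R]_2 => co z k : R).
Proof. by move=> z; exact: coord_continuous. Qed.

Lemma C1_cover_arg : Ck 1 setT (cover_arg : 'rV[R]_2 -> R).
Proof.
have ac : continuous (fun z : 'rV[R]_2 => 2 * co z 1 * L^-1 : R).
  exact/continuous_affine/co_continuous.
by apply: C1_linear; [exact: ac|exact: cover_arg_lin].
Qed.

Lemma C1_cover : Ck 1 setT cover.
Proof.
have c0 : Ck 1 setT (fun z : 'rV[R]_2 => co z 0 : R).
  by apply: C1_linear; [exact: co_continuous|exact: co_lin].
have Yk : forall k, (k <= 3)%N -> Ck 1 setT (fun z : 'rV[R]_2 => co (Y (cover_arg z)) k : R).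
  move=> k k3; move/C1_coP : YC => /(_ k k3)/C1_derive1[Fd Fc].
  apply: (@C1_comp R _ (fun y => co (Y y) k) _ cover_arg C1_cover_arg (fun x => Fd (cover_arg x))).
  by move=> x; exact: Fc.
have fk : forall k, (k <= 3)%N -> Ck 1 setT (fun z : 'rV[R]_2 => co (fibre_dir (Y (cover_arg z))) k : R).
  apply: forall_le3; under eq_fun do rewrite co_rvec //=.
  - by apply: C1_opp; exact: (Yk 1%N).
  - exact: (Yk 0%N).
  - by apply: C1_opp; exact: (Yk 3%N).
  - exact: (Yk 2%N).
apply/C1_coP => k k3; rewrite /cover /rot.
under eq_fun do rewrite coD (coZ _ (Y _)) (coZ _ (fibre_dir _)).
apply: C1_add; apply: C1_mul;
  [apply: C1_cos; exact: c0|exact: Yk|apply: C1_sin; exact: c0|exact: fk].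
Qed.

Lemma C1_cover_base : Ck 1 setT (cover_base : 'rV[R]_2 -> R).
Proof.
apply: (@C1_comp R _ Q _ cover_arg C1_cover_arg (fun x => derive_arc_phase_inv cg (cover_arg x))).
by move=> x; exact: (@arc_phase_inv_slope_continuous _ _ cg (cover_arg x)).
Qed.

(** Going once around the curve multiplies Y by the holonomy exp (- i alpha / 2),
    which the translation by A / 2 in the fibre coordinate compensates. *)
Lemma cover_torus : hopf_torus_cover g (lattice hopf_gen1 (hopf_gen2 A L)) cover_base cover.
Proof.
(* A real area of the curve may differ from alpha by a multiple 4 pi k: one turn
   around the curve then costs k additional turns of the fibre. *)
have [k ek] : exists k : int, A = alpha + (4 * pi) * k%:~R.
  move/intrP : Aalpha => [k e]; exists k; rewrite -e mulrC divfK ?subrKC //.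
  by rewrite mulf_neq0 // gt_eqF // pi_gt0.
have [g10 g11] := co_pt (2 * pi) 0; have [g20 g21] := co_pt (A / 2) (L / 2).
split.
- by move=> z; apply/on_sphereP; rewrite dot_rot; apply/on_sphereP.
- exact: hopf_cover.
- move=> z w; split.
  + move=> /latticeP[m [n]]; rewrite g10 g11 g20 g21 !coD !coN => -[e0 e1].
    have ea : cover_arg z = cover_arg w + n%:~R.
      have -> : cover_arg z = cover_arg w + 2 * (co z 1 - co w 1) / L by rewrite /cover_arg; ring.
      by rewrite e1; field.
    split; last by rewrite /cover_base ea Q_int addrAC subrr add0r intr_int.
    rewrite /cover ea Y_int rotD -[RHS](rot2pi_int (m + n * k)); congr (rot _ _).
    have -> : co z 0 = co w 0 + (co z 0 - co w 0) by ring.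
    rewrite e0 ek rmorphD rmorphM /=; by move: (pi) => P; field.
  + move=> [eX hi]; apply/latticeP; have /intrP[n en] := hi.
    have ea : cover_arg z = cover_arg w + n%:~R.
      rewrite -(arc_phase_invK cg (cover_arg z)) -(arc_phase_invK cg (cover_arg w)) -(phase_int cg).
      by congr (phase _ _); move: en; rewrite /cover_base; lra.
    move: eX; rewrite /cover ea Y_int rotD => /(rot_fix (Y1 _))[j ej].
    exists (j - n * k), n; rewrite g10 g11 g20 g21 !coD !coN; split.
      rewrite (_ : co z 0 = co w 0 + 2 * pi * j%:~R + alpha / 2 * n%:~R); last by rewrite -ej; ring.
      rewrite ek rmorphB rmorphM /=; by move: (pi) => P; field.
    rewrite mulr0 add0r.
    have -> : co z 1 - co w 1 = (cover_arg z - cover_arg w) * (L / 2) by rewrite /cover_arg; field.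
    by rewrite ea; ring.
- move=> x p sp hp.
  have [u ->] : exists u, p = rot u (Y (phase g x)).
    by apply: same_fibre_rot => //; rewrite hY /anchored /= (phaseK cg).
  exists (pt u (L / 2 * phase g x)).
    have [e0 e1] := co_pt u (L / 2 * phase g x).
    by rewrite /cover /cover_arg e0 e1; congr (rot _ (Y _)); field.
  have [e0 e1] := co_pt u (L / 2 * phase g x).
  rewrite /cover_base /cover_arg e1 (_ : 2 * _ / L = phase g x); last by field.
  by rewrite (phaseK cg) subrr.
Qed.

End Cover.

Lemma Pinkall_of_curve g (A : R) : closed_curve g -> mod4pi A = area_class g ->
  Pinkall_lattice g (lattice hopf_gen1 (hopf_gen2 A (clength g))).
Proof.
move=> cg gA; have sc := anchored_loop cg.
have [p sp av] := exists_avoids (closed_curve_loop cg).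
have avc : avoids (anchored g) p by move=> x; exact: av.
have [q sq eq] := hopf_surj sp; rewrite -eq in avc.
have Aal : area_rel A (cone_area (hopf q) (anchored g)).
  apply/mod4piP; rewrite gA eq (cone_area_anchored cg av).
  exact: area_class_cone (closed_curve_loop cg) sp av.
have h (x : R) : exists d, is_derive x 1 (hlift q (anchored g)) d /\
    dot d (fibre_dir (hlift q (anchored g) x)) = 0.
  by have [d d1 d2] := hlift_derive sq sc avc x; exists d.
have [dY hd] := choice h.
have Yd x := (hd x).1; have Yhor x := (hd x).2.
have Y1 := sphere_hlift sq sc avc.
have hY := hopf_hlift sq sc avc.
have YC := C1_hlift sc avc.
have Yp := hlift_period sc avc.
exists (cover_base g), (cover g (hlift q (anchored g))); split.
- exact: C1_cover_base.
- exact: C1_cover.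
- exact: (cover_torus cg Y1 hY Yp Aal).
- exact: (cover_pd0 g Yd).
- by move=> z; split; [exact: (cover_metric cg Y1 hY Yd Yhor)|exact: (cover_orient cg hY)].
Qed.

End Pinkall.

(** * Uniformization of the Hopf torus of an embedded curve *)

Section Uniformization.
Context {R : realType}.
Implicit Types (g : R -> 'rV[R]_3) (z w v : 'rV[R]_2).

Lemma fourpi_gt0 : 0 < 4 * pi :> R.
Proof. by rewrite mulr_gt0 // pi_gt0. Qed.

Lemma complex_div_real (a b r : R) : r != 0 ->
  (a +i* b)%C / (r%:C)%C = (a / r +i* (b / r))%C.
Proof.
move=> r0; apply: (@mulIf _ (r%:C)%C); first by rewrite eq_complex /= eqxx andbT.
rewrite mulfVK; last by rewrite eq_complex /= eqxx andbT.
apply/eqP; rewrite eq_complex /=; apply/andP; split; apply/eqP; by field.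
Qed.

Lemma hopf_modulusE (A L : R) : hopf_modulus A L = (A / (4 * pi) +i* (L / (4 * pi)))%C.
Proof. by rewrite /hopf_modulus complex_div_real // gt_eqF // fourpi_gt0. Qed.

Lemma upper_hopf_modulus (A L : R) : 0 < L -> upper (hopf_modulus A L).
Proof. by move=> L0; rewrite hopf_modulusE /upper /= divr_gt0 // fourpi_gt0. Qed.

Lemma lattice_modulusE (A L : R) :
  lattice_modulus hopf_gen1 (hopf_gen2 A L) = hopf_modulus A L.
Proof.
rewrite hopf_modulusE /lattice_modulus /complex_of_pt /hopf_gen1 /hopf_gen2.
have [-> ->] := co_pt (2 * pi : R) 0; have [-> ->] := co_pt (A / 2) (L / 2).
rewrite -[(2 * pi +i* 0)%C]/((2 * pi)%:C)%C complex_div_real; last first.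
  by rewrite mulf_neq0 // gt_eqF // pi_gt0.
have pi0 : (pi : R) != 0 by rewrite gt_eqF // pi_gt0.
move: pi0; move: (pi : R) => P P0.
by apply/eqP; rewrite eq_complex /=; apply/andP; split; apply/eqP; field.
Qed.

Lemma derive_dilate (W : normedModType R) (f : 'rV[R]_2 -> W) (c : R) z v d :
  is_derive (c *: z) v f d -> is_derive z v (fun z => f (c *: z)) (c *: d).
Proof.
move=> /is_derive_line /(is_derive_scale c) /is_derive_line h; apply/is_derive_line.
congr (is_derive _ _ _ _): h; apply/funext => k; congr f.
by rewrite addr0 scalerDr !scalerA [k *: c]mulrC.
Qed.

Lemma lattice_dilate (A L : R) z w :
  lattice (pt 1 0) (pt (A / (4 * pi)) (L / (4 * pi))) (z - w) <->
  lattice hopf_gen1 (hopf_gen2 A L) ((2 * pi) *: z - (2 * pi) *: w).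
Proof.
rewrite !latticeP /hopf_gen1 /hopf_gen2.
have [-> ->] := co_pt (2 * pi : R) 0; have [-> ->] := co_pt (A / 2) (L / 2).
have [-> ->] := co_pt (1 : R) 0; have [-> ->] := co_pt (A / (4 * pi)) (L / (4 * pi)).
have pi0 : (pi : R) != 0 by rewrite gt_eqF // pi_gt0.
rewrite !(coD, coN, coZ); move: pi0; move: (pi : R) => P P0.
split=> -[m [n [e0 e1]]]; exists m, n; split.
- have -> : 2 * P * co z 0 - 2 * P * co w 0 = 2 * P * (co z 0 - co w 0) by ring.
  by rewrite e0; field.
- have -> : 2 * P * co z 1 - 2 * P * co w 1 = 2 * P * (co z 1 - co w 1) by ring.
  by rewrite e1; field.
- have -> : co z 0 - co w 0 = (2 * P * co z 0 - 2 * P * co w 0) / (2 * P) by field.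
  by rewrite e0; field.
- have -> : co z 1 - co w 1 = (2 * P * co z 1 - 2 * P * co w 1) / (2 * P) by field.
  by rewrite e1; field.
Qed.

Lemma C1_dilate n (X : 'rV[R]_2 -> 'rV[R]_n.+1) (c : R) : Ck 1 setT X ->
  Ck 1 setT (fun z => X (c *: z)).
Proof.
move=> /C1_dest[Xc [dX [Xd dXc]]].
have sc : continuous (fun z : 'rV[R]_2 => c *: z) by move=> z; exact: scaler_continuous.
apply: (@C1_intro R _ _ _ (fun v z => c *: dX v (c *: z))) => [z|v z|v].
- exact: (continuous_comp (sc z) (Xc (c *: z))).
- exact: derive_dilate.
move=> z; have h := continuous_comp (sc z) (dXc v (c *: z)).
exact: (continuous_comp h (@scaler_continuous _ _ c _)).
Qed.

Lemma det2 (M : 'M[R]_2) : \det M = M 0 0 * M 1 1 - M 0 1 * M 1 0.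
Proof.
rewrite (expand_det_row _ 0) !big_ord_recl big_ord0 /cofactor !det_mx11 !mxE /=.
have e0 : (ord0 : 'I_2) = 0 by apply/val_inj.
have e1 : lift (0 : 'I_2) (0 : 'I_1) = 1 by apply/val_inj.
have e2 : lift (1 : 'I_2) (0 : 'I_1) = 0 by apply/val_inj.
have e3 : lift ord0 (ord0 : 'I_1) = 1 :> 'I_2 by apply/val_inj.
rewrite ?e3 ?e0 ?e1 ?e2 /= ?expr0 ?expr1; ring.
Qed.

(** Pinkall's lattice is 2 pi times the lattice of 1 and the modulus; over an
    embedded curve the point of the torus determines the base point. *)
Lemma uniformized_of_Pinkall g (A L : R) : closed_curve g -> embedded g ->
  Pinkall_lattice g (lattice hopf_gen1 (hopf_gen2 A L)) ->
  uniformized_by g (hopf_modulus A L).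
Proof.
move=> cg emb [a [X [aC XC [XS hX LX surjX] X0 XM]]].
have pi20 : 0 < 2 * pi :> R by rewrite mulr_gt0 // pi_gt0.
have [gp _ _ _] := cg.
pose k : R := 2 * pi.
have [Xc [dX [Xd dXc]]] := C1_dest XC.
have pdX i z : pd i X z = dX (delta_mx 0 i) z.
  by rewrite /pd; have [_ ->] := Xd (delta_mx 0 i) z.
have pdk i z : pd i (fun z => X (k *: z)) z = k *: pd i X (k *: z).
  rewrite pdX /pd; exact: (@derive_val _ _ _ _ _ _ _ (derive_dilate (Xd (delta_mx 0 i) (k *: z)))).
have pdh i z : pd i (hopf \o (fun z => X (k *: z))) z = k *: pd i (hopf \o X) (k *: z).
  have hd := is_derive_hopf (Xd (delta_mx 0 i) (k *: z)).
  have -> : pd i (hopf \o X) (k *: z) = dhopf (X (k *: z)) (dX (delta_mx 0 i) (k *: z)).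
    by rewrite /pd; exact: (@derive_val _ _ _ _ _ _ _ hd).
  by rewrite /pd; exact: (@derive_val _ _ _ _ _ _ _ (derive_dilate hd)).
exists (fun z => X (k *: z)); split.
- exact: C1_dilate.
- move=> z w; rewrite hopf_modulusE /= lattice_dilate LX; split=> [[]//|e].
  by split=> //; apply: emb; rewrite -!hX e.
- apply/seteqP; split=> p /=.
    by move=> [z _ <-]; split; [exact: XS|exists (a (k *: z)); rewrite hX].
  move=> [sp [x hp]]; have [z Xz _] := surjX x p sp hp.
  by exists (k^-1 *: z) => //; rewrite scalerA mulfV ?scale1r // gt_eqF.
- move=> z; exists (k ^+ 2); first by rewrite exprn_gt0.
  have [Mz _] := XM (k *: z).
  apply/matrixP => i j; have := congr1 (fun M : 'M[R]_2 => M i j) Mz.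
  rewrite mxE [in X in _ = X]mxE => e.
  rewrite mxE [in RHS]mxE (pdk i z) (pdk j z) dotZl dotZr mulrA -expr2 e.
  by rewrite mulr_natr.
- move=> z x hx; have [Mz or] := XM (k *: z).
  have dx : derive1 g x = derive1 g (a (k *: z)).
    have /emb/intrP[n en] : g (a (k *: z)) = g x by rewrite -hX.
    have gd := sphere_loop_derive (closed_curve_loop cg).
    have := period_int (derive1_period gp gd) n x; rewrite mul1r -en.
    by rewrite subrKC => ->.
  have M00 : dot (pd 0 X (k *: z)) (pd 0 X (k *: z)) = 1.
    by have := congr1 (fun M : 'M[R]_2 => M 0 0) Mz; rewrite !mxE.
  have M10 : dot (pd 1 X (k *: z)) (pd 0 X (k *: z)) = 0.
    by have := congr1 (fun M : 'M[R]_2 => M 1 0) Mz; rewrite !mxE.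
  have A00 : dot (pd 0 (fun z => X (k *: z)) z) (fibre_dir (X (k *: z))) = k.
    by rewrite (pdk 0 z) -X0 dotZl M00 mulr1.
  have A10 : dot (pd 1 (fun z => X (k *: z)) z) (fibre_dir (X (k *: z))) = 0.
    by rewrite (pdk 1 z) -X0 dotZl M10 mulr0.
  have A11 : 0 < dot (pd 1 (hopf \o (fun z => X (k *: z))) z) (derive1 g x).
    by rewrite (pdh 1 z) dotZl dx mulr_gt0.
  set M := (\matrix_(i, j) _ : 'M[R]_2).
  have N00 : M 0 0 = k by rewrite mxE; exact: A00.
  have N10 : M 1 0 = 0 by rewrite mxE; exact: A10.
  have N11 : 0 < M 1 1 by rewrite mxE; exact: A11.
  by rewrite det2 N00 N10 mulr0 subr0 mulr_gt0.
Qed.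

End Uniformization.

(** * Topology of the moduli space of tori *)

Section ModuliTopology.
Context {R : realType}.
Local Notation Cn := (R[i] : numFieldType).
Local Notation Re := (@complex.Re R).
Local Notation Im := (@complex.Im R).
Local Open Scope quotient_scope.

Lemma lt_normc (z : R[i]) (r : R) : `|Re z| + `|Im z| < r -> `|z| < (r%:C)%C.
Proof.
rewrite normc_def ltcR; case: z => a b /= h.
have r0 : 0 <= r by apply: le_trans (ltW h); rewrite addr_ge0.
apply: le_lt_trans h.
rewrite -(@ler_pXn2r _ 2) ?nnegrE ?sqrtr_ge0 ?addr_ge0 // sqr_sqrtr ?addr_ge0 ?sqr_ge0 //.
by rewrite sqrrD !real_normK ?num_real // -addrA lerD2l lerDr mulrn_wge0 // mulr_ge0.
Qed.

Lemma normc_lt (z : R[i]) (r : R) : `|z| < (r%:C)%C -> `|Re z| < r /\ `|Im z| < r.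
Proof.
rewrite normc_def ltcR; case: z => a b /= h.
split; apply: le_lt_trans h; rewrite -sqrtr_sqr ler_wsqrtr //.
  by rewrite lerDl sqr_ge0.
by rewrite lerDr sqr_ge0.
Qed.

Lemma ReB (z w : R[i]) : Re (z - w) = Re z - Re w. Proof. by case: z; case: w. Qed.
Lemma ImB (z w : R[i]) : Im (z - w) = Im z - Im w. Proof. by case: z; case: w. Qed.

Lemma cvg_complex (T : Type) (F : set_system T) (FF : Filter F) (f : T -> Cn) (z : Cn) :
  Re (f t) @[t --> F] --> (Re z : R) -> Im (f t) @[t --> F] --> (Im z : R) -> f t @[t --> F] --> z.
Proof.
move=> fr fi; apply/cvgrPdist_lt => e; rewrite ltcE /= => /andP[/eqP ei er].
have e2 : 0 < Re e / 2 by rewrite divr_gt0.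
have -> : e = ((Re e)%:C)%C by apply/eqP; rewrite eq_complex /= ei !eqxx.
move/cvgrPdist_lt : fr => /(_ _ e2) fr; move/cvgrPdist_lt : fi => /(_ _ e2) fi.
near=> t; apply: lt_normc; rewrite ReB ImB (splitr (Re e)); apply: ltrD; near: t.
  exact: fr.
exact: fi.
Unshelve. all: by end_near. Qed.

Lemma Im_continuous : continuous (Im : Cn -> R).
Proof.
move=> z; have FF : Filter (nbhs (z : Cn)) := nbhs_filter (z : Cn); apply/cvgrPdist_lt => e e0.
have ec : 0 < (e%:C)%C by rewrite ltcR.
exists (e%:C)%C => //= w; rewrite /ball_ /= => /normc_lt[_ h].
by rewrite -ImB.
Qed.

Lemma near_upper (z : Cn) : upper z -> \forall w \near z, upper w.
Proof.
move=> uz; have FF : Filter (nbhs (z : Cn)) := nbhs_filter (z : Cn).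
exact: (@cvgr_gt _ _ (nbhs (z : Cn)) FF _ _ (@Im_continuous z) 0 uz).
Qed.

Lemma nbhs_upper (s : upper (R := R)) (B : set (upper (R := R))) :
  nbhs s B <-> exists2 A : set Cn, nbhs (val s : Cn) A & forall v : upper (R := R), A (val v) -> B v.
Proof.
split=> [[_ [[A oA <-] sA AB]]|[A nA AB]].
  by exists A => [|v Av]; [exact: open_nbhs_nbhs|exact: AB].
have h := @initial_continuous _ _ (@set_val _ (upper (R := R))) s A nA.
have FF : Filter (nbhs s) := nbhs_filter s.
by apply: (@filterS _ (nbhs s) FF _ _ _ h) => v; exact: AB.
Qed.

Definition to_upper (z : R[i]) : upper (R := R) :=
  insubd (SigSub (mem_set upper_i) : upper (R := R)) z.

Lemma to_upperK (z : R[i]) : upper z -> val (to_upper z) = z.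
Proof. by move=> uz; rewrite /to_upper val_insubd mem_set. Qed.

Lemma torus_class_cvg (T : Type) (F : set_system T) (FF : Filter F) (f : T -> Cn) (z : Cn) :
  upper z -> f t @[t --> F] --> z -> torus_class (f t) @[t --> F] --> torus_class z.
Proof.
move=> uz fz.
have h : to_upper (f t) @[t --> F] --> (to_upper z : upper (R := R)).
  move=> B /nbhs_upper[A nA AB]; rewrite to_upperK // in nA.
  have fu : F (fun t => upper (f t)) := fz _ (near_upper uz).
  have fA : F (fun t => A (f t)) := fz _ nA.
  suff : F (fun t => B (to_upper (f t))) by [].
  move: fu fA; apply: filterS2 => t ut At; apply: AB.
  by rewrite to_upperK.
exact: (cvg_comp _ _ h (@pi_continuous _ {eq_quot (modular_rel (R := R))} (to_upper z))).
Qed.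

(** If w = (a z + b) / (c z + d) with z = x + i y and w = u + i v, then
    |c z + d|^2 = y / v. This bounds c y and c x + d, hence c and d, and
    then a and b through az + b = w (c z + d). *)
Lemma matrix_bound (x y u v a b c d m K : R) : 0 < m -> m <= y -> y <= K -> m <= v -> v <= K ->
  `|x| <= K -> `|u| <= K -> a * d - b * c = 1 ->
  u * (c * x + d) - v * (c * y) = a * x + b ->
  v * (c * x + d) + u * (c * y) = a * y ->
  let S := K / m + 1 in
  [/\ `|c| <= S / m, `|d| <= S + S / m * K, `|a| <= 2 * K * S / m
    & `|b| <= 2 * K * S + 2 * K * S / m * K].
Proof.
move=> m0 my yK mv vK xK uK det re im S.
set p := c * x + d in re im; set q := c * y in re im.
have y0 : 0 < y by lra.
have v0 : 0 < v by lra.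
have K0 : 0 < K by lra.
have pq : v * (p ^+ 2 + q ^+ 2) = y.
  have -> : v * (p ^+ 2 + q ^+ 2) = (v * p + u * q) * p - (u * p - v * q) * q by ring.
  rewrite re im /p /q -[RHS]mulr1 -det; ring.
have pqS : p ^+ 2 + q ^+ 2 <= K / m.
  rewrite ler_pdivlMr //; apply: le_trans yK; rewrite -pq mulrC ler_wpM2r //.
  by rewrite addr_ge0 ?sqr_ge0.
have sq1 (t : R) : t ^+ 2 <= K / m -> `|t| <= S.
  move=> tS; rewrite leNgt; apply/negP => St.
  have S1 : 1 < S by rewrite /S ltrDr divr_gt0.
  have : S * S < `|t| * `|t| by apply: ltr_pM => //; lra.
  rewrite -[`|t| * _]expr2 real_normK ?num_real //; rewrite {}/S in S1 St *; nra.
have pS : `|p| <= S by apply: sq1; have := sqr_ge0 q; lra.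
have qS : `|q| <= S by apply: sq1; have := sqr_ge0 p; lra.
have S0 : 0 <= S by apply: le_trans pS.
have cS : `|c| <= S / m.
  rewrite ler_pdivlMr //; apply: le_trans qS; rewrite /q normrM (gtr0_norm y0).
  by rewrite ler_wpM2l.
have dS : `|d| <= S + S / m * K.
  have -> : d = p - c * x by rewrite /p; ring.
  apply: le_trans (ler_normB _ _) _; apply: lerD => //; rewrite normrM.
  by apply: ler_pM.
have upS : `|u * p| <= K * S by rewrite normrM; apply: ler_pM.
have uqS : `|u * q| <= K * S by rewrite normrM; apply: ler_pM.
have nv : `|v| <= K by rewrite gtr0_norm.
have vpS : `|v * p| <= K * S by rewrite normrM; apply: ler_pM.
have vqS : `|v * q| <= K * S by rewrite normrM; apply: ler_pM.
have aS : `|a| <= 2 * K * S / m.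
  rewrite ler_pdivlMr //; apply: (@le_trans _ _ (`|a * y|)).
    by rewrite normrM (gtr0_norm y0) ler_wpM2l.
  by rewrite -im; apply: le_trans (ler_normD _ _) _; lra.
split=> //.
have -> : b = (u * p - v * q) - a * x by rewrite re; ring.
apply: le_trans (ler_normB _ _) _; apply: lerD.
  by apply: le_trans (ler_normB _ _) _; lra.
by rewrite normrM; apply: ler_pM.
Qed.

Lemma matrix_bound_near (x0 y0 u0 v0 : R) : 0 < y0 -> 0 < v0 ->
  exists2 m, 0 < m & exists N : nat, forall x y u v a b c d : R,
    `|x - x0| < m -> `|y - y0| < m -> `|u - u0| < m -> `|v - v0| < m ->
    a * d - b * c = 1 ->
    u * (c * x + d) - v * (c * y) = a * x + b ->
    v * (c * x + d) + u * (c * y) = a * y ->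
    [/\ `|a| <= N%:R, `|b| <= N%:R, `|c| <= N%:R & `|d| <= N%:R].
Proof.
move=> y00 v00.
(* The radius m leaves both imaginary parts above m throughout the neighbourhood. *)
pose m := Num.min (Num.min y0 v0) 1 / 2.
pose K := `|x0| + `|u0| + y0 + v0 + 1.
have m0 : 0 < m by rewrite divr_gt0 // !lt_min y00 v00 ltr01.
have [mz [mw m1]] : m + m <= y0 /\ m + m <= v0 /\ m + m <= 1.
  by rewrite -splitr !ge_min !lexx !orbT.
pose S := K / m + 1.
pose B := S / m + (S + S / m * K) + 2 * K * S / m + (2 * K * S + 2 * K * S / m * K).
have nx := normr_ge0 x0; have nu := normr_ge0 u0.
have K1 : 1 <= K by rewrite /K; lra.
have K0 : 0 <= K by lra.
have S0 : 0 <= S by rewrite addr_ge0 // divr_ge0 // ltW.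
have b1 : 0 <= S / m by rewrite divr_ge0 // ltW.
have b2 : 0 <= S + S / m * K by rewrite addr_ge0 // mulr_ge0.
have b30 : 0 <= 2 * K * S by rewrite !mulr_ge0.
have b3 : 0 <= 2 * K * S / m by rewrite divr_ge0 // ltW.
have b4 : 0 <= 2 * K * S + 2 * K * S / m * K by rewrite addr_ge0 // mulr_ge0.
have [q1 q2 q3 q4] : [/\ S / m <= B, S + S / m * K <= B, 2 * K * S / m <= B
    & 2 * K * S + 2 * K * S / m * K <= B].
  rewrite /B; move: (S / m) (S + _) (2 * K * S / m) (2 * K * S + _) b1 b2 b3 b4.
  by move=> B1 B2 B3 B4 *; split; lra.
have B0 : 0 <= B := le_trans b1 q1.
have BN : B <= (Num.truncn B).+1%:R by have /andP[_ /ltW] := truncn_itv B0.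
exists m => //; exists (Num.truncn B).+1 => x y u v a b c d.
rewrite !ltr_norml => /andP[x1 x2] /andP[y1 y2] /andP[u1 u2] /andP[v1 v2] det re im.
have nRz := ler_norm x0; have nRw := ler_norm u0.
have nNRz := ler_norm (- x0); have nNRw := ler_norm (- u0).
rewrite !normrN in nNRz nNRw.
have c1 : m <= y by lra.
have c2 : y <= K by rewrite /K; lra.
have c3 : m <= v by lra.
have c4 : v <= K by rewrite /K; lra.
have c5 : `|x| <= K by rewrite /K ler_norml; apply/andP; split; lra.
have c6 : `|u| <= K by rewrite /K ler_norml; apply/andP; split; lra.
have [cB dB aB bB] := matrix_bound m0 c1 c2 c3 c4 c5 c6 det re im.
rewrite -/S in cB dB aB bB.
split; apply: le_trans BN;
  [exact: le_trans aB q3|exact: le_trans bB q4|exact: le_trans cB q1|exact: le_trans dB q2].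
Qed.

Lemma modular_eq_re (a b c d : int) (z w : R[i]) :
  w * (c%:~R * z + d%:~R) = a%:~R * z + b%:~R ->
  Re w * (c%:~R * Re z + d%:~R) - Im w * (c%:~R * Im z) = a%:~R * Re z + b%:~R /\
  Im w * (c%:~R * Re z + d%:~R) + Re w * (c%:~R * Im z) = a%:~R * Im z.
Proof.
rewrite -!(rmorph_int (real_complex R)); case: z => x y; case: w => u v /= [] e1 e2.
by split; [move: e1|move: e2]; rewrite !(mul0r, subr0, addr0) => h; rewrite -?h; ring.
Qed.

Lemma near_box (z : Cn) (e : R) : 0 < e ->
  \forall x \near z, `|Re x - Re z| < e /\ `|Im x - Im z| < e.
Proof.
move=> e0; have ec : 0 < (e%:C)%C by rewrite ltcR.
exists (e%:C)%C => //= w; rewrite /ball_ /= => /normc_lt[].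
by rewrite ReB ImB distrC (distrC (Im z)).
Qed.

(** Integers bounded by N as a finite type. *)
Lemma int_shift (N : nat) (a : int) : `|a%:~R : R| <= N%:R ->
  exists i : 'I_(N + N).+1, a = (i : nat)%:Z - N%:Z.
Proof.
rewrite -intr_norm -[N%:R]/(N%:Z%:~R) ler_int => h.
have h1 : (absz (a + N%:Z)%R < (N + N).+1)%N by lia.
by exists (Ordinal h1) => /=; lia.
Qed.

Lemma near_linear_neq (K : numFieldType) (T : Type) (F : set_system T) (FF : Filter F)
    (f g : T -> K) (z w a b c d : K) (Q : Prop) :
  f t @[t --> F] --> z -> g t @[t --> F] --> w ->
  (Q -> w * (c * z + d) != a * z + b) ->
  \forall t \near F, Q -> g t * (c * f t + d) != a * f t + b.
Proof.
move=> c1 c2 h; have [q|nq] := pselect Q; last by near=> t => /nq.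
have cf : g t * (c * f t + d) - (a * f t + b) @[t --> F] --> w * (c * z + d) - (a * z + b).
  exact: (cvgB (cvgM c2 (cvgD (cvgM (cvg_cst c) c1) (cvg_cst d)))
      (cvgD (cvgM (cvg_cst a) c1) (cvg_cst b))).
have y0 : 0 < `|w * (c * z + d) - (a * z + b)| by rewrite normr_gt0 subr_eq0 h.
move/cvgrPdist_lt : cf => /(_ _ y0); apply: filterS => t + _.
by rewrite -subr_eq0; apply: contraTneq => ->; rewrite subr0 ltxx.
Unshelve. all: by end_near. Qed.

Lemma cvg_homography (K : numFieldType) (T : Type) (F : set_system T) (FF : Filter F)
    (f : T -> K) (z a b c d : K) : f t @[t --> F] --> z -> c * z + d != 0 ->
  (a * f t + b) / (c * f t + d) @[t --> F] --> (a * z + b) / (c * z + d).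
Proof.
move=> fz den.
exact: (cvgM (cvgD (cvgM (cvg_cst a) fz) (cvg_cst b))
    (cvgV den (cvgD (cvgM (cvg_cst c) fz) (cvg_cst d)))).
Qed.

(** Proper discontinuity of the modular group: only finitely many matrices can
    carry a point near z to a point near w, and each of them that does not
    carry z to w is excluded on a neighbourhood. *)
Lemma modular_separation (z w : Cn) : upper z -> upper w ->
  (forall a b c d : int, a * d - b * c = 1 -> w * (c%:~R * z + d%:~R) != a%:~R * z + b%:~R) ->
  \forall p \near ((z, w) : Cn * Cn), forall a b c d : int, a * d - b * c = 1 ->
    p.2 * (c%:~R * p.1 + d%:~R) != a%:~R * p.1 + b%:~R.
Proof.
move=> uz uw sep.
have [m m0 [N bound]] := matrix_bound_near (Re z) (Re w) uz uw.
pose M := (N + N).+1.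
pose ent (i : 'I_M) : int := (i : nat)%:Z - N%:Z.
have FF : Filter (nbhs ((z, w) : Cn * Cn)) := nbhs_filter ((z, w) : Cn * Cn).
have fin : \forall p \near ((z, w) : Cn * Cn), forall t : 'I_M * 'I_M * 'I_M * 'I_M,
    let a := ent t.1.1.1 in let b := ent t.1.1.2 in let c := ent t.1.2 in let d := ent t.2 in
    a * d - b * c = 1 -> p.2 * (c%:~R * p.1 + d%:~R) != a%:~R * p.1 + b%:~R.
  apply: (@filter_forall _ _ _ (nbhs ((z, w) : Cn * Cn)) FF) => t /=.
  move: (ent t.1.1.1) (ent t.1.1.2) (ent t.1.2) (ent t.2) => a b c d.
  exact: (@near_linear_neq _ _ _ FF fst snd z w _ _ _ _ _ cvg_fst cvg_snd (sep a b c d)).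
have boxz := near_box z m0; have boxw := near_box w m0.
have box : \forall p \near ((z, w) : Cn * Cn),
    (`|Re p.1 - Re z| < m /\ `|Im p.1 - Im z| < m) /\ (`|Re p.2 - Re w| < m /\ `|Im p.2 - Im w| < m).
  by exists ((fun x => `|Re x - Re z| < m /\ `|Im x - Im z| < m),
          (fun x => `|Re x - Re w| < m /\ `|Im x - Im w| < m)) => //= -[p1 p2] [].
apply: (@filterS2 _ (nbhs ((z, w) : Cn * Cn)) FF _ _ _ _ fin box) => -[p1 p2] /= {}fin [[r1 i1] [r2 i2]] a b c d det.
apply/negP => /eqP e.
have [er ei] := modular_eq_re e.
have detR : (a%:~R : R) * d%:~R - b%:~R * c%:~R = 1 by rewrite -!intrM -intrB det.
have [aB bB cB dB] := bound _ _ _ _ _ _ _ _ r1 i1 r2 i2 detR er ei.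
have [j1 aj] := int_shift aB; have [j2 bj] := int_shift bB.
have [j3 cj] := int_shift cB; have [j4 dj] := int_shift dB.
have := fin (j1, j2, j3, j4); rewrite /= /ent -aj -bj -cj -dj => /(_ det).
by rewrite e eqxx.
Qed.

Lemma modular_relP (z w : upper (R := R)) : modular_rel z w <->
  exists a b c d : int, a * d - b * c = 1 /\
    val w * (c%:~R * val z + d%:~R) = a%:~R * val z + b%:~R.
Proof.
split=> [/asboolP|h]; [|apply/asboolP; move: h].
  move=> [a [b [c [d [det ->]]]]]; exists a, b, c, d; split=> //.
  by rewrite mulfVK // (modular_den_neq0 z det).
move=> [a [b [c [d [det e]]]]]; exists a, b, c, d; split=> //.
by rewrite -e mulfK // (modular_den_neq0 z det).
Qed.

Lemma pi_moduliP (z w : upper (R := R)) :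
  \pi_(moduli (R := R)) z = \pi_(moduli (R := R)) w <-> modular_rel z w.
Proof. by split=> /eqmodP h; exact: h. Qed.

(** The projection to the moduli space is open, because the modular group acts
    by homeomorphisms. *)
Lemma image_nbhs (w : upper (R := R)) (U : set Cn) : open U -> U (val w) ->
  nbhs (\pi_(moduli (R := R)) w) [set \pi_(moduli (R := R)) v | v in [set v : upper (R := R) | U (val v)]].
Proof.
move=> oU Uw.
set N := [set _ | _ in _].
suff oN : open N by apply: open_nbhs_nbhs; split => //; exists w.
rewrite /open /= /quotient_open openE => v /= [v' Uv' e].
have /modular_relP[a [b [c [d [det E]]]]] : modular_rel v v'.
  exact/pi_moduliP/esym.
have den := modular_den_neq0 v det.
have FF : Filter (nbhs (val v : Cn)) := nbhs_filter (val v : Cn).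
pose f (x : Cn) : Cn := (a%:~R * x + b%:~R) / (c%:~R * x + d%:~R).
have fv : f (val v) = val v' by rewrite /f -E mulfK.
have fc : f x @[x --> (val v : Cn)] --> f (val v).
  have ci : x @[x --> (val v : Cn)] --> (val v : Cn) by exact: cvg_id.
  exact: (@cvg_homography _ _ _ FF id (val v) _ _ _ _ ci den).
have nU : nbhs (f (val v)) (U `&` [set x | upper x]).
  have h1 : nbhs (val v' : Cn) U := open_nbhs_nbhs (conj oU Uv').
  have h2 : nbhs (val v' : Cn) [set x | upper x] := near_upper (upper_gt0 v').
  have FF' : Filter (nbhs (val v' : Cn)) := nbhs_filter (val v' : Cn).
  by rewrite fv; exact: (@filterI _ _ FF' _ _ h1 h2).
apply/nbhs_upper; exists (f @^-1` (U `&` [set x | upper x])); first exact: fc nU.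
move=> x [Ufx ufx]; exists (to_upper (f (val x))); first by rewrite /= to_upperK.
symmetry; apply/pi_moduliP/modular_relP; exists a, b, c, d; split; first exact: det.
rewrite to_upperK; last exact: ufx.
by rewrite /f mulfVK //; exact: modular_den_neq0 x det.
Qed.

(** Together with the openness of the projection, proper discontinuity gives
    uniqueness of limits in the moduli space. *)
Lemma torus_class_unique (T : Type) (F : set_system T) (FF : ProperFilter F) (f : T -> Cn) (z : Cn)
    (c : moduli (R := R)) : upper z -> f t @[t --> F] --> z ->
  torus_class (f t) @[t --> F] --> c -> c = torus_class z.
Proof.
move=> uz fz fc; apply: contrapT => ne.
pose w := repr c.
have cw : c = \pi_(moduli (R := R)) w by rewrite reprK.
have uw : upper (val w) by exact: upper_gt0.
have sep (a b k d : int) : a * d - b * k = 1 -> val w * (k%:~R * z + d%:~R) != a%:~R * z + b%:~R.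
  move=> det; apply/negP => /eqP e; apply: ne; rewrite cw; symmetry.
  apply/pi_moduliP/modular_relP; exists a, b, k, d; rewrite to_upperK //.
have [[U V] [/= nU nV] UV] := modular_separation uz uw sep.
have [V' [oV' V'w] V'V] : exists2 V' : set Cn, open V' /\ V' (val w) & V' `<=` V.
  by exists (interior V); [split; [exact: open_interior|exact: nV]|exact: interior_subset].
have nN := image_nbhs oV' V'w; rewrite -cw in nN.
have f1 : F (fun t => U (f t)) := fz _ nU.
have f2 : F (fun t => upper (f t)) := fz _ (near_upper uz).
have f3 : F (fun t => [set \pi_(moduli (R := R)) v | v in [set v : upper (R := R) | V' (val v)]] (torus_class (f t))) := fc _ nN.
have /filter_ex[t [[Ut ut] [v Vv ev]]] : \forall t \near F, (U (f t) /\ upper (f t)) /\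
    [set \pi_(moduli (R := R)) v | v in [set v : upper (R := R) | V' (val v)]] (torus_class (f t)).
  by near=> t; split; [split|]; near: t.
have /modular_relP[a [b [k [d [det E]]]]] : modular_rel (to_upper (f t)) v.
  exact/pi_moduliP/esym.
rewrite to_upperK // in E.
by have := UV (f t, val v) (conj Ut (V'V _ Vv)) a b k d det; rewrite /= E eqxx.
Unshelve. all: by end_near. Qed.

Lemma torus_class_compact (z : Cn) : upper z -> exists2 K : set (moduli (R := R)), compact K &
  \forall x \near z, K (torus_class x).
Proof.
move=> uz; have y0 : 0 < Im z := uz.
pose f (q : R * R) : moduli (R := R) := torus_class (q.1 +i* q.2)%C.
pose b := Im z / 2.
have b0 : 0 < b by rewrite divr_gt0.
pose D := `[Re z - b, Re z + b]%classic `*` `[Im z - b, Im z + b]%classic.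
exists (f @` D).
  apply: continuous_compact; last by apply: compact_setX; exact: segment_compact.
  apply: continuous_in_subspaceT => q; rewrite inE => -[_ /=].
  rewrite in_itv /= => /andP[q2 _].
  have uq : upper (q.1 +i* q.2)%C by rewrite /upper /=; move: q2; rewrite /b; lra.
  apply: (@torus_class_cvg _ (nbhs q) _ (fun q : R * R => (q.1 +i* q.2)%C)) => //.
  by apply: cvg_complex; [exact: cvg_fst|exact: cvg_snd].
have := near_box z b0; apply: filterS => x [xr xi].
exists (Re x, Im x); last by rewrite /f /=; case: (x).
by move: xr xi; rewrite !ltr_norml => /andP[? ?] /andP[? ?]; split; rewrite /= in_itv /=; apply/andP; split; lra.
Qed.

End ModuliTopology.

(** * Convergence along the flow *)

Section Convergence.
Context {R : realType}.
Implicit Types (gamma : R -> R -> 'rV[R]_3) (gammaT : R -> 'rV[R]_3).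

Lemma mod4pi_continuous : continuous (mod4pi : R -> Rmod4pi (R := R)).
Proof. exact: pi_continuous. Qed.

Lemma avoids_anchored g (p : 'rV[R]_3) : closed_curve g -> avoids (anchored g) p -> avoids g p.
Proof. by move=> cg av x; have := av (phase g x); rewrite /anchored /= (phaseK cg). Qed.

Lemma near_left_interval (T : R) : 0 < T -> \forall t \near T^'-, 0 <= t < T.
Proof.
move=> T0; near=> t; apply/andP; split; near: t; first exact: nbhs_left_ge.
exact: nbhs_left_lt.
Unshelve. all: by end_near. Qed.

Lemma cone_area_profile_cvg (T : R) gamma gammaT (p : 'rV[R]_3) : 0 < T ->
  (forall t, 0 <= t < T -> closed_curve (gamma t)) -> profile_limit T gamma gammaT ->
  on_sphere p -> avoids gammaT p ->
  (\forall t \near T^'-, avoids (gamma t) p) /\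
  cone_area p (gamma t) @[t --> T^'-] --> cone_area p gammaT.
Proof.
move=> T0 cg [[cgT _ _] _ C1 _ _] sp av.
have sT := closed_curve_loop cgT.
have a4 : 0 < (4^-1 : R) < 2^-1 by apply/andP; split; lra.
have close e : 0 < e -> \forall t \near T^'-, avoids (gamma t) p /\
    `|cone_area p gammaT - cone_area p (gamma t)| <= e.
  move=> e0; have [d d0 h] := cone_area_close sp sT av e0.
  have n1 := C1 _ a4 d d0; have n2 := near_left_interval T0.
  near=> t; have [c0 c1 _] : [/\ forall x, enorm (anchored (gamma t) x - gammaT x) <= d,
        forall x, enorm (derive1 (anchored (gamma t)) x - derive1 gammaT x) <= d
      & forall x y, enorm ((derive1 (anchored (gamma t)) x - derive1 gammaT x)
          - (derive1 (anchored (gamma t)) y - derive1 gammaT y)) <= d * `|x - y| `^ 4^-1].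
    by near: t; exact: n1.
  have ct : closed_curve (gamma t) by apply: cg; near: t; exact: n2.
  have [ava cl] := h _ (anchored_loop ct) c0 c1.
  have avt := avoids_anchored ct ava.
  by split=> //; rewrite distrC -(cone_area_anchored ct avt).
split; first by have := close 1 ltr01; apply: filterS => t [].
by apply/cvgrPdist_le => e e0; have := close e e0; apply: filterS => t [].
Unshelve. all: by end_near. Qed.

Lemma cvg_seq_left (T : R) (u : nat -> R) : (forall n, u n < T) ->
  u n @[n --> \oo] --> T -> u n @[n --> \oo] --> T^'-.
Proof.
move=> uT uc P nP.
have h : \forall n \near \oo, (u n < T -> P (u n)) := uc _ nP.
by move: h; apply: filterS => n; apply; exact: uT.
Qed.

End Convergence.

Theorem corollary6p6 (R : realType) (T : R) (F : R -> 'rV[R]_2 -> 'rV[R]_4)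
    (gamma : R -> R -> 'rV[R]_3) (gammaT : R -> 'rV[R]_3) :
  MIWF T F ->
  Tmax (F 0) = T%:E ->
  (exists gamma0 : R -> 'rV[R]_3,
     [/\ smooth gamma0, closed_curve gamma0 & hopf_parametrization gamma0 (F 0)]) ->
  Willmore (F 0) <= 8 * pi ->
  normal_gauge_profile T F gamma ->
  profile_limit T gamma gammaT ->
  [/\ area_class (gamma t) @[t --> T^'-] --> area_class gammaT,
      (forall AT : R, mod4pi AT = area_class gammaT ->
         exists A : R -> R, compatible_areas T gamma gammaT A AT)
    & forall (A : R -> R) (AT : R), compatible_areas T gamma gammaT A AT ->
      let L := fun t : R => clength (gamma t) in
      let LT := clength gammaT in
      let tau := fun t : R => hopf_modulus (A t) (L t) in
      let tauT := hopf_modulus AT LT in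
      [/\ (\forall t \near T^'-,
             [/\ Pinkall_lattice (gamma t)
                   (lattice hopf_gen1 (hopf_gen2 (A t) (L t))),
                 lattice_modulus hopf_gen1 (hopf_gen2 (A t) (L t)) = tau t
               & upper (tau t)]),
          (tau t : (R[i] : numFieldType)) @[t --> T^'-]
            --> (tauT : (R[i] : numFieldType))
            /\ 4^-1 <= complex.Im tauT <= 2 / pi,
          torus_class (tau t) @[t --> T^'-] --> torus_class tauT
            /\ (forall (u : nat -> R) (c : moduli),
                  (forall n, 0 <= u n < T) -> u n @[n --> \oo] --> T ->
                  (torus_class (tau (u n)) @[n --> \oo] --> c
                   <-> c = torus_class tauT)),
          oriented_conformal_class gammaT (torus_class tauT)
        & exists2 K : set (moduli (R := R)), compact K &
            \forall t \near T^'-, K (torus_class (tau t))]].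
Proof.
move=> [T0 _ _ _] _ _ _ [[_ rf _] _] pl.
have cg t : 0 <= t < T -> closed_curve (gamma t) by move=> /rf[].
have [[cgT emb _] _ _ Lc /andP[Lpi L8]] := pl.
(* one pole for the limit curve serves for all times close to T *)
have [p sp av] := exists_avoids (closed_curve_loop cgT).
have [navt cc] := cone_area_profile_cvg T0 cg pl sp av.
have nt := near_left_interval T0.
have eT : area_class gammaT = mod4pi (cone_area p gammaT).
  exact: area_class_cone (closed_curve_loop cgT) sp av.
have et : \forall t \near T^'-, area_class (gamma t) = mod4pi (cone_area p (gamma t)).
  near=> t; apply: area_class_cone => //; last by near: t.
  by apply: closed_curve_loop; apply: cg; near: t.
split.
- have mc := cvg_comp _ _ cc (@mod4pi_continuous R (cone_area p gammaT)).
  rewrite eT; apply: cvg_trans mc; apply: near_eq_cvg.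
  by near=> t => /=; symmetry; near: t.
- move=> AT eAT; exists (fun t => cone_area p (gamma t) + (AT - cone_area p gammaT)); split=> //.
  + near=> t; rewrite (_ : area_class (gamma t) = mod4pi (cone_area p (gamma t))); last by near: t.
    apply/mod4piP; have /mod4piP : mod4pi AT = mod4pi (cone_area p gammaT) by rewrite eAT.
    by rewrite /area_rel addrAC subrr add0r.
  + rewrite -[X in _ --> X](_ : cone_area p gammaT + (AT - cone_area p gammaT) = AT); last by ring.
    by apply: cvgD => //; exact: cvg_cst.
move=> A AT [nA eAT cA] L LT tau tauT.
have LT0 : 0 < LT by exact: clength_gt0.
have uT : upper tauT by exact: upper_hopf_modulus.
have tc : (tau t : (R[i] : numFieldType)) @[t --> T^'-] --> (tauT : (R[i] : numFieldType)).
  apply: cvg_complex; rewrite /tau /tauT.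
    under eq_fun do rewrite hopf_modulusE; rewrite hopf_modulusE /=.
    by apply: cvgM => //; exact: cvg_cst.
  under eq_fun do rewrite hopf_modulusE; rewrite hopf_modulusE /=.
  by apply: cvgM => //; exact: cvg_cst.
have tcc := torus_class_cvg _ uT tc.
split.
- near=> t.
  have ct : closed_curve (gamma t) by apply: cg; near: t.
  split; [apply: Pinkall_of_curve => //|exact: lattice_modulusE|].
    by near: t.
  by apply: upper_hopf_modulus; exact: clength_gt0.
- split; first exact: tc.
  rewrite /tauT hopf_modulusE /= -/LT.
  have Lpi' : pi <= LT := Lpi; have pi0 := @pi_gt0 R; have p4 := @fourpi_gt0 R.
  rewrite ler_pdivlMr // ler_pdivrMr //; apply/andP; split; first by clear -Lpi'; lra.
  have e8 (P : R) : P != 0 -> 2 / P * (4 * P) = 8 by move=> P0; field.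
  by rewrite e8 // gt_eqF.
- split; first exact: tcc.
  move=> u c u0 uc.
  have ul : u n @[n --> \oo] --> T^'- by apply: cvg_seq_left => // n; have /andP[] := u0 n.
  have tu : (tau (u n) : (R[i] : numFieldType)) @[n --> \oo] --> (tauT : (R[i] : numFieldType)).
    exact: (cvg_comp _ _ ul tc).
  split=> [h|->]; first exact: (torus_class_unique _ uT tu h).
  exact: torus_class_cvg _ uT tu.
- exists tauT; split=> //.
  by apply: uniformized_of_Pinkall => //; exact: Pinkall_of_curve.
- have [K cK nK] := torus_class_compact uT.
  by exists K => //; exact: (tc _ nK).
Unshelve. all: by end_near. Qed.
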